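(* Let smooth initial data (Q) for an $m$-dimensional conjugate net in $\mathbb{R}^N$ be given, and let $f^\epsilon$ ($\epsilon>0$) be the corresponding canonical discrete Q-nets. Then for some $r>0$ the canonical discrete Q-nets $f^\epsilon:\mathcal{B}^\epsilon(r)\to\mathbb{R}^N$ (defined for all sufficiently small $\epsilon>0$) converge, as $\epsilon\to 0$, to the unique conjugate net $f:\mathcal{B}(r)\to\mathbb{R}^N$ with the initial data (Q). The convergence is with the order $O(\epsilon)$ in $C^\infty(\mathcal{B}(r))$.
   Context: Let $N\ge 3$. Coordinate axes and planes: $\mathcal{B}_i=\{u\in\mathbb{R}^m:u_k=0\ \text{for }k\ne i\}$, $\mathcal{B}_{ij}=\{u\in\mathbb{R}^m: u_k=0\ \text{for }k\neq i,j\}$. Put $\mathcal{B}(r)=[0,r]^m$, $\mathcal{B}^\epsilon(r)=(\epsilon\mathbb{Z})^m\cap[0,r]^m$, $\mathcal{B}_i^\epsilon=\mathcal{B}_i\cap(\epsilon\mathbb{Z})^m$, $\mathcal{B}_{ij}^\epsilon=\mathcal{B}_{ij}\cap(\epsilon\mathbb{Z})^m$. On lattices, $(\tau_i f)(u)=f(u+\epsilon e_i)$ and $\delta_i f=\epsilon^{-1}(\tau_i f-f)$; $\delta^\alpha=\delta_1^{\alpha_1}\cdots\delta_m^{\alpha_m}$. Smooth conjugate net: a map $f$ with $\partial_i\partial_j f=c_{ji}\partial_i f+c_{ij}\partial_j f$ for all $i\neq j$, where the real functions $c_{ij}$ satisfy $\partial_i c_{jk}=c_{ij}c_{jk}+c_{ji}c_{ik}-c_{jk}c_{ik}$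 for pairwise distinct $i,j,k$. Initial data (Q): smooth curves $f|_{\mathcal{B}_i}$, $1\le i\le m$, with a common point $f(0)$, and smooth real functions $c_{ij}|_{\mathcal{B}_{ij}}$ for all ordered pairs $i\ne j$. ''The conjugate net with initial data (Q)'' is the solution $(f,c_{ij})$, with these data, of the system consisting of the equations $\partial_i\partial_j f=c_{ji}\partial_i f+c_{ij}\partial_j f$ for all $i\neq j$ and $\partial_i c_{jk}=c_{ij}c_{jk}+c_{ji}c_{ik}-c_{jk}c_{ik}$ for pairwise distinct $i,j,k$. Discrete Q-net (mesh size $\epsilon$): a map $f^\epsilon$ on the lattice with $\delta_i\delta_j f^\epsilon=c^\epsilon_{ji}\delta_i f^\epsilon+c^\epsilon_{ij}\delta_j f^\epsilon$ for $i\ne j$ (i.e. planar elementary quadrilaterals), where $\delta_i c^\epsilon_{jk}=(\tau_k c^\epsilon_{ij})c^\epsilon_{jk}+(\tau_k c^\epsilon_{ji})c^\epsilon_{ik}-(\tau_i c^\epsilon_{jk})c^\epsilon_{ik}$ for pairwise distinct $i,j,k$. Canonical discrete Q-nets for data (Q): the solutions $(f^\epsilon,c^\epsilon_{ij})$ of these discrete Q-net equations (for $f^\epsilon$ and for $c^\epsilon_{jk}$) with $f^\epsilon(u)=f(u)$ for $u\in\mathcal{B}_i^\epsilon$, and $c_{ij}^\epsilon(u)=c_{ij}(u)$ for $u\in\mathcal{B}^\epsilon_{ij}$ (alternatively, $c^\epsilon_{ij}(u)=c_{ij}(u+\frac{\epsilon}{2}e_i+\frac{\epsilon}{2}e_j)$;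 either choice is allowed). Convergence $f^\epsilon\to f$ with the order $O(\epsilon)$ in $C^\infty(\mathcal{B}(r))$ means: for every multi-index $\alpha$ there is a constant $c_\alpha$ such that $|\delta^\alpha(f^\epsilon-f)(u)|\le c_\alpha\epsilon$ for all sufficiently small $\epsilon$ and all $u\in\mathcal{B}^\epsilon(r)$ at which this difference quotient is defined on $\mathcal{B}^\epsilon(r)$ ($f$ being restricted to the lattice). *)

(* Defs.v *)
From mathcomp Require Import all_boot all_order all_algebra.
From mathcomp Require Import all_classical all_reals all_analysis.

Set Implicit Arguments.
Unset Strict Implicit.
Unset Printing Implicit Defensive.

Import Order.TTheory GRing.Theory Num.Theory.
Import numFieldNormedType.Exports.

Local Open Scope classical_set_scope.
Local Open Scope ring_scope.

Section Domains.
Context {R : realType} {m : nat}.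
Implicit Types (i j k : 'I_m) (r eps : R).

Definition basis_vec i : 'rV[R]_m := delta_mx 0 i.

Definition axis i : set 'rV[R]_m := [set u | forall k, k != i -> u 0 k = 0].

Definition coord_plane i j : set 'rV[R]_m :=
  [set u | forall k, k != i -> k != j -> u 0 k = 0].

Definition cube r : set 'rV[R]_m := [set u | forall k, 0 <= u 0 k <= r].

Definition lattice eps : set 'rV[R]_m :=
  [set u | forall k, exists z : int, u 0 k = eps * z%:~R].

Definition lattice_cube eps r : set 'rV[R]_m := lattice eps `&` cube r.

End Domains.

Section Calculus.
Context {R : realType} {m : nat} {W : normedModType R}.
Implicit Types (i : 'I_m) (f : 'rV[R]_m -> W) (A U : set 'rV[R]_m).

Definition partial i f : 'rV[R]_m -> W := 'D_(basis_vec i) f.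

Definition iter_partial (s : seq 'I_m) f : 'rV[R]_m -> W := foldr partial f s.

(* C^oo regularity of the restriction of f to A with respect to the
   coordinates in I.  It is meant for sets A that are relatively open in the
   coordinate subspace spanned by I, where the iterated partial derivatives
   along I only involve the values of f on A. *)
Definition smooth_along (I : {set 'I_m}) A f : Prop :=
  forall s : seq 'I_m, all (fun i => i \in I) s ->
    {within A, continuous (iter_partial s f)} /\
    (forall u, A u -> forall i, i \in I ->
      derivable (iter_partial s f) u (basis_vec i)).

(* On a set that need not be open, such as the closed cube, smooth means
   smooth on some open neighbourhood; at the points of a cube of positive side
   the partial derivatives are determined by the values on the cube. *)
Definition smooth_on A f : Prop :=
  exists U, [/\ open U, A `<=` U & smooth_along [set: 'I_m] U f].

Definition shift_at (eps : R) i f : 'rV[R]_m -> W :=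
  fun u => f (u + eps *: basis_vec i).

Definition diffq (eps : R) i f : 'rV[R]_m -> W :=
  fun u => eps^-1 *: (shift_at eps i f u - f u).

Definition iter_diffq (eps : R) (alpha : 'I_m -> nat) f : 'rV[R]_m -> W :=
  foldr (fun i g => iter (alpha i) (diffq eps i) g) f (enum 'I_m).

(* The difference quotient of order alpha at u only uses lattice points between
   u and u + eps alpha, so it is defined on the lattice cube exactly when both
   of these end points lie in it. *)
Definition cvg_smooth_O_eps (r : R) (feps : R -> 'rV[R]_m -> W) f : Prop :=
  forall alpha : 'I_m -> nat, exists C : R, \forall eps \near 0^'+,
    forall u, lattice_cube eps r u ->
      lattice_cube eps r (u + eps *: \row_k (alpha k)%:R) ->
      `|iter_diffq eps alpha (fun v => feps eps v - f v) u| <= C * eps.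

End Calculus.

Section Nets.
Context {R : realType} {m N : nat}.
Implicit Types (i j k : 'I_m) (r eps : R) (f : 'rV[R]_m -> 'rV[R]_N).
Implicit Types (c : 'I_m -> 'I_m -> 'rV[R]_m -> R).

Local Notation e_ := (@basis_vec R m).

(* Initial data are carried by total functions of which only the values of f0
   on the axes and of c0 i j on the (i, j) coordinate plane, i != j, are ever
   used; the axes share the point f0 0. *)
Definition smooth_data f0 c0 : Prop :=
  (forall i, smooth_along [set i] (axis i) f0) /\
  (forall i j, i != j -> smooth_along [set i; j] (coord_plane i j) (c0 i j)).

Definition conjugate_system r f c : Prop :=
  (forall i j, i != j -> forall u, cube r u ->
     partial i (partial j f) u =
       c j i u *: partial i f u + c i j u *: partial j f u) /\
  (forall i j k, i != j -> j != k -> i != k -> forall u, cube r u ->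
     partial i (c j k) u =
       c i j u * c j k u + c j i u * c i k u - c j k u * c i k u).

Definition conjugate_net_with_data f0 c0 r f c : Prop :=
  [/\ smooth_on (cube r) f /\
      (forall i j, i != j -> smooth_on (cube r) (c i j)),
      conjugate_system r f c,
      forall i u, axis i u -> cube r u -> f u = f0 u &
      forall i j, i != j -> forall u, coord_plane i j u -> cube r u ->
        c i j u = c0 i j u].

(* The coefficients c i j live on the elementary (i, j) squares, indexed by
   their lowest vertex u. *)
Definition square_in eps r i j : set 'rV[R]_m :=
  [set u | lattice_cube eps r u /\
           lattice_cube eps r (u + eps *: e_ i + eps *: e_ j)].

Definition box_in eps r i j k : set 'rV[R]_m :=
  [set u | lattice_cube eps r u /\
           lattice_cube eps r (u + eps *: e_ i + eps *: e_ j + eps *: e_ k)].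

Definition discrete_system eps r f c : Prop :=
  (forall i j, i != j -> forall u, square_in eps r i j u ->
     diffq eps i (diffq eps j f) u =
       c j i u *: diffq eps i f u + c i j u *: diffq eps j f u) /\
  (forall i j k, i != j -> j != k -> i != k ->
     forall u, box_in eps r i j k u ->
     diffq eps i (c j k) u =
       shift_at eps k (c i j) u * c j k u + shift_at eps k (c j i) u * c i k u
       - shift_at eps i (c j k) u * c i k u).

(* The flag selects where the coefficient data are sampled: at the vertex u
   (false) or at the centre of the elementary square (true). *)
Definition sample_point (centred : bool) eps i j (u : 'rV[R]_m) : 'rV[R]_m :=
  if centred then u + (eps / 2) *: e_ i + (eps / 2) *: e_ j else u.

Definition canonical_Qnet (centred : bool) f0 c0 eps r f c : Prop :=
  [/\ discrete_system eps r f c,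
      forall i u, axis i u -> lattice_cube eps r u -> f u = f0 u &
      forall i j, i != j -> forall u, coord_plane i j u ->
        square_in eps r i j u ->
        c i j u = c0 i j (sample_point centred eps i j u)].

End Nets.

(* Main.v *)
(** With the tangent vectors [w_i = d_i f] and the constant 1 as additional unknowns,
    a conjugate net solves a compatible first order system [d_i x_a = sum +- x_b x_c],
    where [i] runs over a set [E a] of directions and [x_a] is prescribed where all
    coordinates in [E a] vanish; a discrete net solves the same system with difference
    quotients in place of derivatives and one factor of each product shifted.

    The smooth net is the limit of Picard iterates which integrate along the coordinates
    in increasing order.  They converge with all derivatives on one cube, because the
    norms [N_(k+1) x = N_k x + mu sum_i N_k (d_i x)] are submultiplicative and close to
    the sup norm for small [mu].  The equations that the chosen paths do not use hold
    because their defects satisfy a homogeneous linear estimate.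

    In terms of Lame and rotation coefficients the discrete equations become an explicit
    multidimensionally consistent recursion, which gives discrete nets bounded uniformly
    in the mesh size.  The difference of a discrete net and the sampled smooth net
    satisfies, in the same norms for difference quotients, the integrated system up to
    consistency and data errors of order [eps], hence is itself of order [eps]. *)

Require Import Defs.
From mathcomp Require Import all_boot all_order all_algebra.
From mathcomp Require Import all_classical all_reals all_analysis.
From mathcomp Require Import ring lra zify.

Set Implicit Arguments.
Unset Strict Implicit.
Unset Printing Implicit Defensive.

Import Order.TTheory GRing.Theory Num.Theory.
Import numFieldNormedType.Exports.

Local Open Scope classical_set_scope.
Local Open Scope ring_scope.

(** * Weighted norms of iterated derivatives and difference quotients *)

Section SupNorm.
Context {R : realType} {T : Type}.
Implicit Types (D : set T) (f : T -> R).

(** The obstacle is that a single [r] must serve every order of differentiation. In the norm of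
    order [k], integration over a cube of radius [rho] has norm at most [rho + mu * k], and smooth
    data have a norm exceeding their sup norm by as little as desired. Since [mu] may depend on [k],
    every smallness condition on the cube involves sup norms only.

    The discrete equations for the coefficients are implicit: shifted unknowns occur on both sides.
    The substitution w_i = h_i v_i, tau_i h_j = (1 + eps c_ij) h_j turns them into tau_j h_i = h_i +
    b_ij tau_i h_j, and likewise for the b_ij. This system can be solved for the shifted values, and
    its b_ij are of order [eps], whence bounds uniform in [eps].

    These bounds hold for the constructed net, whereas convergence is claimed for every family of
    canonical nets; uniqueness of bounded lattice solutions closes the gap. The uniform bound tames
    the term quadratic in the error at order 0; at each higher order, smallness at the preceding
    order does so. *)

Definition bounded_on D f : Prop := exists M, forall u, D u -> `|f u| <= M.

(** [sup] is 0 on an empty or unbounded set of values; hence [0 <= M] in [supn_le], and boundedness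
    is asked for only in [supn_ub]. *)
Definition supn D f : R := sup [set `|f u| | u in D].

Lemma supn_ub D f u : bounded_on D f -> D u -> `|f u| <= supn D f.
Proof.
move=> [M HM] Du; apply: ub_le_sup; last by exists u.
by exists M => _ [v Dv <-]; exact: HM.
Qed.

Lemma supn_ge0 D f : 0 <= supn D f.
Proof.
rewrite /supn; set S := [set _ | _ in _].
have [hs|hs] := pselect (has_sup S); last by rewrite sup_out.
case: hs => [[x Sx] ub]; apply: (@le_trans _ _ x); last exact: ub_le_sup.
by case: Sx => u _ <-.
Qed.

Lemma supn_le D f M : 0 <= M -> (forall u, D u -> `|f u| <= M) -> supn D f <= M.
Proof.
move=> M0 H; rewrite /supn; set S := [set _ | _ in _].
have [->|S0] := eqVneq S set0; first by rewrite sup0.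
apply: ge_sup; first exact/set0P.
by move=> _ [v Dv <-]; exact: H.
Qed.

End SupNorm.

(* The common pattern of partial derivatives of smooth functions on an open cube
   and of difference quotients of lattice functions: [shp] is the shift in the
   discrete product rule (the identity for derivatives), and a level records how
   far a difference quotient reaches, so that [dom] is where it is defined. *)
Record calculus (R : realType) (m : nat) := Calculus {
  pt : Type;
  lvl : Type;
  dom : lvl -> set pt;
  nxt : lvl -> 'I_m -> lvl;
  lel : lvl -> lvl -> Prop;
  shp : 'I_m -> pt -> pt;
  df : 'I_m -> (pt -> R) -> pt -> R;
  good : (pt -> R) -> Prop;
  good_bounded : forall l f, good f -> bounded_on (dom l) f;
  goodD : forall f g, good f -> good g -> good (fun u => f u + g u);
  goodM : forall f g, good f -> good g -> good (fun u => f u * g u);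
  goodC : forall c, good (fun=> c);
  good_df : forall i f, good f -> good (df i f);
  good_shp : forall i f, good f -> good (fun u => f (shp i u));
  df_ext : forall l i f g, good f -> good g -> (forall u, dom l u -> f u = g u) ->
    forall u, dom (nxt l i) u -> df i f u = df i g u;
  dfC : forall i c u, df i (fun=> c) u = 0;
  dfD : forall i f g u, good f -> good g ->
    df i (fun v => f v + g v) u = df i f u + df i g u;
  dfM : forall i f g u, good f -> good g ->
    df i (fun v => f v * g v) u = df i f u * g u + f (shp i u) * df i g u;
  df_shp : forall i j f u, good f ->
    df i (fun v => f (shp j v)) u = df i f (shp j u);
  lel_dom : forall l l', lel l l' -> dom l' `<=` dom l;
  lel_refl : forall l, lel l l;
  lel_nxt : forall l l' i, lel l l' -> lel (nxt l i) (nxt l' i);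
  lel_self : forall l i, lel l (nxt l i);
  dom_shp : forall l i u, dom (nxt l i) u -> dom l (shp i u);
  nxtC : forall l i j, nxt (nxt l i) j = nxt (nxt l j) i }.

Section WeightedNorm.
Context {R : realType} {m : nat} (K : calculus R m) (mu : R).
Hypothesis mu_ge0 : 0 <= mu.
Implicit Types (k : nat) (l : lvl K) (f g : pt K -> R) (s : seq 'I_m).

(* These norms are submultiplicative, and for every fixed [k] they approach the sup
   norm as [mu] tends to 0: this is what makes one and the same cube work for the
   derivatives of all orders. *)
Fixpoint nrm k l f : R :=
  if k is k'.+1 then nrm k' l f + mu * \sum_i nrm k' (nxt l i) (df i f)
  else supn (dom l) f.

Definition dfiter s f : pt K -> R := foldr (@df R m K) f s.

Definition lev l s : lvl K := foldr (fun i l' => nxt l' i) l s.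

Lemma good_dfiter s f : good f -> good (dfiter s f).
Proof. by move=> gf; elim: s => [//|i s IH] /=; exact: good_df. Qed.

Lemma goodZ c f : good f -> good (fun u => c * f u).
Proof. by move=> gf; apply: goodM => //; exact: goodC. Qed.

Lemma goodN f : good f -> good (fun u => - f u).
Proof.
move=> gf; have -> : (fun u => - f u) = (fun u => -1 * f u).
  by apply/funext => u; rewrite mulN1r.
exact: goodZ.
Qed.

Lemma goodB f g : good f -> good g -> good (fun u => f u - g u).
Proof. by move=> gf gg; apply: goodD => //; exact: goodN. Qed.

Lemma good_sum (I : Type) (r : seq I) (F : I -> pt K -> R) :
  (forall i, good (F i)) -> good (fun u => \sum_(i <- r) F i u).
Proof.
move=> gF; elim: r => [|i r IH].
  by rewrite (_ : (fun _ => _) = fun=> 0); [exact: goodC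
    | apply/funext => u; rewrite big_nil].
rewrite (_ : (fun _ => _) = fun u => F i u + \sum_(j <- r) F j u).
  exact: goodD.
by apply/funext => u; rewrite big_cons.
Qed.

Lemma dfZ i c f u : good f -> df i (fun v => c * f v) u = c * df i f u.
Proof. by move=> gf; rewrite dfM ?dfC ?mul0r ?add0r //; exact: goodC. Qed.

Lemma dfB i f g u : good f -> good g ->
  df i (fun v => f v - g v) u = df i f u - df i g u.
Proof.
move=> gf gg; rewrite dfD //; last exact: goodN.
congr (_ + _); rewrite -mulN1r -dfZ //.
by congr (df i _ u); apply/funext => v; rewrite mulN1r.
Qed.

Lemma nrm_ge0 k l f : 0 <= nrm k l f.
Proof.
elim: k l f => [|k IH] l f /=; first exact: supn_ge0.
by rewrite addr_ge0 ?mulr_ge0 ?sumr_ge0.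
Qed.

Lemma nrm_ext k l f g : good f -> good g -> (forall u, dom l u -> f u = g u) ->
  nrm k l f = nrm k l g.
Proof.
elim: k l f g => [|k IH] l f g gf gg fg /=.
  congr sup; rewrite eqEsubset; split => _ [u Du <-]; exists u => //;
    by rewrite fg.
rewrite (IH l f g) //; congr (_ + _ * _); apply: eq_bigr => i _.
by apply: IH; [exact: good_df..| exact: df_ext].
Qed.

Lemma nrm_lel k l l' f : good f -> lel l l' -> nrm k l' f <= nrm k l f.
Proof.
elim: k l l' f => [|k IH] l l' f gf ll' /=.
  apply: supn_le => [|u Du]; first exact: supn_ge0.
  by apply: supn_ub; [exact: good_bounded | exact: (lel_dom ll')].
rewrite lerD ?IH // ler_wpM2l // ler_sum // => i _.
by apply: IH; [exact: good_df | exact: lel_nxt].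
Qed.

Lemma nrmD k l f g : good f -> good g ->
  nrm k l (fun u => f u + g u) <= nrm k l f + nrm k l g.
Proof.
elim: k l f g => [|k IH] l f g gf gg /=.
  apply: supn_le => [|u Du]; first by rewrite addr_ge0 ?supn_ge0.
  by rewrite (le_trans (ler_normD _ _)) // lerD ?supn_ub //; exact: good_bounded.
rewrite addrACA -mulrDr lerD ?IH // ler_wpM2l // -big_split ler_sum // => i _.
rewrite (_ : df i (fun _ => _) = fun u => df i f u + df i g u).
  by apply: IH; exact: good_df.
by apply/funext => u; rewrite dfD.
Qed.

Lemma nrm_shp k l i f : good f -> nrm k (nxt l i) (fun u => f (shp i u)) <= nrm k l f.
Proof.
elim: k l f => [|k IH] l f gf /=.
  apply: supn_le => [|u Du]; first exact: supn_ge0.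
  by apply: supn_ub; [exact: good_bounded | exact: dom_shp].
rewrite lerD ?IH // ler_wpM2l // ler_sum // => j _.
rewrite nxtC (_ : df j _ = fun u => df j f (shp i u)).
  by apply: IH; exact: good_df.
by apply/funext => u; rewrite df_shp.
Qed.

(** The product rule yields all terms of [(F + mu * SF) * (G + mu * SG)] but [mu * SF * (mu * SG)],
    which is nonnegative. The shift in the product rule costs one level, and [nxt l i] provides
    it. *)
Lemma nrmM k l f g : good f -> good g ->
  nrm k l (fun u => f u * g u) <= nrm k l f * nrm k l g.
Proof.
elim: k l f g => [|k IH] l f g gf gg /=.
  apply: supn_le => [|u Du]; first by rewrite mulr_ge0 ?supn_ge0.
  by rewrite normrM ler_pM ?supn_ub //; exact: good_bounded.
set F := nrm k l f; set G := nrm k l g.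
set SF := \sum_i nrm k _ (df i f); set SG := \sum_i nrm k _ (df i g).
have FG : nrm k l (fun u => f u * g u) <= F * G by exact: IH.
have F0 : 0 <= F by exact: nrm_ge0.
have G0 : 0 <= G by exact: nrm_ge0.
have SF0 : 0 <= SF by rewrite sumr_ge0 // => i _; exact: nrm_ge0.
have SG0 : 0 <= SG by rewrite sumr_ge0 // => i _; exact: nrm_ge0.
have S : \sum_i nrm k (nxt l i) (df i (fun u => f u * g u)) <= SF * G + F * SG.
  rewrite mulr_suml mulr_sumr -big_split ler_sum // => i _ /=.
  rewrite (_ : df i _ = fun u => df i f u * g u + f (shp i u) * df i g u); last first.
    by apply/funext => u; rewrite dfM.
  have gd (h : pt K -> R) : good h -> good (df i h) by exact: good_df.
  apply: le_trans (nrmD _ _ (goodM (gd _ gf) gg) (goodM (good_shp i gf) (gd _ gg))) _.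
  rewrite lerD //.
    apply: le_trans (IH _ _ _ (gd _ gf) gg) _.
    by rewrite ler_wpM2l ?nrm_ge0 // nrm_lel //; exact: lel_self.
  apply: le_trans (IH _ _ _ (good_shp i gf) (gd _ gg)) _.
  by rewrite ler_wpM2r ?nrm_ge0 // nrm_shp.
have := ler_wpM2l mu_ge0 S => {}S.
have ss : 0 <= mu * SF * (mu * SG) by rewrite !mulr_ge0.
by apply: le_trans (lerD FG S) _; nra.
Qed.

(* The point of this variant is that each product has only one factor of the
   top order [k.+1]. *)
Lemma nrmMS k l f g : good f -> good g ->
  nrm k.+1 l (fun u => f u * g u) <=
    nrm k l f * nrm k.+1 l g + nrm k.+1 l f * nrm k l g.
Proof.
move=> gf gg /=.
set F := nrm k l f; set G := nrm k l g.
set SF := \sum_i nrm k _ (df i f); set SG := \sum_i nrm k _ (df i g).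
have FG : nrm k l (fun u => f u * g u) <= F * G by exact: nrmM.
have F0 : 0 <= F by exact: nrm_ge0.
have G0 : 0 <= G by exact: nrm_ge0.
have S : \sum_i nrm k (nxt l i) (df i (fun u => f u * g u)) <= SF * G + F * SG.
  rewrite mulr_suml mulr_sumr -big_split ler_sum // => i _ /=.
  rewrite (_ : df i _ = fun u => df i f u * g u + f (shp i u) * df i g u); last first.
    by apply/funext => u; rewrite dfM.
  have gd (h : pt K -> R) : good h -> good (df i h) by exact: good_df.
  apply: le_trans (nrmD _ _ (goodM (gd _ gf) gg) (goodM (good_shp i gf) (gd _ gg))) _.
  rewrite lerD //.
    apply: le_trans (nrmM _ _ (gd _ gf) gg) _.
    by rewrite ler_wpM2l ?nrm_ge0 // nrm_lel //; exact: lel_self.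
  apply: le_trans (nrmM _ _ (good_shp i gf) (gd _ gg)) _.
  by rewrite ler_wpM2r ?nrm_ge0 // nrm_shp.
have := ler_wpM2l mu_ge0 S => {}S.
have ss : 0 <= F * G by rewrite mulr_ge0.
by apply: le_trans (lerD FG S) _; nra.
Qed.

Lemma nrmC k l c : nrm k l (fun=> c) <= `|c|.
Proof.
have z j l' : nrm j l' (fun=> 0) = 0.
  elim: j l' => [|j IH] l' /=.
    by apply/eqP; rewrite eq_le supn_ge0 andbT supn_le // => u _; rewrite normr0.
  rewrite IH big1 ?mulr0 ?addr0 // => i _.
  by rewrite (_ : df i _ = fun=> 0) // ; apply/funext => u; rewrite dfC.
elim: k l => [|k IH] l /=; first exact: supn_le.
rewrite big1 ?mulr0 ?addr0 // => i _.
by rewrite (_ : df i _ = fun=> 0) //; apply/funext => u; rewrite dfC.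
Qed.

Lemma nrmZ k l c f : good f -> nrm k l (fun u => c * f u) <= `|c| * nrm k l f.
Proof.
move=> gf; apply: le_trans (nrmM _ _ (goodC K c) gf) _.
by rewrite ler_wpM2r ?nrm_ge0 // nrmC.
Qed.

Lemma nrmN k l f : good f -> nrm k l (fun u => - f u) <= nrm k l f.
Proof.
move=> gf; rewrite (_ : (fun _ => _) = fun u => -1 * f u); last first.
  by apply/funext => u; rewrite mulN1r.
by apply: le_trans (nrmZ _ _ _ gf) _; rewrite normrN1 mul1r.
Qed.

Lemma nrm_sum k l (I : Type) (r : seq I) (F : I -> pt K -> R) :
  (forall i, good (F i)) ->
  nrm k l (fun u => \sum_(i <- r) F i u) <= \sum_(i <- r) nrm k l (F i).
Proof.
move=> gF; elim: r => [|i r IH].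
  rewrite big_nil (_ : (fun _ => _) = fun=> 0); last first.
    by apply/funext => u; rewrite big_nil.
  by apply: le_trans (nrmC _ _ _) _; rewrite normr0.
rewrite big_cons (_ : (fun _ => _) = fun u => F i u + \sum_(j <- r) F j u); last first.
  by apply/funext => u; rewrite big_cons.
by apply: le_trans (nrmD _ _ _ (good_sum _ gF)) _ => //; rewrite lerD2l.
Qed.

Lemma nrm_leS k l f : nrm k l f <= nrm k.+1 l f.
Proof. by rewrite /= lerDl mulr_ge0 // sumr_ge0 // => i _; exact: nrm_ge0. Qed.

Lemma nrm_le_order j k l f : (j <= k)%N -> nrm j l f <= nrm k l f.
Proof.
elim: k => [|k IH]; first by rewrite leqn0 => /eqP ->.
rewrite leq_eqVlt => /orP[/eqP -> //|]; rewrite ltnS => /IH h.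
exact: le_trans h (nrm_leS _ _ _).
Qed.

Lemma nrm_df k l i f : mu * nrm k (nxt l i) (df i f) <= nrm k.+1 l f.
Proof.
rewrite /= (bigD1 i) //= mulrDr addrCA lerDl addr_ge0 ?nrm_ge0 //.
by rewrite mulr_ge0 // sumr_ge0 // => j _; exact: nrm_ge0.
Qed.

Lemma nrm_pt k l f s u : good f -> (size s <= k)%N -> dom (lev l s) u ->
  mu ^+ size s * `|dfiter s f u| <= nrm k l f.
Proof.
elim: k l f s => [|k IH] l f s gf.
  rewrite leqn0 size_eq0 => /eqP -> /= Du.
  by rewrite expr0 mul1r supn_ub //; exact: good_bounded.
(* [nrm] unfolds the innermost derivative first, and this is the last letter of [s]. *)
case: (lastP s) => [|s' i] sz.
  move=> Du; apply: le_trans (nrm_leS _ _ _).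
  exact: (IH l f [::]).
move: sz; rewrite size_rcons ltnS => sz.
rewrite /lev /dfiter !foldr_rcons => Du.
apply: le_trans (nrm_df _ _ i _); rewrite exprS -mulrA ler_wpM2l //.
by apply: IH => //; exact: good_df.
Qed.

(** Fully expanded, the norm is a sum of sup norms of derivatives of total weight
    [(1 + mu * m%:R) ^+ k]. The function itself has weight 1, so the bound on its derivatives enters
    only with the excess, which is small with [mu]. *)
Lemma nrm_small k l f M0 M : 0 <= M0 -> 0 <= M -> good f ->
  (forall u, dom l u -> `|f u| <= M0) ->
  (forall s u, s != [::] -> (size s <= k)%N -> dom (lev l s) u -> `|dfiter s f u| <= M) ->
  nrm k l f <= M0 + M * ((1 + mu * m%:R) ^+ k - 1).
Proof.
elim: k l f M0 => [|k IH] l f M0 M00 MM0 gf H0 HM.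
  by rewrite expr0 subrr mulr0 addr0 /= supn_le.
have a1 : nrm k l f <= M0 + M * ((1 + mu * m%:R) ^+ k - 1).
  by apply: IH => // s u s0 sk; apply: HM => //; exact: leqW.
have a2 i : nrm k (nxt l i) (df i f) <= M + M * ((1 + mu * m%:R) ^+ k - 1).
  apply: IH => //; first exact: good_df.
    by move=> u Du; apply: (HM [:: i]).
  move=> s u s0 sk Du; have := HM (rcons s i) u.
  rewrite /lev /dfiter !foldr_rcons size_rcons; apply => //.
  by case: (s).
rewrite /=.
have : mu * \sum_(i < m) nrm k (nxt l i) (df i f) <=
    mu * (m%:R * (M * (1 + mu * m%:R) ^+ k)).
  rewrite ler_wpM2l //; apply: le_trans (ler_sum _ (fun i _ => a2 i)) _.
  by rewrite sumr_const card_ord -[leLHS]mulr_natl mulrBr mulr1 addrCA subrr addr0.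
move=> a3; apply: le_trans (lerD a1 a3) _; rewrite exprS.
set X := _ ^+ k; lra.
Qed.

Lemma nrm_le k l f M : 0 <= M -> good f ->
  (forall s u, (size s <= k)%N -> dom (lev l s) u -> `|dfiter s f u| <= M) ->
  nrm k l f <= M * (1 + mu * m%:R) ^+ k.
Proof.
move=> M0 gf H; apply: le_trans (@nrm_small k l f M M _ _ gf _ _) _ => //.
- by move=> u Du; apply: (H [::]).
- by move=> s u _; apply: H.
- by rewrite mulrBr mulr1 addrCA subrr addr0.
Qed.

End WeightedNorm.

(** * Smooth functions on cubes *)

Lemma is_derive_derivable {R : numFieldType} {V W : normedModType R}
  (f : V -> W) a v l : is_derive a v f l -> derivable f a v.
Proof. by case. Qed.

Lemma is_derive_val {R : numFieldType} {V W : normedModType R}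
  (f : V -> W) a v l : is_derive a v f l -> 'D_v f a = l.
Proof. by case. Qed.

Lemma is_derive_scaled_arg {R : realType} (F : R -> R) (h t l : R) :
  is_derive (t * h) 1 F l -> is_derive t 1 (fun s : R => F (s * h)) (h * l).
Proof.
move=> dF.
have d2 : is_derive t 1 (fun t : R => t * h) h.
  have -> : (fun t : R => t * h) = h \*: id.
    by apply/funext => s /=; rewrite mulrC.
  by apply: is_derive_eq; rewrite [_ *: _]mulr1.
by rewrite mulrC; exact: (@is_derive1_comp _ F (fun s : R => s * h) t l h dF d2).
Qed.

Section Lines.
Context {R : realType} {m : nat}.
Implicit Types (i j k : 'I_m) (u v : 'rV[R]_m) (f g : 'rV[R]_m -> R) (s t h C : R).

Local Notation e_ := (@basis_vec R m).

Lemma basisE i k : e_ i 0 k = (k == i)%:R.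
Proof. by rewrite mxE eqxx. Qed.

Lemma lineE u i t k : (u + t *: e_ i) 0 k = u 0 k + t * (k == i)%:R.
Proof. by rewrite 2!mxE basisE. Qed.

Lemma is_derive_line f u i t l :
  is_derive (u + t *: e_ i) (e_ i) f l ->
  is_derive t 1 (fun s : R => f (u + s *: e_ i)) l.
Proof.
have E : (fun h : R => h^-1 *: (((fun s : R => f (u + s *: e_ i)) \o shift t) (h *: 1)
              - f (u + t *: e_ i))) =
         (fun h : R => h^-1 *: ((f \o shift (u + t *: e_ i)) (h *: e_ i)
              - f (u + t *: e_ i))).
  apply/funext => h /=; congr (_ *: (f _ - _)).
  by rewrite [h *: 1]mulr1 scalerDl addrCA.
by move=> [d v]; split; [rewrite /derivable E | rewrite /derive E].
Qed.

Lemma mvt_line f f' u i (h : R) :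
  (forall t, 0 <= t <= 1 ->
    is_derive (u + (t * h) *: e_ i) (e_ i) f (f' (u + (t * h) *: e_ i))) ->
  exists2 t, 0 <= t <= 1 &
    f (u + h *: e_ i) - f u = h * f' (u + (t * h) *: e_ i).
Proof.
move=> H.
pose g t := f (u + (t * h) *: e_ i).
have Dg (t : R) : 0 <= t <= 1 -> is_derive t 1 g (h * f' (u + (t * h) *: e_ i)).
  move=> /H d.
  have := @is_derive_line f u i (t * h) _ d.
  move=> d1.
  exact: (@is_derive_scaled_arg _ (fun s : R => f (u + s *: e_ i))).
have [| |t tI E] := @MVT_segment R g (fun t => h * f' (u + (t * h) *: e_ i)) 0 1 ler01.
- by move=> t; rewrite in_itv /= => /andP[t0 t1]; apply: Dg; rewrite !ltW.
- apply: derivable_within_continuous => t; rewrite in_itv /= => tI.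
  exact: is_derive_derivable (Dg t tI).
exists t; first by move: tI; rewrite in_itv.
by move: E; rewrite /g mul1r mul0r scale0r addr0 subr0 mulr1.
Qed.

Lemma mvt_bound f f' u i (h C : R) :
  (forall t, 0 <= t <= 1 ->
    is_derive (u + (t * h) *: e_ i) (e_ i) f (f' (u + (t * h) *: e_ i))) ->
  (forall t, 0 <= t <= 1 -> `|f' (u + (t * h) *: e_ i)| <= C) ->
  `|f (u + h *: e_ i) - f u| <= `|h| * C.
Proof.
move=> D B; have [t tI ->] := mvt_line D.
by rewrite normrM ler_wpM2l // B.
Qed.

Lemma taylor_bound f f' f'' u i (h C : R) :
  (forall t, 0 <= t <= 1 ->
    is_derive (u + (t * h) *: e_ i) (e_ i) f (f' (u + (t * h) *: e_ i))) ->
  (forall t, 0 <= t <= 1 ->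
    is_derive (u + (t * h) *: e_ i) (e_ i) f' (f'' (u + (t * h) *: e_ i))) ->
  (forall t, 0 <= t <= 1 -> `|f'' (u + (t * h) *: e_ i)| <= C) ->
  `|f (u + h *: e_ i) - f u - h * f' u| <= C * h ^+ 2.
Proof.
move=> D D' B; have [t tI ->] := mvt_line D.
have C0 : 0 <= C by apply: le_trans (B 0 _) => //; rewrite lexx ler01.
rewrite -mulrBr normrM; have /andP[t0 t1] := tI.
have sub s : 0 <= s <= 1 -> 0 <= s * t <= 1.
  by move=> /andP[s0 s1]; rewrite mulr_ge0 //= mulr_ile1.
have M := @mvt_bound f' f'' u i (t * h) C.
lapply M; last by move=> s /sub st; rewrite (mulrA s t h); exact: D' st.
move=> {}M; lapply M; last by move=> s /sub st; rewrite (mulrA s t h); exact: B st.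
move=> {}M.
apply: le_trans (ler_wpM2l _ M) _ => //.
rewrite normrM (ger0_norm t0) -(real_normK (num_real h)).
have : t * (C * `|h| ^+ 2) <= 1 * (C * `|h| ^+ 2).
  by rewrite ler_wpM2r // mulr_ge0 // exprn_ge0.
by rewrite mul1r; apply: le_trans; rewrite le_eqVlt; apply/orP; left; apply/eqP; ring.
Qed.

(** A quadratic remainder estimate is preserved by integrals and pointwise limits. Derivatives under
    the integral sign and derivatives of limits are both obtained by passing [taylor_bound] through
    and concluding with this converse. *)
Lemma is_derive_quadratic f u i l (d C : R) : 0 < d ->
  (forall h, `|h| < d -> `|f (u + h *: e_ i) - f u - h * l| <= C * h ^+ 2) ->
  is_derive u (e_ i) f l.
Proof.
move=> d0 H.
have L : (fun h : R => h^-1 *: ((f \o shift u) (h *: e_ i) - f u)) @ 0^' --> l.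
  apply/cvgrPdist_le => /= e e0.
  near=> h.
  have h0 : h != 0 by near: h; exact: nbhs_dnbhs_neq.
  have hd : `|h| < d by near: h; exact: dnbhs0_lt.
  have hC : `|h| <= e / (`|C| + 1).
    by near: h; apply: dnbhs0_le; rewrite divr_gt0 // ltr_wpDl.
  have E : h^-1 *: (f (h *: e_ i + u) - f u) = h^-1 * (f (u + h *: e_ i) - f u).
    by congr (_ * (f _ - _)); exact: addrC.
  rewrite E distrC.
  have -> : h^-1 * (f (u + h *: e_ i) - f u) - l = h^-1 * (f (u + h *: e_ i) - f u - h * l).
    by field.
  rewrite normrM normfV mulrC ler_pdivrMr ?normr_gt0 //.
  apply: le_trans (H h hd) _; rewrite -(real_normK (num_real h)).
  rewrite expr2 mulrA ler_wpM2r //.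
  move: hC; rewrite ler_pdivlMr ?ltr_wpDl // => hC.
  by have := ler_norm C; have := normr_ge0 h; nra.
by split; [apply/cvg_ex; exists l | exact/cvg_lim].
Unshelve. all: by end_near. Qed.

Lemma is_derive_translate f u w i l :
  is_derive (u + w) (e_ i) f l -> is_derive u (e_ i) (fun v => f (v + w)) l.
Proof.
have E : (fun h : R => h^-1 *: (((fun v => f (v + w)) \o shift u) (h *: e_ i) - f (u + w)))
    = (fun h : R => h^-1 *: ((f \o shift (u + w)) (h *: e_ i) - f (u + w))).
  by apply/funext => h /=; rewrite addrA.
by move=> [d v]; split; [rewrite /derivable E | rewrite /derive E].
Qed.

Lemma is_derive_ext_line f g u i l :
  (forall h, f (u + h *: e_ i) = g (u + h *: e_ i)) ->
  is_derive u (e_ i) f l -> is_derive u (e_ i) g l.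
Proof.
move=> E; have E0 : f u = g u by have := E 0; rewrite scale0r addr0.
have EE : (fun h : R => h^-1 *: ((f \o shift u) (h *: e_ i) - f u)) =
          (fun h : R => h^-1 *: ((g \o shift u) (h *: e_ i) - g u)).
  by apply/funext => h /=; rewrite (addrC (h *: _)) E E0.
by move=> [d v]; split; [rewrite /derivable -EE | rewrite /derive -EE].
Qed.

Definition ocube (rho : R) : set 'rV[R]_m := [set u | forall k, `|u 0 k| < rho].

Lemma ocube_seg rho u i h t : ocube rho u -> ocube rho (u + h *: e_ i) ->
  0 <= t <= 1 -> ocube rho (u + (t * h) *: e_ i).
Proof.
move=> Qu Qv /andP[t0 t1] k; rewrite lineE -mulrA.
have := Qu k; have := Qv k; rewrite lineE !ltr_norml => /andP[a b] /andP[c d].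
set w := h * _ in a b *; set x := u 0 k in a b c d *.
have [t_gt0|t_le0] := ltrP 0 t; last first.
  have -> : t = 0 by apply/eqP; rewrite eq_le t_le0.
  by rewrite mul0r addr0 c d.
have e1 : 0 <= (1 - t) * (x + rho) by rewrite mulr_ge0; lra.
have e2 : 0 < t * (x + w + rho) by rewrite mulr_gt0; lra.
have e3 : 0 <= (1 - t) * (rho - x) by rewrite mulr_ge0; lra.
have e4 : 0 < t * (rho - x - w) by rewrite mulr_gt0; lra.
by apply/andP; split; lra.
Qed.

Lemma ocube_open_line rho u i : ocube rho u ->
  exists2 d : R, 0 < d & forall h, `|h| < d -> ocube rho (u + h *: e_ i).
Proof.
move=> Qu; exists (rho - `|u 0 i|); first by rewrite subr_gt0.
move=> h hd k; rewrite lineE; case: eqP => [->|_]; last by rewrite mulr0 addr0.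
rewrite mulr1; apply: le_lt_trans (ler_normD _ _) _; lra.
Qed.

Lemma ocube_nbhs rho u : ocube rho u -> \forall v \near u, ocube rho v.
Proof.
move=> Qu.
have H k : \forall v \near u, `|(v : 'rV[R]_m) 0 k| < rho.
  have c : (fun v : 'rV[R]_m => v 0 k) @ u --> u 0 k by exact: coord_continuous.
  exact: (cvgr_norm_lt _ c _ (Qu k)).
exact: (@filter_forall _ _ (fun k v => `|v 0 k| < rho) (nbhs u) _ H).
Qed.

Lemma ocube_open rho : open (ocube rho).
Proof. by rewrite openE => u /ocube_nbhs; rewrite /interior /=; apply: filterS. Qed.

Lemma is_derive_ext_ocube rho f g u i l : ocube rho u ->
  (forall v, ocube rho v -> f v = g v) ->
  is_derive u (e_ i) f l -> is_derive u (e_ i) g l.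
Proof.
move=> Qu E; apply: near_eq_is_derive.
by apply: filterS (ocube_nbhs Qu) => v /E.
Qed.

Lemma ocube_open2 rho u i j : ocube rho u ->
  exists2 d : R, 0 < d & forall a b, `|a| < d -> `|b| < d ->
    ocube rho (u + a *: e_ i + b *: e_ j).
Proof.
move=> Qu; pose d := Num.min (rho - `|u 0 i|) (rho - `|u 0 j|) / 2.
have d0 : 0 < d by rewrite divr_gt0 // lt_min !subr_gt0 !Qu.
have di : `|u 0 i| + 2 * d <= rho.
  by rewrite /d mulrC divfK // addrC -lerBrDr ge_min lexx.
have dj : `|u 0 j| + 2 * d <= rho.
  by rewrite /d mulrC divfK // addrC -lerBrDr ge_min lexx orbT.
exists d => // a b ha hb k; rewrite !lineE.
apply: le_lt_trans (ler_normD _ _) _.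
apply: le_lt_trans (lerD (ler_normD _ _) (lexx _)) _.
rewrite !normrM.
have -> : `|(k == i)%:R| = (k == i)%:R :> R by case: eqP => _; rewrite ?normr1 ?normr0.
have -> : `|(k == j)%:R| = (k == j)%:R :> R by case: eqP => _; rewrite ?normr1 ?normr0.
have := Qu k; have [ki|_] := eqVneq k i; have [kj|_] := eqVneq k j;
  rewrite ?mulr1 ?mulr0 => Hk; rewrite -?ki -?kj in di dj; lra.
Qed.

(** The mean value theorem along [i] for [f (v + h *: e_ j) - f v], then along [j] for [fi], gives
    [fij] at a point at distance of order [h] from [u]; bounded third derivatives do the rest. *)
Lemma mixed_quotient rho f fi fij fiji fijj u i j d : ocube rho u -> 0 < d ->
  (forall a b, `|a| < d -> `|b| < d -> ocube rho (u + a *: e_ i + b *: e_ j)) ->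
  (forall v, ocube rho v -> is_derive v (e_ i) f (fi v)) ->
  (forall v, ocube rho v -> is_derive v (e_ j) fi (fij v)) ->
  (forall v, ocube rho v -> is_derive v (e_ i) fij (fiji v)) ->
  (forall v, ocube rho v -> is_derive v (e_ j) fij (fijj v)) ->
  bounded_on (ocube rho) fiji -> bounded_on (ocube rho) fijj ->
  exists C, forall h, `|h| < d ->
    `|f (u + h *: e_ i + h *: e_ j) - f (u + h *: e_ i) - f (u + h *: e_ j) + f u
      - h ^+ 2 * fij u| <= C * `|h| ^+ 3.
Proof.
move=> Qu d0 Qd Di Dij Diji Dijj [B1 HB1] [B2 HB2].
exists (B1 + B2) => h hd.
have th t : 0 <= t <= 1 -> `|t * h| < d.
  move=> /andP[t0 t1]; rewrite normrM (ger0_norm t0) (le_lt_trans _ hd) //.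
  by rewrite ler_piMl.
have Qd1 a : `|a| < d -> ocube rho (u + a *: e_ i).
  by move=> ha; have := Qd a 0 ha; rewrite normr0 scale0r addr0; apply.
pose g := fun v => f (v + h *: e_ j) - f v.
pose g' := fun v => fi (v + h *: e_ j) - fi v.
have [t t01 E] : exists2 t, 0 <= t <= 1 &
    g (u + h *: e_ i) - g u = h * g' (u + (t * h) *: e_ i).
  apply: mvt_line => t t01; rewrite /g /g'.
  apply: (@is_deriveB _ _ _ (fun v => f (v + h *: e_ j)) f).
    apply: is_derive_translate; apply: Di; exact: Qd (th t t01) hd.
  exact: Di (Qd1 _ (th t t01)).
have [s s01 E'] : exists2 s, 0 <= s <= 1 &
    fi (u + (t * h) *: e_ i + h *: e_ j) - fi (u + (t * h) *: e_ i) =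
      h * fij (u + (t * h) *: e_ i + (s * h) *: e_ j).
  apply: mvt_line => s s01.
  apply: Dij; exact: Qd (th t t01) (th s s01).
have M1 : `|fij (u + (t * h) *: e_ i) - fij u| <= `|t * h| * B1.
  have M := @mvt_bound fij fiji u i (t * h) B1.
  lapply M.
    move=> {}M; lapply M; first by move=> {}M.
    move=> w w01; rewrite mulrA; apply: HB1; apply: Qd1; rewrite -mulrA normrM.
    by case/andP: w01 => w0 w1; rewrite (ger0_norm w0) (le_lt_trans _ (th t t01)) // ler_piMl.
  move=> w w01; rewrite mulrA; apply: Diji; apply: Qd1; rewrite -mulrA normrM.
  by case/andP: w01 => w0 w1; rewrite (ger0_norm w0) (le_lt_trans _ (th t t01)) // ler_piMl.
have M2 : `|fij (u + (t * h) *: e_ i + (s * h) *: e_ j) - fij (u + (t * h) *: e_ i)|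
    <= `|s * h| * B2.
  have M := @mvt_bound fij fijj (u + (t * h) *: e_ i) j (s * h) B2.
  lapply M.
    move=> {}M; lapply M; first by move=> {}M.
    move=> w w01; rewrite mulrA; apply: HB2; apply: Qd; first exact: th.
    rewrite -mulrA normrM.
    by case/andP: w01 => w0 w1; rewrite (ger0_norm w0) (le_lt_trans _ (th s s01)) // ler_piMl.
  move=> w w01; rewrite mulrA; apply: Dijj; apply: Qd; first exact: th.
  rewrite -mulrA normrM.
  by case/andP: w01 => w0 w1; rewrite (ger0_norm w0) (le_lt_trans _ (th s s01)) // ler_piMl.
have EE : f (u + h *: e_ i + h *: e_ j) - f (u + h *: e_ i) - f (u + h *: e_ j) + f u
    - h ^+ 2 * fij u
  = h ^+ 2 * ((fij (u + (t * h) *: e_ i + (s * h) *: e_ j) - fij (u + (t * h) *: e_ i))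
     + (fij (u + (t * h) *: e_ i) - fij u)).
  rewrite subrKA mulrBr; congr (_ - _); rewrite expr2 -mulrA -E'.
  by move: E; rewrite /g /g' => <-; ring.
have B10 : 0 <= B1 by apply: le_trans (HB1 _ Qu).
have B20 : 0 <= B2 by apply: le_trans (HB2 _ Qu).
have le1 w : 0 <= w <= 1 -> `|w * h| <= `|h|.
  by case/andP=> w0 w1; rewrite normrM (ger0_norm w0) ler_piMl.
rewrite EE normrM normrX.
have : `|h| ^+ 2 * (`|h| * B2 + `|h| * B1) = (B1 + B2) * `|h| ^+ 3 by ring.
move=> <-; rewrite ler_wpM2l ?exprn_ge0 //.
apply: le_trans (ler_normD _ _) _; apply: lerD.
  by apply: le_trans M2 _; rewrite ler_wpM2r // le1.
by apply: le_trans M1 _; rewrite ler_wpM2r // le1.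
Qed.

(** The second difference of [f] is symmetric in the two directions, and by [mixed_quotient] both
    mixed derivatives equal it divided by [h ^+ 2] up to an error of order [h]. *)
Lemma schwarz_ocube rho f fi fj fij fji fiji fijj fjii fjij u i j : ocube rho u ->
  let D g k g' := forall v, ocube rho v -> is_derive v (e_ k) g (g' v) in
  D f i fi -> D f j fj -> D fi j fij -> D fj i fji ->
  D fij i fiji -> D fij j fijj -> D fji j fjij -> D fji i fjii ->
  bounded_on (ocube rho) fiji -> bounded_on (ocube rho) fijj ->
  bounded_on (ocube rho) fjij -> bounded_on (ocube rho) fjii ->
  fij u = fji u.
Proof.
move=> Qu D; rewrite /D {D} => Di Dj Dij Dji Diji Dijj Djij Djii Biji Bijj Bjij Bjii.
have [d d0 Qd] := ocube_open2 i j Qu.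
have [C1 HC1] := mixed_quotient Qu d0 Qd Di Dij Diji Dijj Biji Bijj.
have Qd' a b : `|a| < d -> `|b| < d -> ocube rho (u + a *: e_ j + b *: e_ i).
  by move=> ha hb; rewrite addrAC; exact: Qd.
have [C2 HC2] := mixed_quotient Qu d0 Qd' Dj Dji Djij Djii Bjij Bjii.
apply/eqP; rewrite -subr_eq0 -normr_le0; apply/ler_addgt0Pr => e e0.
rewrite add0r.
pose h := Num.min (d / 2) (e / (`|C1| + `|C2| + 1)).
have h0 : 0 < h.
  by rewrite lt_min !divr_gt0 // ltr_wpDl // addr_ge0.
have hd : `|h| < d.
  by rewrite gtr0_norm // /h gt_min; apply/orP; left; lra.
have := HC1 h hd; have := HC2 h hd.
rewrite [u + h *: e_ j + h *: e_ i]addrAC.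
set P := f _; set Q := f _; set S := f _; set T := f u => H2 H1.
have h2 : h ^+ 2 * `|fij u - fji u| <= (C1 + C2) * h ^+ 3.
  have h2 : 0 <= h ^+ 2 by rewrite exprn_ge0 // ltW.
  rewrite -{1}(ger0_norm h2) -normrM.
  have -> : h ^+ 2 * (fij u - fji u) =
    (P - Q - S + T - h ^+ 2 * fji u) - (P - S - Q + T - h ^+ 2 * fij u) by ring.
  rewrite (gtr0_norm h0) in H1 H2.
  have := ler_normB (P - Q - S + T - h ^+ 2 * fji u) (P - S - Q + T - h ^+ 2 * fij u).
  by move=> H3; apply: le_trans H3 _; rewrite mulrDl addrC lerD.
have h3 : `|fij u - fji u| <= (C1 + C2) * h.
  rewrite -(ler_pM2l (exprn_gt0 2 h0)); apply: le_trans h2 _.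
  by rewrite le_eqVlt; apply/orP; left; apply/eqP; ring.
apply: le_trans h3 _.
have he : h <= e / (`|C1| + `|C2| + 1) by rewrite /h ge_min lexx orbT.
have n0 : 0 < `|C1| + `|C2| + 1 by rewrite ltr_wpDl // addr_ge0.
move: he; rewrite ler_pdivlMr // => he.
have := ler_norm C1; have := ler_norm C2; nra.
Qed.

End Lines.

(** * Primitives of continuous functions of one variable *)

Lemma mvt1 {R : realType} (F F' : R -> R) (a b : R) :
  (forall t, Num.min a b <= t <= Num.max a b -> is_derive t 1 F (F' t)) ->
  exists2 t, Num.min a b <= t <= Num.max a b & F b - F a = F' t * (b - a).
Proof.
wlog ab : a b / a <= b.
  move=> H; have /orP[ab|ba] := le_total a b; first exact: H.
  rewrite minC maxC => /(H b a ba)[t tab E]; exists t => //.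
  by rewrite -opprB E -mulrN opprB.
rewrite (min_idPl ab) (max_idPr ab) => D.
have [| |t tab E] := @MVT_segment R F F' a b ab.
- by move=> t; rewrite in_itv /= => /andP[t0 t1]; apply: D; rewrite !ltW.
- apply: derivable_within_continuous => t; rewrite in_itv /= => tI.
  exact: is_derive_derivable (D t tI).
by exists t => //; rewrite in_itv in tab.
Qed.

Section Antiderivative.
Context {R : realType}.
Implicit Types (g : R -> R) (x : R).

Local Notation mu := (@lebesgue_measure R).

Lemma antiderivative_from g A : continuous g ->
  exists G : R -> R, forall x, - A < x -> is_derive x 1 G (g x).
Proof.
move=> cg; exists (fun x => \int[mu]_(t in [set` Interval (BLeft (- A)) (BRight x)]) g t)%R.
move=> x Ax.
have [] := @continuous_FTC1 R g (BLeft (- A)) x (x + 1) _ _ _ (cg x).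
- by rewrite ltrDl.
- apply: continuous_compact_integrable; first exact: segment_compact.
  exact: continuous_subspaceT.
- by rewrite /= lte_fin.
by move=> d e; apply: (DeriveDef d); rewrite -derive1E; exact: e.
Qed.

Lemma antiderivative g : continuous g ->
  exists G : R -> R, G 0 = 0 /\ forall x, is_derive x 1 G (g x).
Proof.
move=> cg.
pose F A := sval (cid (antiderivative_from A cg)).
have HF A x : - A < x -> is_derive x 1 (F A) (g x).
  exact: (svalP (cid (antiderivative_from A cg))).
pose G x := F (`|x| + 1) x - F (`|x| + 1) 0.
have GE A x : 0 < A -> - A < x -> G x = F A x - F A 0.
  move=> A0 Ax; have xA : - (`|x| + 1) < x by have := ler_norm (- x); rewrite normrN; lra.
  pose H t := F (`|x| + 1) t - F A t.
  have [|t _] := @mvt1 R H (fun=> 0) 0 x.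
    move=> t /andP[t0 t1]; rewrite -(subrr (g t)).
    apply: is_deriveB; apply: HF.
      apply: lt_le_trans t0; rewrite lt_min xA andbT.
      by have := normr_ge0 x; lra.
    by apply: lt_le_trans t0; rewrite lt_min Ax andbT; lra.
  by rewrite mul0r /H /G => E; lra.
exists G; split; first by rewrite /G subrr.
move=> x; pose A := `|x| + 1.
have A0 : 0 < A by rewrite /A ltr_wpDl.
have Ax : - A < x by have := ler_norm (- x); rewrite normrN /A; lra.
have d : is_derive x 1 (fun t => F A t - F A 0) (g x).
  rewrite -[g x]subr0; apply: is_deriveB; first exact: HF.
apply: near_eq_is_derive d.
near=> t; rewrite (GE A) //.
near: t; exact: lt_nbhsr.
Unshelve. all: by end_near. Qed.

End Antiderivative.

(** * Smooth functions on the whole space and integration along coordinate lines *)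

Section SmoothGlobal.
Context {R : realType} {m : nat}.
Implicit Types (i j : 'I_m) (k : nat) (u v w : 'rV[R]_m) (f g : 'rV[R]_m -> R) (t h C : R).

Local Notation e_ := (@basis_vec R m).

Lemma line_is_derive f w i t l :
  is_derive t 1 (fun s : R => f (w + s *: e_ i)) l -> is_derive (w + t *: e_ i) (e_ i) f l.
Proof.
have E : (fun h : R => h^-1 *: (((fun s : R => f (w + s *: e_ i)) \o shift t) (h *: 1)
              - f (w + t *: e_ i))) =
         (fun h : R => h^-1 *: ((f \o shift (w + t *: e_ i)) (h *: e_ i)
              - f (w + t *: e_ i))).
  apply/funext => h /=; congr (_ *: (f _ - _)).
  by rewrite [h *: 1]mulr1 scalerDl addrCA.
by move=> [d v]; split; [rewrite /derivable -E | rewrite /derive -E].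
Qed.

Lemma partial_is_derive f i u l : is_derive u (e_ i) f l -> partial i f u = l.
Proof. by case. Qed.

Definition locally_bounded f := forall rho, bounded_on (ocube rho) f.

(** Only partial derivatives and bounds on cubes are recorded, which sums, products, projections and
    integrals preserve easily. Continuity follows where it matters, since bounded partial
    derivatives make a function Lipschitz on cubes. *)
Fixpoint smooth_order (k : nat) f : Prop :=
  locally_bounded f /\
  if k is k'.+1 then
    forall i, (forall u, derivable f u (e_ i)) /\ smooth_order k' (partial i f)
  else True.

Definition smoothG f := forall k, smooth_order k f.

Lemma smooth_order_lb k f : smooth_order k f -> locally_bounded f.
Proof. by case: k => [|k]; case. Qed.

Lemma smooth_orderW k f : smooth_order k.+1 f -> smooth_order k f.
Proof.
elim: k f => [|k IH] f [lb H]; split=> // i.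
have [d s] := H i; split=> //; exact: IH.
Qed.

Lemma smooth_orderS k f : locally_bounded f ->
  (forall i, exists2 g, smooth_order k g & forall u, is_derive u (e_ i) f (g u)) ->
  smooth_order k.+1 f.
Proof.
move=> lb H; split=> // i; have [g sg d] := H i; split.
  by move=> u; exact: is_derive_derivable (d u).
rewrite (_ : partial i f = g) //; apply/funext => u.
exact: partial_is_derive.
Qed.

Lemma smooth_order_is_derive k f i u : smooth_order k.+1 f ->
  is_derive u (e_ i) f (partial i f u).
Proof. by move=> [_ /(_ i)[/(_ u) d _]]; exact: derivableP. Qed.

Lemma smooth_order_partial k f i : smooth_order k.+1 f -> smooth_order k (partial i f).
Proof. by move=> [_ /(_ i)[]]. Qed.

Lemma smoothG_lb f : smoothG f -> locally_bounded f.
Proof. by move=> /(_ 0%N) /smooth_order_lb. Qed.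

Lemma smoothG_is_derive f i u : smoothG f -> is_derive u (e_ i) f (partial i f u).
Proof. by move=> /(_ 1%N) H; exact: smooth_order_is_derive H. Qed.

Lemma smoothG_partial f i : smoothG f -> smoothG (partial i f).
Proof. by move=> H k; have [_ /(_ i)[]] := H k.+1. Qed.

Lemma locally_boundedD f g : locally_bounded f -> locally_bounded g ->
  locally_bounded (fun u => f u + g u).
Proof.
move=> lf lg rho; have [M HM] := lf rho; have [N HN] := lg rho.
by exists (M + N) => u Qu; rewrite (le_trans (ler_normD _ _)) // lerD ?HM ?HN.
Qed.

Lemma locally_boundedM f g : locally_bounded f -> locally_bounded g ->
  locally_bounded (fun u => f u * g u).
Proof.
move=> lf lg rho; have [M HM] := lf rho; have [N HN] := lg rho.
by exists (M * N) => u Qu; rewrite normrM ler_pM ?HM ?HN.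
Qed.

Lemma locally_bounded_cst c : locally_bounded (fun=> c).
Proof. by move=> rho; exists `|c|. Qed.

Lemma smooth_order_cst k c : smooth_order k (fun=> c).
Proof.
elim: k c => [|k IH] c; first by split=> //; exact: locally_bounded_cst.
apply: smooth_orderS; first exact: locally_bounded_cst.
by move=> i; exists (fun=> 0) => // u; exact: is_derive_cst.
Qed.

Lemma smooth_orderD k f g : smooth_order k f -> smooth_order k g ->
  smooth_order k (fun u => f u + g u).
Proof.
elim: k f g => [|k IH] f g sf sg.
  by split=> //; apply: locally_boundedD; apply: smooth_order_lb; eassumption.
apply: smooth_orderS.
  by apply: locally_boundedD; apply: smooth_order_lb; eassumption.
move=> i; exists (fun u => partial i f u + partial i g u).
  by apply: IH; exact: smooth_order_partial.
by move=> u; apply: is_deriveD; apply: smooth_order_is_derive; eassumption.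
Qed.

Lemma is_derive_mul f g u i l l' : is_derive u (e_ i) f l -> is_derive u (e_ i) g l' ->
  is_derive u (e_ i) (fun v => f v * g v) (l * g u + f u * l').
Proof.
move=> df dg; have H := is_deriveM df dg.
by apply: is_derive_eq H _; rewrite /GRing.scale /= addrC [g u * l]mulrC.
Qed.

Lemma smooth_orderM k f g : smooth_order k f -> smooth_order k g ->
  smooth_order k (fun u => f u * g u).
Proof.
elim: k f g => [|k IH] f g sf sg.
  by split=> //; apply: locally_boundedM; apply: smooth_order_lb; eassumption.
apply: smooth_orderS.
  by apply: locally_boundedM; apply: smooth_order_lb; eassumption.
move=> i; exists (fun u => partial i f u * g u + f u * partial i g u).
  by apply: smooth_orderD; apply: IH => //;
    (exact: smooth_order_partial || exact: smooth_orderW).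
by move=> u; apply: is_derive_mul; apply: smooth_order_is_derive; eassumption.
Qed.

Lemma smoothGD f g : smoothG f -> smoothG g -> smoothG (fun u => f u + g u).
Proof. by move=> sf sg k; exact: smooth_orderD. Qed.

Lemma smoothGM f g : smoothG f -> smoothG g -> smoothG (fun u => f u * g u).
Proof. by move=> sf sg k; exact: smooth_orderM. Qed.

Lemma smoothG_cst c : smoothG (fun=> c).
Proof. by move=> k; exact: smooth_order_cst. Qed.

Definition cont_calculus (rho : R) : calculus R m.
Proof.
refine (@Calculus R m 'rV[R]_m unit (fun=> ocube rho) (fun l _ => l)
  (fun _ _ => True) (fun _ u => u) (@partial R m R) smoothG
  _ smoothGD smoothGM smoothG_cst _ _ _ _ _ _ _ _ _ _ _ _ _) => //=.
- by move=> _ f /smoothG_lb; exact.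
- by move=> i f; exact: smoothG_partial.
- move=> _ i f g sf sg fg u Qu.
  symmetry; apply: partial_is_derive.
  exact: is_derive_ext_ocube Qu fg (smoothG_is_derive i u sf).
- by move=> i c u; apply: partial_is_derive; exact: is_derive_cst.
- move=> i f g u sf sg; apply: partial_is_derive.
  by apply: is_deriveD; exact: smoothG_is_derive.
- move=> i f g u sf sg; apply: partial_is_derive.
  by apply: is_derive_mul; exact: smoothG_is_derive.
- by move=> _ _ _ u.
Defined.

Definition zer (L : pred 'I_m) u : 'rV[R]_m := \row_k (if L k then 0 else u 0 k).

Lemma zerE L u (k : 'I_m) : zer L u 0 k = if L k then 0 else u 0 k.
Proof. by rewrite mxE. Qed.

Lemma zer_line L u i h : zer L (u + h *: e_ i) = if L i then zer L u else zer L u + h *: e_ i.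
Proof.
apply/rowP => k; case: ifP => Li; rewrite ?lineE !zerE lineE; case: ifP => Lk //.
- by case: eqP => [E|]; [rewrite -E Lk in Li | rewrite mulr0 addr0].
- by case: eqP => [E|]; [rewrite -E Lk in Li | rewrite mulr0 addr0].
Qed.

Lemma zer_idem L u : zer L (zer L u) = zer L u.
Proof. by apply/rowP => j; rewrite !zerE; case: (L j). Qed.

Lemma ocube_zer rho L u : ocube rho u -> ocube rho (zer L u).
Proof.
move=> Qu k; rewrite zerE; case: ifP => _; last exact: Qu.
by rewrite normr0; apply: le_lt_trans (Qu k); rewrite normr_ge0.
Qed.

Lemma is_derive_pull L f g u i :
  (forall v, is_derive v (e_ i) f (g v)) ->
  is_derive u (e_ i) (fun v => f (zer L v)) (if L i then 0 else g (zer L u)).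
Proof.
move=> d; case: ifP => Li.
  apply: (@is_derive_ext_line _ _ (fun=> f (zer L u))).
    by move=> h; rewrite zer_line Li.
have := @is_derive_translate R m f u (zer L u - u) i (g (zer L u)).
rewrite addrC subrK => /(_ (d _)); apply: is_derive_ext_line => h.
by rewrite zer_line Li addrC addrA subrK.
Qed.

Lemma smoothG_pull L f : smoothG f -> smoothG (fun u => f (zer L u)).
Proof.
move=> sf k; elim: k f sf => [|k IH] f sf.
  split=> // rho; have [M HM] := smoothG_lb sf rho.
  by exists M => u Qu; apply: HM; exact: ocube_zer.
apply: smooth_orderS.
  move=> rho; have [M HM] := smoothG_lb sf rho.
  by exists M => u Qu; apply: HM; exact: ocube_zer.
move=> i; exists (fun u => if L i then 0 else partial i f (zer L u)).
  case: (L i); first exact: smooth_order_cst.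
  by apply: IH; exact: smoothG_partial.
by move=> u; apply: is_derive_pull => v; exact: smoothG_is_derive.
Qed.

Lemma partial_pull L f i : smoothG f ->
  partial i (fun u => f (zer L u)) = fun u => if L i then 0 else partial i f (zer L u).
Proof.
move=> sf; apply/funext => u; apply: partial_is_derive.
by apply: is_derive_pull => v; exact: smoothG_is_derive.
Qed.

Definition prim (g : R -> R) : R -> R :=
  if pselect (continuous g) is left H then sval (cid (antiderivative H)) else fun=> 0.

Lemma prim0 (g : R -> R) : continuous g -> prim g 0 = 0.
Proof.
by rewrite /prim; case: pselect => // H _; have [] := svalP (cid (antiderivative H)).
Qed.

Lemma prim_is_derive (g : R -> R) (x : R) : continuous g -> is_derive x 1 (prim g) (g x).
Proof.
rewrite /prim; case: pselect => // H _.
by have [_] := svalP (cid (antiderivative H)); exact.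
Qed.

(** The integral of [f] along direction [i], from the hyperplane where the coordinate [i] is 0 up to
    [u]. *)
Definition intop i f u : R :=
  prim (fun t => f (zer (pred1 i) u + t *: e_ i)) (u 0 i).

Lemma zer1_add u i : zer (pred1 i) u + u 0 i *: e_ i = u.
Proof.
by apply/rowP => k; rewrite lineE zerE /=; case: eqP => [->|_];
  rewrite ?mulr1 ?add0r ?mulr0 ?addr0.
Qed.

Lemma smoothG_line_continuous f w i : smoothG f ->
  continuous (fun t : R => f (w + t *: e_ i)).
Proof.
move=> sf t; apply/differentiable_continuous/derivable1_diffP.
apply: is_derive_derivable; apply: is_derive_line; exact: smoothG_is_derive.
Qed.

Lemma intop_is_derive_same i f u : smoothG f -> is_derive u (e_ i) (intop i f) (f u).
Proof.
move=> sf; rewrite -{1}(zer1_add u i); apply: line_is_derive.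
have := prim_is_derive (u 0 i) (@smoothG_line_continuous f (zer (pred1 i) u) i sf).
rewrite zer1_add; rewrite /intop.
set F := prim _; set H := (fun s : R => _).
suff -> : H = F by [].
apply/funext => s; rewrite /H /F; congr (prim _ _).
  by apply/funext => t; rewrite zer_line /= eqxx zer_idem.
by rewrite lineE zerE /= !eqxx mulr1 add0r.
Qed.

(** The mean value theorem for the combination of primitives. With [C = 0] it gives linearity of the
    integral, with [C] of order [h ^+ 2] differentiation under the integral sign. *)
Lemma prim_comb (F1 F2 F3 : R -> R) (h C x : R) :
  continuous F1 -> continuous F2 -> continuous F3 ->
  (forall t, Num.min 0 x <= t <= Num.max 0 x -> `|F1 t - F2 t - h * F3 t| <= C) ->
  `|prim F1 x - prim F2 x - h * prim F3 x| <= `|x| * C.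
Proof.
move=> c1 c2 c3 B.
pose H t := prim F1 t - prim F2 t - h * prim F3 t.
have [|t tx E] := @mvt1 R H (fun t => F1 t - F2 t - h * F3 t) 0 x.
  move=> t _; apply: is_deriveB; last first.
    by apply: (@is_deriveZ _ _ _ (prim F3)); exact: prim_is_derive.
  by apply: is_deriveB; exact: prim_is_derive.
move: E; rewrite {2}/H !prim0 // mulr0 !subr0 => E.
by rewrite -/(H x) E normrM mulrC ler_wpM2l // B.
Qed.

Lemma prim_bound (F : R -> R) (C x : R) : continuous F ->
  (forall t, Num.min 0 x <= t <= Num.max 0 x -> `|F t| <= C) ->
  `|prim F x| <= `|x| * C.
Proof.
move=> c B; have [|t tx E] := @mvt1 R (prim F) F 0 x.
  by move=> t _; exact: prim_is_derive.
move: E; rewrite prim0 // !subr0 => ->.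
by rewrite normrM mulrC ler_wpM2l // B.
Qed.

Lemma between_norm (x t : R) : Num.min 0 x <= t <= Num.max 0 x -> `|t| <= `|x|.
Proof.
move=> /andP[]; have [x0|x0] := leP 0 x => a b.
  by rewrite !ger0_norm.
by rewrite !ler0_norm ?lerN2 // ltW.
Qed.

Lemma ocube_zer1_line rho u i t : ocube rho u -> `|t| <= `|u 0 i| ->
  ocube rho (zer (pred1 i) u + t *: e_ i).
Proof.
move=> Qu tx k; rewrite lineE zerE /=; case: eqP => _.
  by rewrite add0r mulr1 (le_lt_trans tx).
by rewrite mulr0 addr0.
Qed.

Lemma in_ocube u : exists rho, ocube rho u.
Proof.
exists (\sum_k `|u 0 k| + 1) => k; rewrite (bigD1 k) //=.
by rewrite -addrA ltrDl ltr_wpDl // sumr_ge0.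
Qed.

(** [taylor_bound] is integrated along [i]. The second derivative is bounded on a cube enlarged by
    1, to contain the segments with [|h| < 1] that start on the path of integration. *)
Lemma intop_is_derive_other i j f u : j != i -> smoothG f ->
  is_derive u (e_ j) (intop i f) (intop i (partial j f) u).
Proof.
move=> ji sf; have [rho Qu] := in_ocube u.
have [C HC] := smoothG_lb (smoothG_partial j (smoothG_partial j sf)) (rho + 1).
apply: (@is_derive_quadratic _ _ _ _ _ _ 1 (`|u 0 i| * C)) => // h h1.
rewrite /intop zer_line /= (negbTE ji) lineE eq_sym (negbTE ji) mulr0 addr0.
rewrite -mulrA; apply: prim_comb; try exact: smoothG_line_continuous.
  exact: (smoothG_line_continuous (smoothG_partial j sf)).
move=> t /between_norm tx; rewrite [zer _ _ + h *: _ + _]addrAC.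
apply: (@taylor_bound _ _ f (partial j f) (partial j (partial j f)) (zer (pred1 i) u + t *: e_ i) j h C).
- by move=> s _; exact: smoothG_is_derive.
- by move=> s _; apply: smoothG_is_derive; exact: smoothG_partial.
- move=> s /andP[s0 s1]; apply: HC => k; rewrite lineE.
  apply: le_lt_trans (ler_normD _ _) _; apply: ltr_leD.
    exact: ocube_zer1_line.
  rewrite normrM normrM (ger0_norm s0).
  have : `|(k == j)%:R| <= 1 :> R by case: eqP; rewrite ?normr1 ?normr0.
  have := normr_ge0 h; set x := `|(k == j)%:R| => h0 x1.
  have x0 : 0 <= x by exact: normr_ge0.
  by apply: mulr_ile1 => //; [rewrite mulr_ge0 | apply: mulr_ile1 => //; exact: ltW].
Qed.

Lemma intop_bound rho i f u C : smoothG f -> ocube rho u ->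
  (forall v, ocube rho v -> `|f v| <= C) -> `|intop i f u| <= rho * C.
Proof.
move=> sf Qu HC.
have C0 : 0 <= C by apply: le_trans (HC _ Qu).
apply: (@le_trans _ _ (`|u 0 i| * C)); last by rewrite ler_wpM2r // ltW.
apply: prim_bound; first exact: smoothG_line_continuous.
by move=> t /between_norm tx; apply: HC; exact: ocube_zer1_line.
Qed.

Lemma smoothG_intop i f : smoothG f -> smoothG (intop i f).
Proof.
have lb g : smoothG g -> locally_bounded (intop i g).
  move=> sg rho; have [M HM] := smoothG_lb sg rho.
  by exists (rho * M) => u Qu; exact: intop_bound.
move=> sf k; elim: k f sf => [|k IH] f sf; first by split=> //; exact: lb.
apply: smooth_orderS; first exact: lb.
move=> j; have [->|ji] := eqVneq j i.
  by exists f => // u; exact: intop_is_derive_same.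
exists (intop i (partial j f)); first by apply: IH; exact: smoothG_partial.
by move=> u; exact: intop_is_derive_other.
Qed.

Lemma intopB i f g u : smoothG f -> smoothG g ->
  intop i (fun v => f v - g v) u = intop i f u - intop i g u.
Proof.
move=> sf sg; apply/eqP; rewrite -subr_eq0 -normr_le0.
have sfg : smoothG (fun v => f v - g v) by exact: (@goodB _ _ (cont_calculus 0)).
have E : intop i (fun v => f v - g v) u - (intop i f u - intop i g u) =
    intop i (fun v => f v - g v) u - intop i f u - (-1) * intop i g u by ring.
rewrite E -[leRHS](mulr0 `|u 0 i|); apply: prim_comb.
- exact: (@smoothG_line_continuous (fun v => f v - g v)).
- exact: smoothG_line_continuous.
- exact: smoothG_line_continuous.
- by move=> t _; rewrite mulN1r opprK addrAC subrK subrr normr0.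
Qed.

Lemma intop_zero i f u : smoothG f -> u 0 i = 0 -> intop i f u = 0.
Proof. by move=> sf u0; rewrite /intop u0 prim0 //; exact: smoothG_line_continuous. Qed.

End SmoothGlobal.

Section SmoothNorm.
Context {R : realType} {m : nat} (rho mu : R).
Hypotheses (rho_ge0 : 0 <= rho) (mu_ge0 : 0 <= mu).
Local Notation K := (@cont_calculus R m rho).
Local Notation N k f := (@nrm R m K mu k tt f).

Lemma nrm_pull k (L : pred 'I_m) (f : 'rV[R]_m -> R) : smoothG f ->
  N k (fun u => f (zer L u)) <= N k f.
Proof.
elim: k f => [|k IH] f sf /=.
  apply: supn_le => [|u Qu]; first exact: supn_ge0.
  by apply: supn_ub; [exact: smoothG_lb | exact: ocube_zer].
rewrite lerD ?IH // ler_wpM2l // ler_sum // => i _.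
rewrite partial_pull //; case: (L i); last by apply: IH; exact: smoothG_partial.
by apply: le_trans (@nrmC _ _ K _ _ _ _) _; rewrite normr0 nrm_ge0.
Qed.

(** Integration along [i] commutes with the other derivatives, while the derivative along [i] gives
    back [f] itself, with weight [mu] in place of a factor [rho]. Each order thus adds one [mu] to
    the constant. *)
Lemma nrm_intop k i (f : 'rV[R]_m -> R) : smoothG f ->
  N k (intop i f) <= (rho + mu * k%:R) * N k f.
Proof.
elim: k f => [|k IH] f sf.
  rewrite mulr0 addr0 /=.
  apply: supn_le => [|u Qu]; first by rewrite mulr_ge0 // supn_ge0.
  by apply: intop_bound => // v Qv; apply: supn_ub => //; exact: smoothG_lb.
have S : \sum_j N k (partial j (intop i f)) <=
    N k f + (rho + mu * k%:R) * \sum_j N k (partial j f).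
  rewrite (bigD1 i) //= [X in X + _](_ : _ = N k f); last first.
    congr nrm; apply/funext => u; apply: partial_is_derive.
    exact: intop_is_derive_same.
  rewrite lerD2l [X in _ * X](bigD1 i) //= mulrDr.
  apply: le_trans (_ : _ <= \sum_(j < m | j != i) (rho + mu * k%:R) * N k (partial j f)) _.
    apply: ler_sum => j ji.
    rewrite (_ : partial j (intop i f) = intop i (partial j f)).
      by apply: IH; exact: smoothG_partial.
    apply/funext => u; apply: partial_is_derive; exact: intop_is_derive_other.
  by rewrite -mulr_sumr lerDr mulr_ge0 ?nrm_ge0 // addr_ge0 // mulr_ge0.
have b0 : 0 <= \sum_j N k (partial j f) by rewrite sumr_ge0 // => j _; exact: nrm_ge0.
have bb := mulr_ge0 mu_ge0 (mulr_ge0 mu_ge0 b0).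
rewrite -natr1 /=; apply: le_trans (lerD (IH f sf) (ler_wpM2l mu_ge0 S)) _.
set a := N k f; set b := \sum_j _ in b0 bb *; lra.
Qed.

End SmoothNorm.

(** * Picard iteration with all derivatives *)

(** The intervals of radius [2 * C / 2 ^+ n] around [v n] are nested; the supremum of their left
    ends lies in all of them. *)
Lemma geometric_limit {R : realType} (v : nat -> R) (C : R) :
  (forall n, `|v n.+1 - v n| <= C / 2 ^+ n) ->
  exists l, forall n, `|v n - l| <= 2 * C / 2 ^+ n.
Proof.
move=> H; pose u n := v n - 2 * C / 2 ^+ n; pose w n := v n + 2 * C / 2 ^+ n.
have half n : 2 * C / 2 ^+ n.+1 = C / 2 ^+ n.
  by rewrite exprS; field; rewrite expf_neq0.
have step n : u n <= u n.+1 /\ w n.+1 <= w n.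
  have := H n; rewrite ler_norml /u /w half => /andP[h1 h2].
  have e : 2 * C / 2 ^+ n = 2 * (C / 2 ^+ n) by rewrite mulrA.
  by rewrite e; split; lra.
have C0 : 0 <= C by have := H 0%N; rewrite expr0 divr1; apply: le_trans.
have uw n : u n <= w n.
  by rewrite /u /w lerBlDr -addrA lerDl addr_ge0 // divr_ge0 ?mulr_ge0 ?exprn_ge0.
have um : {homo u : i j / (i <= j)%N >-> i <= j}.
  by apply: homo_leq => // [x y z|n]; [exact: le_trans | have [] := step n].
have wm : {homo w : i j / (i <= j)%N >-> j <= i}.
  by apply: homo_leq => // [x y z a b|n]; [exact: le_trans b a | have [] := step n].
have uwij i j : u i <= w j.
  apply: le_trans (um _ _ (leq_maxl i j)) _.
  by apply: le_trans (uw _) _; exact: wm (leq_maxr i j).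
exists (sup (range u)) => n; rewrite ler_distl; apply/andP; split.
  rewrite lerBlDr; apply: ge_sup; first by exists (u 0%N), 0%N.
  by move=> _ [k _ <-]; exact: uwij.
rewrite -lerBlDr; apply: ub_le_sup; last by exists n.
by exists (w 0%N) => _ [k _ <-].
Qed.

Lemma geometric_cvg {R : realType} (v : nat -> R) (l C : R) :
  (forall n, `|v n - l| <= C / 2 ^+ n) -> v n @[n --> \oo] --> l.
Proof.
move=> H.
have C0 : 0 <= C by have := H 0%N; rewrite expr0 divr1; apply: le_trans.
have c0 : (fun n => C / 2 ^+ n) @ \oo --> (0 : R).
  have -> : (fun n => C / 2 ^+ n) = geometric C (2^-1).
    by apply/funext => n; rewrite /geometric /= exprVn.
  by apply: cvg_geometric; rewrite gtr0_norm ?invf_lt1 // ltr1n.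
apply/cvgrPdist_le => e e0.
move/cvgrPdist_le : c0 => /(_ e e0); apply: filterS => n.
rewrite sub0r normrN => h; rewrite distrC; apply: le_trans (H n) (le_trans _ h).
exact: ler_norm.
Qed.

Lemma pow1D_le {R : realType} (x : R) k : 0 <= x <= 1 -> (1 + x) ^+ k <= 1 + 3 ^+ k * x.
Proof.
move=> /andP[x0 x1]; elim: k => [|k IH]; first by rewrite !expr0 mul1r lerDl.
rewrite !exprS; set a := (1 + x) ^+ k in IH *; set b := 3 ^+ k in IH *.
have b1 : 1 <= b by rewrite exprn_ege1 // ler1n.
have : (1 + x) * a <= (1 + x) * (1 + b * x) by rewrite ler_wpM2l // addr_ge0.
have : b * x * x <= b * x * 1 by rewrite ler_wpM2l // mulr_ge0 // (le_trans ler01).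
have : 1 * x <= b * x by rewrite ler_wpM2r.
lra.
Qed.

Lemma small_weight {R : realType} (c : R) k (e b : R) : 0 <= c -> 0 < e -> 0 < b ->
  exists2 mu, 0 < mu & mu <= b /\ (1 + mu * c) ^+ k - 1 <= e.
Proof.
move=> c0 e0 b0; pose d := (c + 1) * 3 ^+ k.
have d0 : 0 < d by rewrite mulr_gt0 ?exprn_gt0 // ltr_wpDl.
have d1 : c <= d.
  have : 1 <= (3 : R) ^+ k by rewrite exprn_ege1 // ler1n.
  by rewrite /d; nra.
pose mu := Num.min b (Num.min (e / d) (d^-1)).
have m0 : 0 < mu by rewrite !lt_min b0 divr_gt0 // invr_gt0 d0.
have m1 : mu <= e / d by rewrite /mu !ge_min lexx orbT.
have m2 : mu <= d^-1 by rewrite /mu !ge_min lexx !orbT.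
exists mu => //; split; first by rewrite /mu ge_min lexx.
have mc1 : mu * c <= 1.
  have md : mu * d <= 1 by rewrite -ler_pdivlMr // div1r.
  by apply: le_trans md; rewrite ler_wpM2l // ltW.
have mc0 : 0 <= mu * c by rewrite mulr_ge0 // ltW.
have h : (1 + mu * c) ^+ k <= 1 + 3 ^+ k * (mu * c) by apply: pow1D_le; rewrite mc0.
have h2 : mu * d <= e by rewrite -ler_pdivlMr.
have : 3 ^+ k * (mu * c) <= mu * d.
  rewrite /d mulrCA ler_wpM2l ?(ltW m0) // mulrC ler_wpM2r ?exprn_ge0 //.
  by rewrite lerDl.
lra.
Qed.

Section Picard.
Context {R : realType} {m : nat} {A : finType}.
Variables (ev : A -> pred 'I_m)
  (rhs : A -> 'I_m -> seq (bool * option 'I_m * (A * A))).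
Implicit Types (a b : A) (i j l : 'I_m) (u v : 'rV[R]_m) (k n : nat)
  (x y : A -> 'rV[R]_m -> R) (s : seq 'I_m).

Local Notation e_ := (@basis_vec R m).

(** Kept bilinear rather than quadratic: the derivative of a right-hand side, and the difference of
    its values at two families, are then sums of two such forms. The lattice version with the shifts
    is [dbilf]. *)
Definition bil a i (p q : A -> R) : R :=
  \sum_(t <- rhs a i) (-1) ^+ t.1.1 * (p t.2.1 * q t.2.2).

Definition bilf a i x y u : R := bil a i (x^~ u) (y^~ u).

(* A point is reached from the data by switching its coordinates on in increasing
   order, so that the integral in direction [i] runs where the later ones are 0. *)
Definition later a i : pred 'I_m := fun l => ev a l && (i < l)%N.

Variables (d : A -> 'rV[R]_m -> R).
Hypothesis d_smooth : forall a, smoothG (d a).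
Hypothesis d_data : forall a u, d a (zer (ev a) u) = d a u.
Hypothesis rhs_size : forall a i, (size (rhs a i) <= 3)%N.

Definition picard_step x a u : R :=
  d a u + \sum_(i | ev a i) intop i (bilf a i x x) (zer (later a i) u).

Fixpoint picard n : A -> 'rV[R]_m -> R :=
  if n is n'.+1 then picard_step (picard n') else fun _ _ => 0.

Lemma picardS n a u : picard n.+1 a u =
  d a u + \sum_(i | ev a i) intop i (bilf a i (picard n) (picard n)) (zer (later a i) u).
Proof. by []. Qed.

(** The class of smooth functions is the same for all radii, so radius 0 serves for its closure
    properties. *)
Let K0 := @cont_calculus R m 0.

Lemma smoothG_bilf a i x y : (forall b, smoothG (x b)) -> (forall b, smoothG (y b)) ->
  smoothG (bilf a i x y).
Proof.
move=> sx sy; apply: (@good_sum _ _ K0) => t.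
by apply: (@goodZ _ _ K0); exact: smoothGM.
Qed.

Lemma smoothG_step x : (forall b, smoothG (x b)) -> forall a, smoothG (picard_step x a).
Proof.
move=> sx a; apply: smoothGD => //.
rewrite (_ : (fun _ => _) = fun u => \sum_(i <- index_enum 'I_m)
    (if ev a i then intop i (bilf a i x x) (zer (later a i) u) else 0)); last first.
  by apply/funext => u; rewrite big_mkcond.
apply: (@good_sum _ _ K0) => i /=; case: (ev a i); last exact: smoothG_cst.
have sb : smoothG (bilf a i x x) by exact: smoothG_bilf.
exact: (@smoothG_pull _ _ (later a i) _ (smoothG_intop i sb)).
Qed.

Lemma smoothG_picard n a : smoothG (picard n a).
Proof.
by elim: n a => [|n IH] a; [exact: smoothG_cst | exact: smoothG_step].
Qed.

Section Estimates.
Variables (rho mu : R) (k : nat) (D B : R).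
Hypotheses (rho_ge0 : 0 <= rho) (mu_ge0 : 0 <= mu) (B_ge0 : 0 <= B).
Local Notation K := (@cont_calculus R m rho).
Local Notation N f := (@nrm R m K mu k tt f).
Hypothesis ND : forall a, N (d a) <= D.
Let th := (rho + mu * k%:R) * m%:R.

Lemma nrm_bilf a i x y X Y : (forall b, smoothG (x b)) -> (forall b, smoothG (y b)) ->
  0 <= X -> 0 <= Y -> (forall b, N (x b) <= X) -> (forall b, N (y b) <= Y) ->
  N (bilf a i x y) <= 3 * (X * Y).
Proof.
move=> sx sy X0 Y0 HX HY.
pose F (t : bool * option 'I_m * (A * A)) u := (-1) ^+ t.1.1 * (x t.2.1 u * y t.2.2 u) : R.
have H := @nrm_sum _ _ K _ mu_ge0 k tt _ (rhs a i) F _.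
apply: le_trans (H _) _.
  by move=> t; apply: (@goodZ _ _ K); exact: smoothGM.
apply: le_trans (_ : _ <= \sum_(t <- rhs a i) X * Y) _.
  apply: ler_sum => t _.
  apply: le_trans (@nrmZ _ _ K _ mu_ge0 _ _ _ _ _) _; first exact: smoothGM.
  rewrite normrX normrN1 expr1n mul1r.
  apply: le_trans (@nrmM _ _ K _ mu_ge0 k tt _ _ (sx t.2.1) (sy t.2.2)) _.
  by rewrite ler_pM ?nrm_ge0.
rewrite big_const_seq count_predT iter_addr_0 -[leLHS]mulr_natl ler_wpM2r ?mulr_ge0 //.
by rewrite ler_nat.
Qed.

Lemma nrm_later_sum a (F : 'I_m -> 'rV[R]_m -> R) Y : 0 <= Y ->
  (forall i, smoothG (F i)) -> (forall i, N (F i) <= Y) ->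
  N (fun u => \sum_(i | ev a i) intop i (F i) (zer (later a i) u)) <= th * Y.
Proof.
move=> Y0 sF HF.
rewrite (_ : (fun _ => _) = fun u => \sum_(i <- index_enum 'I_m)
    (if ev a i then intop i (F i) (zer (later a i) u) else 0)); last first.
  by apply/funext => u; rewrite big_mkcond.
have sI i : smoothG (fun u => intop i (F i) (zer (later a i) u)).
  exact: (@smoothG_pull _ _ (later a i) _ (smoothG_intop i (sF i))).
pose G i u := if ev a i then intop i (F i) (zer (later a i) u) else 0.
have H := @nrm_sum _ _ K _ mu_ge0 k tt _ (index_enum 'I_m) G _.
apply: le_trans (H _) _.
  by move=> i; rewrite /G; case: (ev a i); [exact: sI | exact: smoothG_cst].
have th0 : 0 <= rho + mu * k%:R by rewrite addr_ge0 // mulr_ge0.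
apply: le_trans (_ : _ <= \sum_(i < m) (rho + mu * k%:R) * Y) _.
  apply: ler_sum => i _; rewrite /G; case: (ev a i); last first.
    by apply: le_trans (@nrmC _ _ K _ _ _ _) _; rewrite normr0 mulr_ge0.
  apply: le_trans (@nrm_pull _ _ rho mu mu_ge0 k _ _ (smoothG_intop i (sF i))) _.
  apply: le_trans (nrm_intop rho_ge0 mu_ge0 k i (sF i)) _.
  by rewrite ler_wpM2l.
by rewrite sumr_const card_ord -[leLHS]mulr_natr /th mulrAC.
Qed.

(** [th] bounds the sum of the integrals over at most [m] directions. A right-hand side has at most
    3 terms; in [contr] the factor is 6, since a difference of two quadratic forms is a sum of two
    bilinear ones. *)
Hypothesis ball : D + th * (3 * (B * B)) <= B.
Hypothesis contr : th * (6 * B) <= 2^-1.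

Lemma picard_ball n a : N (picard n a) <= B.
Proof.
elim: n a => [|n IH] a.
  by apply: le_trans (@nrmC _ _ K _ _ _ _) _; rewrite normr0.
have sb i : smoothG (bilf a i (picard n) (picard n)).
  by apply: smoothG_bilf => b; exact: smoothG_picard.
have sI := @smoothG_step (picard n) (@smoothG_picard n) a.
have sS : smoothG (fun u => picard_step (picard n) a u - d a u).
  exact: (@goodB _ _ K _ _ sI (d_smooth a)).
rewrite /= (_ : picard_step _ a = fun u => d a u +
   \sum_(i | ev a i) intop i (bilf a i (picard n) (picard n)) (zer (later a i) u)) //.
have sS' : smoothG (fun u => \sum_(i | ev a i) intop i (bilf a i (picard n) (picard n)) (zer (later a i) u)).
  rewrite (_ : (fun _ => _) = fun u => picard_step (picard n) a u - d a u) //.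
  by apply/funext => u; rewrite /picard_step addrAC subrr add0r.
apply: le_trans (@nrmD _ _ K _ mu_ge0 k tt _ _ (d_smooth a) sS') _.
apply: le_trans ball; apply: lerD => //.
apply: nrm_later_sum => //; first by rewrite !mulr_ge0.
by move=> i; apply: nrm_bilf => //; exact: smoothG_picard.
Qed.

Lemma picard_diff n a : N (fun u => picard n.+1 a u - picard n a u) <= B / 2 ^+ n.
Proof.
elim: n a => [|n IH] a.
  rewrite expr0 divr1 (_ : (fun _ => _) = picard 1 a); first exact: picard_ball.
  by apply/funext => u; rewrite /= subr0.
pose X := fun b u => picard n.+1 b u - picard n b u.
have sX b : smoothG (X b) by apply: (@goodB _ _ K); exact: smoothG_picard.
pose F i u := bilf a i X (picard n.+1) u + bilf a i (picard n) X u.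
have sF i : smoothG (F i).
  by apply: smoothGD; apply: smoothG_bilf => // b; exact: smoothG_picard.
have B2 : 0 <= B / 2 ^+ n by rewrite divr_ge0 ?exprn_ge0.
have -> : (fun u => picard n.+2 a u - picard n.+1 a u) =
    (fun u => \sum_(i | ev a i) intop i (F i) (zer (later a i) u)).
  apply/funext => u; rewrite (picardS n.+1) (picardS n).
  rewrite opprD addrACA subrr add0r -sumrB; apply: eq_bigr => i _.
  rewrite -intopB; try by apply: smoothG_bilf => b; exact: smoothG_picard.
  congr intop; apply/funext => v; rewrite /F /X /bilf /bil.
  move: (picard n.+1) (picard n) => p q; rewrite -sumrB -big_split /=.
  by apply: eq_bigr => t _; move: ((-1) ^+ _) => c; ring.
have Y0 : 0 <= 6 * B * (B / 2 ^+ n) by rewrite !mulr_ge0.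
apply: le_trans (@nrm_later_sum a F (6 * B * (B / 2 ^+ n)) Y0 sF _) _.
  move=> i.
  have s1 : smoothG (bilf a i X (picard n.+1)).
    by apply: smoothG_bilf => // b; exact: smoothG_picard.
  have s2 : smoothG (bilf a i (picard n) X).
    by apply: smoothG_bilf => // b; exact: smoothG_picard.
  apply: le_trans (@nrmD _ _ K _ mu_ge0 k tt _ _ s1 s2) _.
  have -> : 6 * B * (B / 2 ^+ n) = 3 * (B / 2 ^+ n * B) + 3 * (B * (B / 2 ^+ n)) by ring.
  by apply: lerD; apply: nrm_bilf => // b;
    (exact: smoothG_picard || exact: picard_ball || exact: IH).
have -> : B / 2 ^+ n.+1 = 2^-1 * (B / 2 ^+ n).
  by rewrite exprS; field; rewrite expf_neq0.
by rewrite mulrA; apply: ler_wpM2r.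
Qed.

End Estimates.

End Picard.

Lemma ex_choice {X Y : Type} (P : X -> Y -> Prop) :
  (forall x, exists y, P x y) -> exists f, forall x, P x (f x).
Proof. by move=> /boolp.choice[f Hf]; exists f. Qed.

Section SystemExistence.
Context {R : realType} {m : nat} {A : finType}.
Variables (ev : A -> pred 'I_m)
  (rhs : A -> 'I_m -> seq (bool * option 'I_m * (A * A))).
Implicit Types (a b : A) (i j l : 'I_m) (u v : 'rV[R]_m) (k n : nat)
  (s : seq 'I_m).

Local Notation e_ := (@basis_vec R m).

Lemma dfs_bound rho k (f : 'rV[R]_m -> R) : smoothG f ->
  exists2 M : R, 0 <= M & forall s u, (size s <= k)%N -> ocube rho u ->
    `|iter_partial s f u| <= M.
Proof.
elim: k f => [|k IH] f sf.
  have [M HM] := smoothG_lb sf rho; exists `|M| => // -[|//] u _ Qu /=.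
  by apply: le_trans (HM u Qu) (ler_norm _).
have [M0 M00 H0] := IH f sf.
have [F HF] : exists F : 'I_m -> R, forall i, 0 <= F i /\ forall s u,
    (size s <= k)%N -> ocube rho u -> `|iter_partial s (partial i f) u| <= F i.
  apply: (@ex_choice _ _ (fun i (M : R) => 0 <= M /\ forall s u,
    (size s <= k)%N -> ocube rho u -> `|iter_partial s (partial i f) u| <= M)) => i.
  by have [M ? ?] := IH _ (smoothG_partial i sf); exists M.
have F0 i : 0 <= F i by have [] := HF i.
exists (M0 + \sum_i F i); first by rewrite addr_ge0 // sumr_ge0.
move=> s u; case/lastP: s => [|s i] sz Qu.
  by apply: le_trans (H0 [::] u _ Qu) _ => //; rewrite lerDl sumr_ge0.
rewrite size_rcons ltnS in sz.
have [_ H] := HF i; rewrite /iter_partial foldr_rcons.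
apply: le_trans (H s u sz Qu) _; rewrite (bigD1 i) //= addrCA lerDl.
by rewrite addr_ge0 // sumr_ge0.
Qed.

Lemma iter_partialB s (f g : 'rV[R]_m -> R) u : smoothG f -> smoothG g ->
  iter_partial s (fun v => f v - g v) u = iter_partial s f u - iter_partial s g u.
Proof.
move=> sf sg; elim: s u => [//|i s IH] u /=.
have K := @cont_calculus R m 0.
rewrite (_ : iter_partial s (fun v => f v - g v) =
   fun v => iter_partial s f v - iter_partial s g v); last exact/funext.
apply: (@dfB _ _ (@cont_calculus R m 0) i (iter_partial s f) (iter_partial s g)).
  exact: (@good_dfiter _ _ (@cont_calculus R m 0) s f sf).
exact: (@good_dfiter _ _ (@cont_calculus R m 0) s g sg).
Qed.

Variables (d : A -> 'rV[R]_m -> R).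
Hypothesis d_smooth : forall a, smoothG (d a).
Hypothesis d_data : forall a u, d a (zer (ev a) u) = d a u.
Hypothesis rhs_size : forall a i, (size (rhs a i) <= 3)%N.
Variables (rho D : R).
Hypotheses (rho_gt0 : 0 < rho) (D_ge0 : 0 <= D).
Hypothesis d_bound : forall a u, ocube rho u -> `|d a u| <= D.
(** By [data_weight], [mu] can be taken for each [k] such that the data have norm at most [D + 1]
    and [mu * k%:R <= rho]; the integrals contribute at most 1 more. The factor [2 * rho] below
    bounds [rho + mu * k%:R], so neither condition refers to [k]. *)
Let B := D + 2.
Hypothesis rho_ball : 2 * rho * m%:R * (3 * (B * B)) <= 1.
Hypothesis rho_contr : 2 * rho * m%:R * (6 * B) <= 2^-1.

Local Notation pic := (picard ev rhs d).
Local Notation sp := (@smoothG_picard R m A ev rhs d d_smooth).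

Lemma data_weight k : exists2 mu : R, 0 < mu <= 1 & mu * k%:R <= rho /\
  forall a, @nrm R m (cont_calculus rho) mu k tt (d a) <= D + 1.
Proof.
have [M HM] : exists M : A -> R, forall a, 0 <= M a /\ forall s u,
    (size s <= k)%N -> ocube rho u -> `|iter_partial s (d a) u| <= M a.
  apply: (@ex_choice _ _ (fun a (M : R) => 0 <= M /\ forall s u,
    (size s <= k)%N -> ocube rho u -> `|iter_partial s (d a) u| <= M)) => a.
  by have [M ? ?] := dfs_bound rho k (d_smooth a); exists M.
have M0 a : 0 <= M a by have [] := HM a.
pose S := \sum_a M a + 1.
have S0 : 0 < S by rewrite ltr_wpDl // sumr_ge0.
have MS a : M a <= S.
  by rewrite /S (bigD1 a) //= -addrA lerDl addr_ge0 // sumr_ge0.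
have b0 : 0 < Num.min 1 (rho / (k%:R + 1)).
  by rewrite lt_min ltr01 divr_gt0 // ltr_wpDl.
have Si : 0 < S^-1 by rewrite invr_gt0.
have [mu mu0 [mub hmu]] := small_weight k (ler0n R m) Si b0.
move: mub; rewrite le_min => /andP[mu1 mur].
exists mu; first by rewrite mu0.
split.
  move: mur; rewrite ler_pdivlMr ?ltr_wpDl //; lra.
move=> a; apply: le_trans (@nrm_small _ _ (cont_calculus rho) mu (ltW mu0) k tt (d a) D S
   D_ge0 (ltW S0) (d_smooth a) _ _) _.
- by move=> u Qu; exact: d_bound.
- move=> s u _ sk Qu; apply: le_trans (MS a); have [_ H] := HM a; exact: H.
- rewrite lerD2l; have : S * ((1 + mu * m%:R) ^+ k - 1) <= S * S^-1.
    by rewrite ler_wpM2l // ltW.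
  by rewrite mulfV ?gt_eqF.
Qed.

(** The order [k] affects only the constant, through the factor [mu ^- k] lost in passing from the
    norm to derivatives; the cube and the rate [2 ^- n] stay the same. *)
Lemma picard_derivatives k : exists2 C : R, 0 <= C & forall a s u n,
  (size s <= k)%N -> ocube rho u ->
  `|iter_partial s (pic n a) u| <= C /\
  `|iter_partial s (pic n.+1 a) u - iter_partial s (pic n a) u| <= C / 2 ^+ n.
Proof.
have [mu /andP[mu0 mu1] [muk ND]] := data_weight k.
have B0 : 0 <= B by rewrite /B addr_ge0.
have t0 : 0 <= (rho + mu * k%:R) * m%:R.
  by rewrite mulr_ge0 // addr_ge0 ?mulr_ge0 // ltW.
have t1 : (rho + mu * k%:R) * m%:R <= 2 * rho * m%:R.
  by rewrite ler_wpM2r //; lra.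
have ball : D + 1 + (rho + mu * k%:R) * m%:R * (3 * (B * B)) <= B.
  have : (rho + mu * k%:R) * m%:R * (3 * (B * B)) <= 1.
    by apply: le_trans rho_ball; rewrite ler_wpM2r // !mulr_ge0.
  by move=> h; apply: le_trans (lerD (lexx _) h) _; rewrite /B; lra.
have contr : (rho + mu * k%:R) * m%:R * (6 * B) <= 2^-1.
  by apply: le_trans rho_contr; rewrite ler_wpM2r // mulr_ge0.
have rho0 := ltW rho_gt0; have mu0' := ltW mu0.
have P1 := @picard_ball R m A ev rhs d d_smooth rhs_size rho mu k (D + 1) B
  rho0 mu0' B0 ND ball.
have P2 := @picard_diff R m A ev rhs d d_smooth rhs_size rho mu k (D + 1) B
  rho0 mu0' B0 ND ball contr.
have muk0 : 0 < mu ^+ k by rewrite exprn_gt0.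
have wt (f : 'rV[R]_m -> R) X s u : smoothG f -> 0 <= X ->
    @nrm R m (cont_calculus rho) mu k tt f <= X ->
    (size s <= k)%N -> ocube rho u -> `|iter_partial s f u| <= X / mu ^+ k.
  move=> sf X0 NX sk Qu; rewrite ler_pdivlMr // mulrC.
  have Q' : dom (lev (K := cont_calculus rho) tt s) u by exact: Qu.
  have := @nrm_pt _ _ (cont_calculus rho) mu mu0' k tt f s u sf sk Q'.
  move=> h; apply: le_trans (le_trans h NX).
  rewrite ler_wpM2r //.
  by rewrite -(subnK sk) exprD ler_piMl ?exprn_ge0 // exprn_ile1.
exists (B / mu ^+ k); first by rewrite divr_ge0 // ltW.
move=> a s u n sk Qu; split.
  by apply: wt => //; exact: sp.
rewrite mulrAC -iter_partialB; try exact: sp.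
apply: wt => //.
  by apply: (@goodB _ _ (@cont_calculus R m rho)); exact: sp.
by rewrite divr_ge0 // exprn_ge0.
Qed.

Lemma picard_sup n a u : ocube rho u -> `|pic n a u| <= B.
Proof.
move=> Qu; have [mu /andP[mu0 mu1] [muk ND]] := data_weight 0.
have B0 : 0 <= B by rewrite /B addr_ge0.
have ball : D + 1 + (rho + mu * 0%:R) * m%:R * (3 * (B * B)) <= B.
  have : (rho + mu * 0%:R) * m%:R * (3 * (B * B)) <= 1.
    apply: le_trans rho_ball; rewrite ler_wpM2r ?mulr_ge0 // ler_wpM2r //.
    by have := rho_gt0; lra.
  by move=> h; apply: le_trans (lerD (lexx _) h) _; rewrite /B; lra.
have := @picard_ball R m A ev rhs d d_smooth rhs_size rho mu 0 (D + 1) B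
  (ltW rho_gt0) (ltW mu0) B0 ND ball n a.
apply: le_trans; apply: supn_ub => //; exact: smoothG_lb (sp n a) rho.
Qed.

(** The limits of all iterated derivatives are taken separately; [jet_is_derive] then identifies
    each as a derivative of another. The limit exists on the open cube of radius [rho]. *)
Definition jet a s u : R := lim (iter_partial s (pic n a) u @[n --> \oo]).

Lemma jet_cvg a s u : ocube rho u -> iter_partial s (pic n a) u @[n --> \oo] --> jet a s u.
Proof.
move=> Qu; have [C C0 H] := picard_derivatives (size s).
have [l Hl] := @geometric_limit R (fun n => iter_partial s (pic n a) u) C
   (fun n => (H a s u n (leqnn _) Qu).2).
have c := geometric_cvg Hl.
by rewrite /jet; have -> := cvg_lim _ c.
Qed.

Lemma jet_bounded s : exists2 C : R, 0 <= C & forall a u, ocube rho u -> `|jet a s u| <= C.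
Proof.
have [C C0 H] := picard_derivatives (size s); exists C => // a u Qu.
have c : `|iter_partial s (pic n a) u| @[n --> \oo] --> `|jet a s u|.
  by apply: cvg_norm; exact: jet_cvg.
apply: (cvgr_to_le c); near=> n.
by have [] := H a s u n (leqnn _) Qu.
Unshelve. all: by end_near. Qed.

Lemma smooth_iter_partial f s : smoothG (f : 'rV[R]_m -> R) -> smoothG (iter_partial s f).
Proof. by move=> sf; exact: (@good_dfiter _ _ (@cont_calculus R m 0) s f sf). Qed.

(** The Taylor estimate of the iterates has a constant independent of [n], so it passes to the
    limit. *)
Lemma jet_is_derive a s i u : ocube rho u -> is_derive u (e_ i) (jet a s) (jet a (i :: s) u).
Proof.
move=> Qu; have [C C0 H] := picard_derivatives (size s).+2.
have [dl d0 Qd] := ocube_open_line i Qu.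
apply: (@is_derive_quadratic _ _ _ _ _ _ dl C) => // h hd.
have Qh := Qd h hd.
have c : `|iter_partial s (pic n a) (u + h *: e_ i) - iter_partial s (pic n a) u
     - h * iter_partial (i :: s) (pic n a) u| @[n --> \oo] -->
   `|jet a s (u + h *: e_ i) - jet a s u - h * jet a (i :: s) u|.
  apply: cvg_norm; apply: cvgB; last by apply: cvgMr; exact: jet_cvg.
  by apply: cvgB; exact: jet_cvg.
apply: (cvgr_to_le c); near=> n.
have T := @taylor_bound R m (iter_partial s (pic n a)) (iter_partial (i :: s) (pic n a))
  (iter_partial [:: i, i & s] (pic n a)) u i h C.
lapply T.
  move=> {}T; lapply T.
    move=> {}T; lapply T; first by move=> {}T.
    move=> t t01; have [] := H a [:: i, i & s] (u + (t * h) *: e_ i) n (leqnn _) _ => //.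
    exact: ocube_seg.
  by move=> t _; apply: smoothG_is_derive; apply: smooth_iter_partial; exact: sp.
by move=> t _; apply: smoothG_is_derive; apply: smooth_iter_partial; exact: sp.
Unshelve. all: by end_near. Qed.

(** Where the later coordinates vanish, the integrals in later directions run over a trivial
    interval; those in earlier directions are evaluated with coordinate [i] set to 0, hence are
    constant along [i]. Only the integral in direction [i] contributes. *)
Lemma picard_path n a i u : ev a i -> (forall l, later ev a i l -> u 0 l = 0) ->
  partial i (pic n.+1 a) u = bilf rhs a i (pic n) (pic n) u.
Proof.
move=> ai u0.
have sb q : smoothG (bilf rhs a q (pic n) (pic n)).
  by apply: smoothG_bilf => b; exact: sp.
have zu : zer (later ev a i) u = u.
  by apply/rowP => l; rewrite zerE; case: ifP => // /u0.
apply: partial_is_derive.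
pose c := d a u + \sum_(q | ev a q && (q != i))
  intop q (bilf rhs a q (pic n) (pic n)) (zer (later ev a q) u).
have D1 : is_derive u (e_ i)
   (fun v => c + intop i (bilf rhs a i (pic n) (pic n)) (zer (later ev a i) v))
   (bilf rhs a i (pic n) (pic n) u).
  rewrite -[bilf _ _ _ _ _ u]add0r; apply: is_deriveD.
  have := @is_derive_pull R m (later ev a i) (intop i (bilf rhs a i (pic n) (pic n)))
    (bilf rhs a i (pic n) (pic n)) u i.
  rewrite {2}/later ltnn andbF zu; apply=> v; exact: intop_is_derive_same.
apply: is_derive_ext_line D1 => h.
rewrite picardS /c -addrA; congr (_ + _).
  rewrite -[LHS]d_data -[RHS]d_data zer_line ai //.
rewrite [RHS](bigD1 i) //= addrC; congr (_ + _).
apply: eq_bigr => q /andP[aq qi].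
have [iq|qi'] := ltnP q i.
  by rewrite zer_line /later ai iq.
have lq : later ev a i q by rewrite /later aq /= ltn_neqAle eq_sym qi' andbT.
have z v : v 0 q = 0 -> intop q (bilf rhs a q (pic n) (pic n)) (zer (later ev a q) v) = 0.
  by move=> vq; apply: intop_zero => //; rewrite zerE /later ltnn andbF.
by rewrite !z // ?lineE u0 // (negbTE qi) mulr0 addr0.
Qed.

Lemma bilf_cvg (x : nat -> A -> 'rV[R]_m -> R) (y : A -> 'rV[R]_m -> R) a i u :
  (forall b, x n b u @[n --> \oo] --> y b u) ->
  bilf rhs a i (x n) (x n) u @[n --> \oo] --> bilf rhs a i y y u.
Proof.
move=> c; rewrite /bilf /bil; elim: (rhs a i) => [|t r IH].
  rewrite big_nil (_ : (fun _ => _) = fun=> 0); last first.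
    by apply/funext => n; rewrite big_nil.
  exact: cvg_cst.
rewrite big_cons (_ : (fun _ => _) = fun n => (-1) ^+ t.1.1 * (x n t.2.1 u * x n t.2.2 u) +
  \sum_(t <- r) (-1) ^+ t.1.1 * (x n t.2.1 u * x n t.2.2 u)); last first.
  by apply/funext => n; rewrite big_cons.
by apply: cvgD => //; apply: cvgMr; apply: cvgM; exact: c.
Qed.

Lemma jet_path a i u : ocube rho u -> ev a i -> (forall l, later ev a i l -> u 0 l = 0) ->
  jet a [:: i] u = bilf rhs a i (fun b => jet b [::]) (fun b => jet b [::]) u.
Proof.
move=> Qu ai u0.
have c1 : iter_partial [:: i] (pic n.+1 a) u @[n --> \oo] --> jet a [:: i] u.
  have := @jet_cvg a [:: i] u Qu; rewrite -(cvg_shiftS).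
  exact.
have c2 : bilf rhs a i (pic n) (pic n) u @[n --> \oo] -->
   bilf rhs a i (fun b => jet b [::]) (fun b => jet b [::]) u.
  by apply: bilf_cvg => b; exact: (@jet_cvg b [::] u Qu).
have E : (fun n => bilf rhs a i (pic n) (pic n) u) =
    (fun n => iter_partial [:: i] (pic n.+1 a) u).
  by apply/funext => n /=; rewrite picard_path.
rewrite E in c2; exact: (cvg_unique _ c1 c2).
Qed.

Lemma jet_ball a u : ocube rho u -> `|jet a [::] u| <= B.
Proof.
move=> Qu; have c : `|pic n a u| @[n --> \oo] --> `|jet a [::] u|.
  by apply: cvg_norm; exact: (@jet_cvg a [::]).
by apply: (cvgr_to_le c); near=> n; exact: picard_sup.
Unshelve. all: by end_near. Qed.

Lemma jet_data a u : ocube rho u -> (forall i, ev a i -> u 0 i = 0) -> jet a [::] u = d a u.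
Proof.
move=> Qu u0; have c : pic n.+1 a u @[n --> \oo] --> jet a [::] u.
  by have := @jet_cvg a [::] u Qu; rewrite -(cvg_shiftS); exact.
have E : (fun n => pic n.+1 a u) = (fun=> d a u).
  apply/funext => n; rewrite picardS big1 ?addr0 // => i ai.
  apply: intop_zero; last by rewrite zerE /later ltnn andbF u0.
  by apply: smoothG_bilf => b; exact: sp.
rewrite E in c; exact: (cvg_unique _ c (cvg_cst _)).
Qed.

End SystemExistence.

Section LinesMore.
Context {R : realType} {m : nat}.
Implicit Types (i : 'I_m) (u : 'rV[R]_m) (f g : 'rV[R]_m -> R) (t h C l d : R).
Local Notation e_ := (@basis_vec R m).

Lemma is_derive_near_line f g u i l d : 0 < d ->
  (forall h, `|h| < d -> f (u + h *: e_ i) = g (u + h *: e_ i)) ->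
  is_derive u (e_ i) f l -> is_derive u (e_ i) g l.
Proof.
move=> d0 E df; rewrite -[u](addr0 u) -(scale0r (e_ i)) in df *.
apply: line_is_derive; have := is_derive_line df; apply: near_eq_is_derive.
near=> h; apply: E.
near: h; exists d => //= h; rewrite /ball /= sub0r normrN; exact.
Unshelve. all: by end_near. Qed.

Lemma mvt_bound_ex f u i h C :
  (forall t, 0 <= t <= 1 -> exists2 g,
    is_derive (u + (t * h) *: e_ i) (e_ i) f g & `|g| <= C) ->
  `|f (u + h *: e_ i) - f u| <= `|h| * C.
Proof.
move=> H; have M := @mvt_bound R m f (partial i f) u i h C.
lapply M.
  move=> {}M; lapply M; first by move=> {}M.
  by move=> t /H[g dg gC]; rewrite (partial_is_derive dg).
by move=> t /H[g dg gC]; rewrite (partial_is_derive dg).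
Qed.

End LinesMore.

(** * The equations off the paths of integration *)

Section Compatibility.
Context {R : realType} {m : nat} {A : finType}.
Variables (ev : A -> pred 'I_m)
  (rhs : A -> 'I_m -> seq (bool * option 'I_m * (A * A))).
Implicit Types (a b : A) (i j l : 'I_m) (u v : 'rV[R]_m) (n : nat)
  (p q : A -> R) (s : seq 'I_m).

Local Notation e_ := (@basis_vec R m).

(** Every unknown in the equation of [a] in direction [i] must itself have an equation in each other
    direction of [a], so that differentiating the equation again leads to defects of the system. *)
Definition rhs_closed := forall a i l t, ev a i -> ev a l -> l != i ->
  t \in rhs a i -> ev t.2.1 l && ev t.2.2 l.

(** Equality of the mixed second derivatives of [a] after each first derivative is replaced by its
    right-hand side: [Q l b] stands for the derivative of [b] along [l]. *)
Definition rhs_compatible := forall a i l p, ev a i -> ev a l -> i != l ->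
  let Q j b := bil rhs b j p p in
  bil rhs a i (Q l) p + bil rhs a i p (Q l) = bil rhs a l (Q i) p + bil rhs a l p (Q i).

Hypothesis rhs_size : forall a i, (size (rhs a i) <= 3)%N.

Lemma bil_bound a i p q (P Q : R) : 0 <= P -> 0 <= Q ->
  (forall t, t \in rhs a i -> `|p t.2.1| <= P) ->
  (forall t, t \in rhs a i -> `|q t.2.2| <= Q) -> `|bil rhs a i p q| <= 3 * (P * Q).
Proof.
move=> P0 Q0 HP HQ; apply: le_trans (ler_norm_sum _ _ _) _.
apply: le_trans (_ : _ <= \sum_(t <- rhs a i) P * Q) _.
  rewrite !big_seq; apply: ler_sum => t tr.
  by rewrite normrM normrX normrN1 expr1n mul1r normrM ler_pM ?HP ?HQ.
rewrite big_const_seq count_predT iter_addr_0 -[leLHS]mulr_natl ler_wpM2r ?mulr_ge0 //.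
by rewrite ler_nat.
Qed.

Lemma bilDl a i p p' q : bil rhs a i (fun b => p b + p' b) q = bil rhs a i p q + bil rhs a i p' q.
Proof.
rewrite /bil -big_split; apply: eq_bigr => t _ /=.
by move: ((-1) ^+ _) => c; ring.
Qed.

Lemma bilDr a i p q q' : bil rhs a i p (fun b => q b + q' b) = bil rhs a i p q + bil rhs a i p q'.
Proof.
rewrite /bil -big_split; apply: eq_bigr => t _ /=.
by move: ((-1) ^+ _) => c; ring.
Qed.

Lemma is_derive_bilf a i (x y : A -> 'rV[R]_m -> R) x' y' u l :
  (forall b, is_derive u (e_ l) (x b) (x' b)) ->
  (forall b, is_derive u (e_ l) (y b) (y' b)) ->
  is_derive u (e_ l) (bilf rhs a i x y)
    (bil rhs a i x' (y^~ u) + bil rhs a i (x^~ u) y').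
Proof.
move=> dx dy; rewrite /bilf /bil; elim: (rhs a i) => [|t r IH].
  rewrite !big_nil addr0 (_ : (fun _ => _) = fun=> 0); last first.
    by apply/funext => v; rewrite big_nil.
  exact: is_derive_cst.
rewrite (_ : (fun _ => _) = fun v => (-1) ^+ t.1.1 * (x t.2.1 v * y t.2.2 v) +
  \sum_(t <- r) (-1) ^+ t.1.1 * (x t.2.1 v * y t.2.2 v)); last first.
  by apply/funext => v; rewrite big_cons.
rewrite !big_cons addrACA -mulrDr; apply: is_deriveD => //.
apply: (@is_deriveZ _ _ _ (fun v => x t.2.1 v * y t.2.2 v)).
exact: is_derive_mul.
Qed.

Variables (J : A -> seq 'I_m -> 'rV[R]_m -> R) (rho B : R).
Hypothesis J_jet : forall a s i u, ocube rho u ->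
  is_derive u (e_ i) (J a s) (J a (i :: s) u).
Hypothesis J_bounded : forall a s, bounded_on (ocube rho) (J a s).
Let X b := J b [::].
Hypothesis J_path : forall a i u, ocube rho u -> ev a i ->
  (forall l, later ev a i l -> u 0 l = 0) -> J a [:: i] u = bilf rhs a i X X u.
Hypothesis XB : forall a u, ocube rho u -> `|X a u| <= B.
Hypotheses (rho_gt0 : 0 < rho) (B_ge0 : 0 <= B).
Hypothesis small : 2 * rho * m%:R * (6 * B) <= 2^-1.
Hypothesis closed : rhs_closed.
Hypothesis compat : rhs_compatible.

Let Dis a i u := J a [:: i] u - bilf rhs a i X X u.

(* In a later direction [j] the defect of the equation in direction [q] has, by
   the symmetry of second derivatives and compatibility, a derivative which is
   bilinear in the unknowns and the defects; as it vanishes where the later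
   coordinates do, it is halved on a small cube. *)
Lemma discrepancy_half (Dt : R) : 0 <= Dt ->
  (forall a i u, ev a i -> ocube rho u -> `|Dis a i u| <= Dt) ->
  forall a i u, ev a i -> ocube rho u -> `|Dis a i u| <= Dt / 2.
Proof.
move=> Dt0 HD a q u aq Qu.
(* A chain from the point where all coordinates later than [q] vanish ([n = 0]), at which the defect
   is 0, to [u] ([n = m]), switching on one coordinate at a time. *)
pose z n := zer (fun l => later ev a q l && (n <= l)%N) u.
have Qz n : ocube rho (z n) by exact: ocube_zer.
have X_der v i b : ocube rho v -> is_derive v (e_ i) (X b) (J b [:: i] v).
  exact: J_jet.
have Dder (j : 'I_m) v : later ev a q j -> ocube rho v ->
    (forall l, later ev a q l -> (j < l)%N -> v 0 l = 0) ->
    exists2 g, is_derive v (e_ j) (Dis a q) g & `|g| <= 12 * B * Dt.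
  move=> lj Qv v0; have /andP[aj qj] := lj.
  have qj' : q != j by rewrite neq_ltn qj.
  pose g1 c := J c [:: j] v; pose g2 c := J c [:: q] v.
  pose x c := X c v.
  exists (J a [:: j; q] v - (bil rhs a q g1 x + bil rhs a q x g1)).
    apply: is_deriveB; first exact: J_jet.
    by apply: is_derive_bilf => b; exact: X_der.
  have Sw : J a [:: j; q] v = J a [:: q; j] v.
    apply: (@schwarz_ocube R m rho (X a) (J a [:: q]) (J a [:: j]) (J a [:: j; q])
      (J a [:: q; j]) (J a [:: q; j; q]) (J a [:: j; j; q]) (J a [:: q; q; j])
      (J a [:: j; q; j]) v q j Qv) => //; by move=> w Qw; exact: J_jet.
  (* As [q < j], moving along [q] leaves the coordinates after [j] at 0. The equation in direction
     [j] holds on a whole segment through [v] and may be differentiated along [q]. *)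
  have Jq : J a [:: q; j] v = bil rhs a j g2 x + bil rhs a j x g2.
    have d1 : is_derive v (e_ q) (bilf rhs a j X X) (J a [:: q; j] v).
      have [dl dl0 Qd] := ocube_open_line q Qv.
      have d2 := J_jet a [:: j] q Qv.
      have near_line : is_derive v (e_ q) (bilf rhs a j X X) (J a [:: q; j] v).
        apply: is_derive_near_line dl0 _ d2 => h hd.
        apply: J_path => //; first exact: Qd.
        move=> l /andP[al jl].
        have ql : (q < l)%N by exact: ltn_trans qj jl.
        rewrite lineE v0 //; last by rewrite /later al.
        by rewrite (_ : (l == q) = false) ?mulr0 ?addr0 //; apply/negbTE; rewrite neq_ltn ql orbT.
      exact: near_line.
    have d2 : is_derive v (e_ q) (bilf rhs a j X X) (bil rhs a j g2 x + bil rhs a j x g2).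
      by apply: is_derive_bilf => b; exact: X_der.
    by rewrite -(is_derive_val d1) (is_derive_val d2).
  pose D1 c := Dis c j v; pose D2 c := Dis c q v.
  pose Q1 c := bil rhs c j x x; pose Q2 c := bil rhs c q x x.
  have E1 : g1 = fun c => Q1 c + D1 c.
    by apply/funext => c; rewrite /Q1 /D1 /Dis /bilf addrC subrK.
  have E2 : g2 = fun c => Q2 c + D2 c.
    by apply/funext => c; rewrite /Q2 /D2 /Dis /bilf addrC subrK.
  have C := @compat a q j x aq aj qj'.
  have Dq t : t \in rhs a j -> (`|D2 t.2.1| <= Dt) /\ (`|D2 t.2.2| <= Dt).
    by move=> tr; have /andP[? ?] := closed aj aq qj' tr; split; exact: HD.
  have Dj t : t \in rhs a q -> (`|D1 t.2.1| <= Dt) /\ (`|D1 t.2.2| <= Dt).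
    have jq' : j != q by rewrite eq_sym.
    by move=> tr; have /andP[? ?] := closed aq aj jq' tr; split; exact: HD.
  have xB c : `|x c| <= B by exact: XB.
  (* After cancellation by compatibility four bilinear forms remain, each of size at most
     [3 * B * Dt]; their sum is the bound [12 * B * Dt]. *)
  have b1 : `|bil rhs a j D2 x| <= 3 * (Dt * B).
    by apply: bil_bound => // t /Dq[].
  have b2 : `|bil rhs a j x D2| <= 3 * (B * Dt).
    by apply: bil_bound => // t /Dq[].
  have b3 : `|bil rhs a q D1 x| <= 3 * (Dt * B).
    by apply: bil_bound => // t /Dj[].
  have b4 : `|bil rhs a q x D1| <= 3 * (B * Dt).
    by apply: bil_bound => // t /Dj[].
  have e1 := @bilDl a j Q2 D2 x; have e2 := @bilDr a j x Q2 D2.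
  have e3 := @bilDl a q Q1 D1 x; have e4 := @bilDr a q x Q1 D1.
  rewrite Sw Jq E1 E2 e1 e2 e3 e4.
  move: C; rewrite /= -/Q1 -/Q2 => C.
  have -> : bil rhs a j Q2 x + bil rhs a j D2 x + (bil rhs a j x Q2 + bil rhs a j x D2) -
     (bil rhs a q Q1 x + bil rhs a q D1 x + (bil rhs a q x Q1 + bil rhs a q x D1)) =
     (bil rhs a j D2 x + bil rhs a j x D2) - (bil rhs a q D1 x + bil rhs a q x D1).
    by lra.
  apply: le_trans (ler_normB _ _) _.
  apply: le_trans (lerD (ler_normD _ _) (ler_normD _ _)) _.
  lra.
have W n : (n <= m)%N -> `|Dis a q (z n)| <= n%:R * (rho * (12 * B * Dt)).
  elim: n => [_|n IH nm].
    rewrite mul0r /Dis J_path ?subrr ?normr0 //.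
    by move=> l ll; rewrite /z zerE ll.
  have := IH (ltnW nm); pose j := Ordinal nm; rewrite -[n.+1%:R]natr1 [X in _ -> _ <= X]mulrDl mul1r.
  have ZE : z n.+1 = z n + (if later ev a q j then u 0 j else 0) *: e_ j.
    apply/rowP => l; rewrite lineE !zerE.
    have [->|lj] := eqVneq l j.
      by rewrite mulr1 /= leqnn ltnn andbT andbF; case: ifP; rewrite ?add0r ?addr0.
    rewrite mulr0 addr0; congr (if _ then _ else _); congr (_ && _).
    by rewrite ltn_neqAle [X in X && _](_ : _ = true) // eq_sym.
  move=> H; have [lj|nlj] := boolP (later ev a q j); last first.
    rewrite ZE (negbTE nlj) scale0r addr0; apply: le_trans H _.
    by rewrite lerDl !mulr_ge0 // ltW.
  rewrite lj in ZE.
  have M : `|Dis a q (z n + u 0 j *: e_ j) - Dis a q (z n)| <= `|u 0 j| * (12 * B * Dt).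
    apply: mvt_bound_ex => t t01.
    apply: Dder => //.
      by apply: ocube_seg => //; rewrite -ZE.
    move=> l ll jl; rewrite lineE zerE ll /= ltnW // add0r.
    by rewrite (_ : (l == j) = false) ?mulr0 //; apply/negbTE; rewrite neq_ltn jl orbT.
  rewrite ZE -[X in `|X|](subrK (Dis a q (z n))) addrC.
  apply: le_trans (ler_normD _ _) _; apply: lerD => //.
  apply: le_trans M _; rewrite ler_wpM2r ?mulr_ge0 //.
  by apply: ltW; exact: Qu.
have zm : z m = u.
  by apply/rowP => l; rewrite zerE leqNgt ltn_ord andbF.
have := W m (leqnn m); rewrite zm => h; apply: le_trans h _.
have : 2 * rho * m%:R * (6 * B) * Dt <= 2^-1 * Dt by rewrite ler_wpM2r.
lra.
Qed.

(** The defects are bounded, and [discrepancy_half] can be applied any number of times. *)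
Lemma system_holds a i u : ocube rho u -> ev a i -> J a [:: i] u = bilf rhs a i X X u.
Proof.
move=> Qu ai; apply/eqP; rewrite -subr_eq0 -/(Dis a i u).
have [M HM] : exists M, 0 <= M /\ forall a i u, ev a i -> ocube rho u -> `|Dis a i u| <= M.
  have [F HF] : exists F : A * 'I_m -> R, forall ai, forall u, ocube rho u -> `|J ai.1 [:: ai.2] u| <= F ai.
    by apply: (@ex_choice _ _ (fun (ai : A * 'I_m) (M : R) =>
      forall u, ocube rho u -> `|J ai.1 [:: ai.2] u| <= M)) => ai'; have [M HM] := J_bounded ai'.1 [:: ai'.2]; exists M.
  have F0 ai' : 0 <= F ai' by apply: le_trans (HF ai' u Qu).
  exists (\sum_ai F ai + 3 * (B * B)); split.
    by rewrite addr_ge0 ?sumr_ge0 // !mulr_ge0.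
  move=> b j v bj Qv; apply: le_trans (ler_normB _ _) _; apply: lerD.
    apply: le_trans (HF (b, j) v Qv) _; rewrite (bigD1 (b, j)) //= lerDl.
    by rewrite sumr_ge0.
  by apply: bil_bound => // t _; exact: XB.
have [M0 H0] := HM.
have HN n : forall a i u, ev a i -> ocube rho u -> `|Dis a i u| <= M / 2 ^+ n.
  elim: n => [|n IH]; first by rewrite expr0 divr1.
  rewrite exprSr invfM mulrA; apply: discrepancy_half => //.
  by rewrite divr_ge0 // exprn_ge0.
have c : (fun=> Dis a i u) @ \oo --> (0 : R).
  by apply: (@geometric_cvg _ _ _ M) => n; rewrite subr0; exact: HN.
by apply/eqP; apply: (cvg_unique _ (cvg_cst _) c).
Qed.

End Compatibility.

(** * Lattice functions *)

Section Lattice.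
Context {R : realType} {m : nat}.
Local Notation pts := ('I_m -> nat).
Implicit Types (i j : 'I_m) (n l : pts) (f g : pts -> R).

Definition inc i n : pts := fun k => (n k + (k == i))%N.

Definition delta (eps : R) i f n : R := eps^-1 * (f (inc i n) - f n).

(** The points of the grid with coordinates up to [K] at which an object reaching [l k] steps along
    each [k] still fits into the grid: [l] is 0 for vertices, [inc i] of 0 for edges, and so on. *)
Definition box (K : nat) l : set pts := [set n | forall k, (n k + l k <= K)%N].

Lemma incC i j n : inc i (inc j n) = inc j (inc i n).
Proof. by apply/funext => k; rewrite /inc addnAC. Qed.

Lemma box_bounded K l f : bounded_on (box K l) f.
Proof.
exists (\sum_(g : {ffun 'I_m -> 'I_K.+1}) `|f (fun k => g k : nat)|) => n Hn.
pose g := [ffun k => inord (n k) : 'I_K.+1].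
have E : n = (fun k => g k : nat).
  apply/funext => k; rewrite ffunE inordK // ltnS.
  by apply: leq_trans (Hn k); exact: leq_addr.
by rewrite {1}E (bigD1 g) //= lerDl sumr_ge0.
Qed.

Definition lattice_calculus (eps : R) (K : nat) : calculus R m.
Proof.
refine (@Calculus R m pts pts (box K) (fun l i => inc i l)
  (fun l l' => forall k, (l k <= l' k)%N) inc (delta eps) (fun _ => True)
  _ _ _ _ _ _ _ _ _ _ _ _ _ _ _ _ _) => //.
- by move=> l f _; exact: box_bounded.
- move=> l i f g _ _ fg n Hn; rewrite /delta !fg //.
    by move=> k; apply: leq_trans (Hn k); rewrite leq_add2l leq_addr.
  by move=> k; have := Hn k; rewrite /inc addnA addnAC.
- by move=> i c n; rewrite /delta subrr mulr0.
- by move=> i f g n _ _; rewrite /delta; ring.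
- by move=> i f g n _ _; rewrite /delta; ring.
- by move=> i j f n _; rewrite /delta incC.
- by move=> l l' ll' n Hn k; apply: leq_trans (Hn k); rewrite leq_add2l.
- by move=> l l' i ll' k; rewrite leq_add2r.
- by move=> l i k; rewrite leq_addr.
- by move=> l i n Hn k; have := Hn k; rewrite /inc addnA addnAC.
- by move=> l i j; rewrite incC.
Defined.

Definition zl (L : pred 'I_m) n : pts := fun k => if L k then 0%N else n k.

Lemma zl_inc L i n : zl L (inc i n) = if L i then zl L n else inc i (zl L n).
Proof.
apply/funext => k; have [->|ki] := eqVneq k i.
  by rewrite /zl /inc; case: ifP => Li //; rewrite Li.
by rewrite /zl /inc; case: (L i); rewrite (negbTE ki) /= !addn0.
Qed.

Lemma delta_zl eps L i f : delta eps i (fun n => f (zl L n)) =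
  fun n => if L i then 0 else delta eps i f (zl L n).
Proof.
apply/funext => n; rewrite /delta zl_inc; case: (L i) => //.
by rewrite subrr mulr0.
Qed.

Lemma deltaC eps i j f : delta eps i (delta eps j f) = delta eps j (delta eps i f).
Proof. by apply/funext => n; rewrite /delta incC; ring. Qed.

Lemma box_zl K L l n : box K l n -> box K l (zl L n).
Proof.
move=> Hn k; rewrite /zl; case: (L k); last exact: Hn.
by rewrite add0n; apply: leq_trans (Hn k); rewrite leq_addl.
Qed.

Section LatticeNorm.
Variables (eps mu r : R) (K : nat).
Hypotheses (eps_gt0 : 0 < eps) (mu_ge0 : 0 <= mu) (epsK : eps * K%:R <= r).
Local Notation C := (lattice_calculus eps K).
Local Notation N k l f := (@nrm R m C mu k l f).

Let r_ge0 : 0 <= r.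
Proof. by apply: le_trans epsK; rewrite mulr_ge0 // ltW. Qed.

Lemma nrm_zl k l (L : pred 'I_m) f : N k l (fun n => f (zl L n)) <= N k l f.
Proof.
elim: k l f => [|k IH] l f /=.
  apply: supn_le => [|n Hn]; first exact: supn_ge0.
  by apply: supn_ub; [exact: box_bounded | exact: box_zl].
rewrite lerD ?IH // ler_wpM2l // ler_sum // => i _.
rewrite delta_zl; case: (L i); last exact: IH.
by apply: le_trans (@nrmC _ _ C _ _ _ _) _; rewrite normr0 nrm_ge0.
Qed.

Lemma sup_step l i f n : box K l n ->
  `|f n| <= `|f (zl (pred1 i) n)| + eps * (n i)%:R * supn (box K (inc i l)) (delta eps i f).
Proof.
move: {2}(n i) (erefl (n i)) => p; elim: p n => [|p IH] n np Hn.
  rewrite np mulr0 mul0r addr0; suff -> : zl (pred1 i) n = n by [].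
  by apply/funext => k; rewrite /zl /=; case: eqP => [->|].
pose n' : pts := fun k => if k == i then p else n k.
have E : n = inc i n'.
  by apply/funext => k; rewrite /inc /n'; case: eqP => [->|]; rewrite ?np ?addn1 ?addn0.
have zE : zl (pred1 i) n = zl (pred1 i) n'.
  by rewrite E zl_inc /= eqxx.
have Hn' : box K (inc i l) n'.
  by move=> k; have := Hn k; rewrite {1}E /inc addnA addnAC.
have Hn'' : box K l n'.
  by move=> k; apply: leq_trans (Hn' k); rewrite leq_add2l leq_addr.
have pi : n' i = p by rewrite /n' eqxx.
have := IH n' pi Hn''; rewrite zE np pi -natr1.
have Dn := @supn_ub _ _ (box K (inc i l)) (delta eps i f) n' (@box_bounded _ _ _) Hn'.
set S := supn _ _ in Dn *.
have fE : f n = f n' + eps * delta eps i f n'.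
  by rewrite /delta mulrA mulfV ?gt_eqF // mul1r -E addrC subrK.
have : `|f n| <= `|f n'| + eps * S.
  rewrite fE; apply: le_trans (ler_normD _ _) _; rewrite lerD2l normrM (gtr0_norm eps_gt0).
  by rewrite ler_wpM2l // ltW.
lra.
Qed.

(** The lattice counterpart of [nrm_intop]. Telescoping along [i] crosses at most [K] edges of
    length [eps], whence the factor [r]. At each further order the quotient along [i] is itself the
    quantity on the right and enters with weight [mu]. *)
Lemma nrm_poincare k l i f :
  N k l f <= N k l (fun n => f (zl (pred1 i) n)) + (r + mu * k%:R) * N k (inc i l) (delta eps i f).
Proof.
elim: k l f => [|k IH] l f.
  rewrite mulr0 addr0 /=.
  apply: supn_le => [|n Hn]; first by rewrite addr_ge0 ?mulr_ge0 ?supn_ge0.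
  apply: le_trans (sup_step i f Hn) _; apply: lerD.
    by apply: (@supn_ub _ _ _ (fun n => f (zl (pred1 i) n))) => //; exact: box_bounded.
  rewrite ler_wpM2r ?supn_ge0 //; apply: le_trans epsK; rewrite ler_wpM2l ?(ltW eps_gt0) //.
  by rewrite ler_nat; apply: leq_trans (Hn i); rewrite leq_addr.
pose F j := N k (inc j l) (delta eps j f).
pose G j := N k (inc j l) (delta eps j (fun n => f (zl (pred1 i) n))).
pose H j := N k (inc j (inc i l)) (delta eps j (delta eps i f)).
have H0 j : 0 <= H j by exact: nrm_ge0.
have rk0 : 0 <= r + mu * k%:R by rewrite addr_ge0 // mulr_ge0.
have S : \sum_j F j <= F i + \sum_j G j + (r + mu * k%:R) * \sum_j H j.
  rewrite (bigD1 i) //= -addrA lerD2l.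
  apply: le_trans (_ : _ <= \sum_(j < m | j != i) (G j + (r + mu * k%:R) * H j)) _.
    apply: ler_sum => j ji; apply: le_trans (IH _ _) _.
    rewrite incC deltaC /G delta_zl /= (negbTE ji) -/(H j).
    by [].
  rewrite big_split /= -mulr_sumr; apply: lerD.
    by rewrite [leRHS](bigD1 i) //= lerDr nrm_ge0.
  by rewrite ler_wpM2l // [leRHS](bigD1 i) //= lerDr.
rewrite -natr1 /= -/(G _) -/(H _).
apply: le_trans (lerD (IH l f) (ler_wpM2l mu_ge0 S)) _.
have hh : 0 <= mu * (mu * \sum_j H j) by rewrite !mulr_ge0 // sumr_ge0.
rewrite -/(F i); set a := N k l _; set SG := \sum_j G j; set SH := \sum_j H j in hh *.
by set f' := F i; lra.
Qed.

Lemma nrm_poincare_seq k l (s : seq 'I_m) f :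
  N k l f <= N k l (fun n => f (zl (mem s) n)) +
    \sum_(i <- s) (r + mu * k%:R) * N k (inc i l) (delta eps i f).
Proof.
have rk0 : 0 <= r + mu * k%:R by rewrite addr_ge0 // mulr_ge0.
elim: s => [|i s IH].
  by rewrite big_nil addr0 (_ : (fun n => f (zl (mem [::]) n)) = f).
rewrite big_cons; apply: le_trans IH _.
rewrite addrA lerD2r.
apply: le_trans (nrm_poincare k l i (fun n => f (zl (mem s) n))) _.
have -> : (fun n => f (zl (mem s) (zl (pred1 i) n))) = (fun n => f (zl (mem (i :: s)) n)).
  apply/funext => n; congr f; apply/funext => j; rewrite /zl /= inE.
  by case: (j == i); case: (j \in s).
rewrite lerD2l ler_wpM2l // delta_zl.
case: (mem s i) => /=; last exact: nrm_zl.
by apply: le_trans (@nrmC _ _ C _ _ _ _) _; rewrite normr0 nrm_ge0.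
Qed.

End LatticeNorm.

End Lattice.

(** * Error estimate for lattice solutions *)

Section LatticeConvergence.
Context {R : realType} {m : nat} {A : finType}.
Local Notation pts := ('I_m -> nat).
Variables (ev : A -> pred 'I_m)
  (rhs : A -> 'I_m -> seq (bool * option 'I_m * (A * A))) (ell : A -> pts).
Implicit Types (a b : A) (i : 'I_m) (n l : pts) (k j : nat) (x y : A -> pts -> R).

Definition osh (o : option 'I_m) n : pts := if o is Some k then inc k n else n.

Definition dbilf a i x y n : R :=
  \sum_(t <- rhs a i) (-1) ^+ t.1.1 * (x t.2.1 (osh t.1.2 n) * y t.2.2 n).

(** The equation of [a] in direction [i] is posed at level [inc i (ell a)]. There the first factor
    of each term, after its shift, and the second factor have to be defined. *)
Definition rhs_levels := forall a i t, ev a i -> t \in rhs a i ->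
  (forall p, (osh t.1.2 (ell t.2.1) p <= inc i (ell a) p)%N) /\
  (forall p, (ell t.2.2 p <= inc i (ell a) p)%N).

Hypothesis rhs_size : forall a i, (size (rhs a i) <= 3)%N.
Hypothesis levels : rhs_levels.

Variables (eps mu r : R) (K : nat).
Hypotheses (eps_gt0 : 0 < eps) (mu_ge0 : 0 <= mu) (epsK : eps * K%:R <= r).
Local Notation C := (lattice_calculus eps K).
Local Notation N k l f := (@nrm R m C mu k l f).

Let nrmM_l k l f g : N k l (fun n => f n * g n) <= N k l f * N k l g.
Proof. exact: (@nrmM _ _ C mu mu_ge0 k l f g). Qed.

Let nrmMS_l k l f g : N k.+1 l (fun n => f n * g n) <=
  N k l f * N k.+1 l g + N k.+1 l f * N k l g.
Proof. exact: (@nrmMS _ _ C mu mu_ge0 k l f g). Qed.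

Lemma nrm_osh k l l' o f : (forall p, (osh o l p <= l' p)%N) ->
  N k l' (fun n => f (osh o n)) <= N k l f.
Proof.
case: o => [q|] /= H; last exact: (@nrm_lel _ _ C mu mu_ge0 k l l' f).
apply: le_trans (@nrm_lel _ _ C mu mu_ge0 k (inc q l) l' (fun n => f (inc q n)) _ H) _ => //.
exact: (@nrm_shp _ _ C mu mu_ge0 k l q f).
Qed.

Lemma nrm_dbilf k a i x y (P : R) : 0 <= P ->
  (forall t, t \in rhs a i ->
    N k (inc i (ell a)) (fun n => x t.2.1 (osh t.1.2 n) * y t.2.2 n) <= P) ->
  N k (inc i (ell a)) (dbilf a i x y) <= 3 * P.
Proof.
move=> P0 HP.
pose F (t : bool * option 'I_m * (A * A)) n :=
  (-1) ^+ t.1.1 * (x t.2.1 (osh t.1.2 n) * y t.2.2 n) : R.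
have H := @nrm_sum _ _ C mu mu_ge0 k (inc i (ell a)) _ (rhs a i) F (fun _ => I).
apply: le_trans H _.
apply: le_trans (_ : _ <= \sum_(t <- rhs a i) P) _.
  rewrite !big_seq; apply: ler_sum => t tr.
  apply: le_trans (@nrmZ _ _ C mu mu_ge0 k _ _ (fun n => x t.2.1 (osh t.1.2 n) * y t.2.2 n) I) _.
  by rewrite normrX normrN1 expr1n mul1r HP.
rewrite big_const_seq count_predT iter_addr_0 -[leLHS]mulr_natl ler_wpM2r //.
by rewrite ler_nat.
Qed.

Variables (X Z : A -> pts -> R) (B B1 kappa : R).
Hypotheses (B_ge0 : 0 <= B) (B1_ge0 : 0 <= B1) (kappa_ge0 : 0 <= kappa).
Hypothesis Z_eq : forall a i n, ev a i -> box K (inc i (ell a)) n ->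
  delta eps i (Z a) n = dbilf a i Z Z n.

Let y a n := Z a n - X a n.

Section Step.
Variable k : nat.
Hypothesis NX : forall a, N k (ell a) (X a) <= B.
Hypothesis Ne : forall a i, ev a i ->
  N k (inc i (ell a)) (fun n => delta eps i (X a) n - dbilf a i X X n) <= kappa.
Hypothesis Nd : forall a, N k (ell a) (fun n => y a (zl (ev a) n)) <= kappa.
Variable H : R.
Hypotheses (H_ge0 : 0 <= H) (rk_le1 : (r + mu * k%:R) * m%:R <= 1).
Hypothesis small : (r + mu * k%:R) * m%:R * (3 * (2 * B + H)) <= 2^-1.

(** The error satisfies [delta y = bil(y, X) + bil(X, y) + bil(y, y) - e], with [e] the consistency
    error. Once products of errors are bounded by [H * M], the equation behaves as a linear one, and
    the discrete Poincare inequality gains the small factor. *)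
Lemma convergence_half (M : R) : 0 <= M -> (forall a, N k (ell a) (y a) <= M) ->
  (forall a i t, ev a i -> t \in rhs a i ->
    N k (inc i (ell a)) (fun n => y t.2.1 (osh t.1.2 n) * y t.2.2 n) <= H * M) ->
  forall a, N k (ell a) (y a) <= 2 * kappa + M / 2.
Proof.
move=> M0 HM HH a.
have r0 : 0 <= r by apply: le_trans epsK; rewrite mulr_ge0 // ltW.
have rk0 : 0 <= r + mu * k%:R by rewrite addr_ge0 // mulr_ge0.
have D i : ev a i -> N k (inc i (ell a)) (delta eps i (y a)) <=
    3 * (2 * B + H) * M + kappa.
  move=> ai; pose l := inc i (ell a).
  pose e n := delta eps i (X a) n - dbilf a i X X n.
  pose T1 n := dbilf a i y X n; pose T2 n := dbilf a i X y n; pose T3 n := dbilf a i y y n.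
  have E n : box K l n -> delta eps i (y a) n = (T1 n + T2 n) + T3 n + - e n.
    move=> Hn; have := Z_eq ai Hn; rewrite /e /T1 /T2 /T3 /y.
    have -> : delta eps i (fun n => Z a n - X a n) n = delta eps i (Z a) n - delta eps i (X a) n.
      by rewrite /delta; ring.
    move=> ->; rewrite opprB addrA; congr (_ - _).
    rewrite /dbilf -!big_split /=; apply: eq_bigr => t _.
    by move: ((-1) ^+ _) => c; ring.
  have -> : N k l (delta eps i (y a)) = N k l (fun n => (T1 n + T2 n) + T3 n + - e n).
    exact: (@nrm_ext _ _ C mu k l).
  apply: le_trans (@nrmD _ _ C mu mu_ge0 k l (fun n => T1 n + T2 n + T3 n) (fun n => - e n) I I) _.
  apply: lerD; last first.
    by apply: le_trans (@nrmN _ _ C mu mu_ge0 k l e I) _; exact: Ne.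
  apply: le_trans (@nrmD _ _ C mu mu_ge0 k l (fun n => T1 n + T2 n) T3 I I) _.
  have -> : 3 * (2 * B + H) * M = (3 * (M * B) + 3 * (B * M)) + 3 * (H * M) by ring.
  apply: lerD; last first.
    by apply: nrm_dbilf; [rewrite mulr_ge0 | move=> t tr; exact: HH].
  apply: le_trans (@nrmD _ _ C mu mu_ge0 k l T1 T2 I I) _.
  apply: lerD; (apply: nrm_dbilf; first by rewrite mulr_ge0) => t tr.
    have [l1 l2] := levels ai tr.
    apply: le_trans (nrmM_l _ _ (fun n => y t.2.1 (osh t.1.2 n)) (X t.2.2)) _.
    apply: ler_pM; rewrite ?nrm_ge0 //.
      by apply: le_trans (HM t.2.1); exact: nrm_osh.
    by apply: le_trans (NX t.2.2); exact: (@nrm_osh _ _ _ None).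
  have [l1 l2] := levels ai tr.
  apply: le_trans (nrmM_l _ _ (fun n => X t.2.1 (osh t.1.2 n)) (y t.2.2)) _.
  apply: ler_pM; rewrite ?nrm_ge0 //.
    by apply: le_trans (NX t.2.1); exact: nrm_osh.
  by apply: le_trans (HM t.2.2); exact: (@nrm_osh _ _ _ None).
have P := @nrm_poincare_seq R m eps mu r K eps_gt0 mu_ge0 epsK k (ell a)
  [seq i <- enum 'I_m | ev a i] (y a).
apply: le_trans P _.
have -> : (fun n => y a (zl (mem [seq i <- enum 'I_m | ev a i]) n)) =
    (fun n => y a (zl (ev a) n)).
  apply/funext => n; congr (y a _); apply/funext => i; rewrite /zl /=.
  by rewrite mem_filter mem_enum andbT.
have S : \sum_(i <- [seq i <- enum 'I_m | ev a i])
    (r + mu * k%:R) * N k (inc i (ell a)) (delta eps i (y a)) <=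
    m%:R * ((r + mu * k%:R) * (3 * (2 * B + H) * M + kappa)).
  have X0 : 0 <= (r + mu * k%:R) * (3 * (2 * B + H) * M + kappa).
    by rewrite mulr_ge0 // addr_ge0 // !mulr_ge0 // addr_ge0 // mulr_ge0.
  rewrite big_filter.
  apply: le_trans (_ : _ <= \sum_(i <- enum 'I_m | ev a i)
      (r + mu * k%:R) * (3 * (2 * B + H) * M + kappa)) _.
    by apply: ler_sum => i ai; rewrite ler_wpM2l // D.
  rewrite big_mkcond /=; apply: le_trans (_ : _ <= \sum_(i <- enum 'I_m)
      (r + mu * k%:R) * (3 * (2 * B + H) * M + kappa)) _.
    by apply: ler_sum => i _; case: (ev a i).
  by rewrite big_const_seq count_predT iter_addr_0 size_enum_ord -[leLHS]mulr_natl.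
apply: le_trans (lerD (Nd a) S) _.
have h1 : (r + mu * k%:R) * m%:R * (3 * (2 * B + H)) * M <= 2^-1 * M by rewrite ler_wpM2r.
have h2 : (r + mu * k%:R) * m%:R * kappa <= 1 * kappa by rewrite ler_wpM2r.
lra.
Qed.

(** The boxes are finite, so some bound [M0] exists, possibly a very large one. Iterating
    [M |-> 2 * kappa + M / 2] brings it down to the fixed point [4 * kappa]. *)
Lemma convergence_step :
  (forall a i t (M : R), 0 <= M -> (forall b, N k (ell b) (y b) <= M) ->
    ev a i -> t \in rhs a i ->
    N k (inc i (ell a)) (fun n => y t.2.1 (osh t.1.2 n) * y t.2.2 n) <= H * M) ->
  forall a, N k (ell a) (y a) <= 4 * kappa.
Proof.
move=> HH.
pose M0 := \sum_b N k (ell b) (y b).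
have M00 : 0 <= M0 by rewrite sumr_ge0 // => b _; exact: nrm_ge0.
have it p : forall a, N k (ell a) (y a) <= 4 * kappa + M0 / 2 ^+ p.
  elim: p => [|p IH] a.
    rewrite expr0 divr1 /M0 (bigD1 a) //= addrCA lerDl addr_ge0 ?mulr_ge0 //.
    by rewrite sumr_ge0 // => b _; exact: nrm_ge0.
  have M1 : 0 <= 4 * kappa + M0 / 2 ^+ p by rewrite addr_ge0 ?mulr_ge0 ?divr_ge0 ?exprn_ge0.
  apply: le_trans (convergence_half M1 IH _ a) _.
    by move=> b i t bi tr; exact: HH.
  by rewrite exprSr invfM mulrA; lra.
move=> a; have c : (fun p => 4 * kappa + M0 / 2 ^+ p) @ \oo --> 4 * kappa.
  apply: (@geometric_cvg _ _ _ M0) => p; rewrite addrAC subrr add0r.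
  by rewrite ger0_norm // divr_ge0 // exprn_ge0.
apply: (cvgr_to_ge c); near=> p; exact: it.
Unshelve. all: by end_near. Qed.

End Step.

Variable k : nat.
Hypothesis NX : forall a, N k (ell a) (X a) <= B.
Hypothesis Ne : forall a i, ev a i ->
  N k (inc i (ell a)) (fun n => delta eps i (X a) n - dbilf a i X X n) <= kappa.
Hypothesis Nd : forall a, N k (ell a) (fun n => y a (zl (ev a) n)) <= kappa.
Hypothesis Z_bound : forall a n, box K (ell a) n -> `|Z a n| <= B1.
Let H := B + B1 + 1.
Hypotheses (rk_le1 : (r + mu * k%:R) * m%:R <= 1) (kappa_small : 8 * kappa <= 1).
Hypothesis small : (r + mu * k%:R) * m%:R * (3 * (2 * B + H)) <= 2^-1.

(** Induction on the order, to control products of two errors. At order 0 one factor is bounded by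
    [B + B1]. At order [j.+1] each term of [nrmMS] has a factor of order [j], already at most
    [4 * kappa], and [8 * kappa <= 1] absorbs both terms. *)
Lemma lattice_convergence j : (j <= k)%N -> forall a, N j (ell a) (y a) <= 4 * kappa.
Proof.
have H0 : 0 <= H by rewrite /H !addr_ge0.
have mono q : (q <= k)%N -> [/\ forall a, N q (ell a) (X a) <= B,
    forall a i, ev a i ->
      N q (inc i (ell a)) (fun n => delta eps i (X a) n - dbilf a i X X n) <= kappa,
    forall a, N q (ell a) (fun n => y a (zl (ev a) n)) <= kappa &
    (r + mu * q%:R) * m%:R <= 1 /\
    (r + mu * q%:R) * m%:R * (3 * (2 * B + H)) <= 2^-1].
  move=> qk; have le l f : N q l f <= N k l f by exact: nrm_le_order.
  have rq : (r + mu * q%:R) * m%:R <= (r + mu * k%:R) * m%:R.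
    by rewrite ler_wpM2r // lerD2l ler_wpM2l // ler_nat.
  split; last split.
  - by move=> a; exact: le_trans (le _ _) (NX a).
  - by move=> a i ai; exact: le_trans (le _ _) (Ne ai).
  - by move=> a; exact: le_trans (le _ _) (Nd a).
  - exact: le_trans rk_le1.
  - apply: le_trans small; rewrite ler_wpM2r // mulr_ge0 // addr_ge0 // mulr_ge0 //.
elim: j => [_|j IH jk].
  have [h1 h2 h3 [h4 h5]] := mono 0%N (leq0n _).
  apply: (@convergence_step 0 h1 h2 h3 H) => // a i t M M0 HM ai tr.
  have [l1 l2] := levels ai tr.
  have yB b : N 0 (ell b) (y b) <= H.
    apply: supn_le => // n Hn; rewrite /y.
    apply: le_trans (ler_normB _ _) _.
    have := Z_bound Hn; have := @supn_ub _ _ _ (X b) n (@box_bounded _ _ K (ell b) _) Hn.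
    have := h1 b; rewrite /= /H; lra.
  apply: le_trans (nrmM_l _ _ (fun n => y t.2.1 (osh t.1.2 n)) (y t.2.2)) _.
  apply: ler_pM; rewrite ?nrm_ge0 //.
    by apply: le_trans (yB t.2.1); exact: nrm_osh.
  by apply: le_trans (HM t.2.2); exact: (@nrm_osh _ _ _ None).
have {}IH := IH (ltnW jk).
have [h1 h2 h3 [h4 h5]] := mono _ jk.
apply: (@convergence_step j.+1 h1 h2 h3 H) => // a i t M M0 HM ai tr.
have [l1 l2] := levels ai tr.
apply: le_trans (nrmMS_l _ _ (fun n => y t.2.1 (osh t.1.2 n)) (y t.2.2)) _.
have k0 : 0 <= 4 * kappa by rewrite mulr_ge0.
apply: le_trans (_ : _ <= 4 * kappa * M + M * (4 * kappa)) _.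
  apply: lerD; apply: ler_pM; rewrite ?nrm_ge0 //.
  - by apply: le_trans (IH t.2.1); exact: nrm_osh.
  - by apply: le_trans (HM t.2.2); exact: (@nrm_osh _ _ _ None).
  - by apply: le_trans (HM t.2.1); exact: nrm_osh.
  - by apply: le_trans (IH t.2.2); exact: (@nrm_osh _ _ _ None).
have : 8 * kappa * M <= 1 * M by rewrite ler_wpM2r.
have : 1 * M <= H * M by rewrite ler_wpM2r // /H lerDr addr_ge0.
lra.
Qed.

End LatticeConvergence.

(** * Difference quotients of smooth functions *)

Section DifferenceQuotients.
Context {R : realType} {m : nat}.
Local Notation pts := ('I_m -> nat).
Implicit Types (i j : 'I_m) (u v w : 'rV[R]_m) (f g : 'rV[R]_m -> R)
  (s t : seq 'I_m) (eps rho h M : R).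

Local Notation e_ := (@basis_vec R m).

Definition dq eps i f u : R := eps^-1 * (f (u + eps *: e_ i) - f u).

Definition dqs eps s f : 'rV[R]_m -> R := foldr (dq eps) f s.

(** A function with all its iterated derivatives, indexed by words and described on the open cube
    only. This covers both globally smooth functions and the limits [jet]. *)
Definition jets rho (J : seq 'I_m -> 'rV[R]_m -> R) := forall s i u, ocube rho u ->
  is_derive u (e_ i) (J s) (J (i :: s) u).

Lemma jets_cat rho J t : jets rho J -> jets rho (fun s => J (s ++ t)).
Proof. by move=> HJ s i u Qu; exact: HJ. Qed.

Lemma jets_all_bounded rho J k : jets rho J -> (forall s, bounded_on (ocube rho) (J s)) ->
  exists2 M, 0 <= M & forall s u, (size s <= k)%N -> ocube rho u -> `|J s u| <= M.
Proof.
elim: k J => [|k IH] J HJ HB.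
  have [M HM] := HB [::]; exists `|M| => // -[|//] u _ Qu.
  by apply: le_trans (HM u Qu) (ler_norm _).
have [M0 M00 H0] := IH J HJ HB.
have [F HF] : exists F : 'I_m -> R, forall i, 0 <= F i /\ forall s u,
    (size s <= k)%N -> ocube rho u -> `|J (s ++ [:: i]) u| <= F i.
  apply: (@ex_choice _ _ (fun i (M : R) => 0 <= M /\ forall s u,
    (size s <= k)%N -> ocube rho u -> `|J (s ++ [:: i]) u| <= M)) => i.
  by have [M ? ?] := IH _ (jets_cat [:: i] HJ) (fun s => HB _); exists M.
have F0 i : 0 <= F i by have [] := HF i.
exists (M0 + \sum_i F i); first by rewrite addr_ge0 // sumr_ge0.
move=> s u; case/lastP: s => [|s i] sz Qu.
  by apply: le_trans (H0 [::] u _ Qu) _ => //; rewrite lerDl sumr_ge0.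
rewrite size_rcons ltnS in sz.
have [_ H] := HF i; rewrite -cats1.
apply: le_trans (H s u sz Qu) _; rewrite (bigD1 i) //= addrCA lerDl.
by rewrite addr_ge0 // sumr_ge0.
Qed.

Lemma ocubeW (a b : R) u : a <= b -> ocube a u -> ocube b u.
Proof. by move=> ab Qu k; exact: lt_le_trans (Qu k) ab. Qed.

Lemma ocube_shift (a h : R) u i : 0 <= h -> ocube (a - h) u -> ocube a (u + h *: e_ i).
Proof.
move=> h0 Qu k; rewrite lineE; apply: le_lt_trans (ler_normD _ _) _.
rewrite -ltrBrDr; apply: lt_le_trans (Qu k) _; rewrite lerD2l lerN2.
by case: eqP => _; rewrite ?mulr1 ?mulr0 ?normr0 // ger0_norm.
Qed.

Lemma dqs_is_derive rho eps s f g i u : 0 < eps ->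
  (forall v, ocube rho v -> is_derive v (e_ i) f (g v)) ->
  ocube (rho - eps * (size s)%:R) u -> is_derive u (e_ i) (dqs eps s f) (dqs eps s g u).
Proof.
move=> eps0 D; elim: s u => [|j s IH] u /=.
  by rewrite mulr0 subr0; exact: D.
rewrite -natr1 mulrDr mulr1 opprD addrA => Qu.
rewrite /dq; apply: (@is_deriveZ _ _ _
  (fun u => dqs eps s f (u + eps *: e_ j) - dqs eps s f u)).
apply: is_deriveB.
  apply: is_derive_translate; apply: IH.
  exact: ocube_shift (ltW eps0) Qu.
apply: IH; apply: ocubeW Qu; lra.
Qed.

Lemma dqsB eps s f g u : dqs eps s (fun v => f v - g v) u = dqs eps s f u - dqs eps s g u.
Proof.
elim: s u => [//|i s IH] u /=; rewrite /dq !IH; ring.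
Qed.

Lemma dqsC eps s i f : dqs eps s (dq eps i f) = dq eps i (dqs eps s f).
Proof.
elim: s => [//|j s IH] /=; rewrite IH; apply/funext => u; rewrite /dq.
rewrite [u + eps *: e_ j + _]addrAC; ring.
Qed.

Lemma dqs_translate eps s f w u : dqs eps s (fun v => f (v + w)) u = dqs eps s f (u + w).
Proof.
by elim: s u => [//|i s IH] u /=; rewrite /dq !IH [u + w + _]addrAC.
Qed.

(** By the mean value theorem each quotient is a derivative at an intermediate point. The outermost
    quotient is converted first, so the derivatives pile up in the order [rev s], and each quotient
    uses up a margin [eps] of the cube. *)
Lemma dqs_bound rho eps s J M u : 0 < eps -> jets rho J ->
  (forall v, ocube rho v -> `|J (rev s) v| <= M) ->
  ocube (rho - eps * (size s)%:R) u -> `|dqs eps s (J [::]) u| <= M.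
Proof.
move=> eps0; elim: s J u => [|i s IH] J u HJ HM /=.
  by rewrite mulr0 subr0 => Qu; exact: HM.
rewrite -natr1 mulrDr mulr1 opprD addrA => Qu.
have Qu' : ocube (rho - eps * (size s)%:R) u by apply: ocubeW Qu; lra.
have Qs := ocube_shift i (ltW eps0) Qu.
rewrite /dq normrM normfV (gtr0_norm eps0) mulrC ler_pdivrMr // [leRHS]mulrC.
rewrite -[X in _ <= X * _](gtr0_norm eps0).
apply: mvt_bound_ex => t t01; exists (dqs eps s (J [:: i]) (u + (t * eps) *: e_ i)).
  apply: (@dqs_is_derive rho) => //; first by move=> v Qv; exact: HJ.
  exact: ocube_seg.
apply: (IH (fun s => J (s ++ [:: i]))); first exact: jets_cat.
  by move=> v Qv; rewrite cats1 -rev_cons; exact: HM.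
exact: ocube_seg.
Qed.

(** Difference quotients commute, so the Taylor estimate along [i] may be applied to [dqs eps s] of
    the function and divided by [eps]. *)
Lemma dqs_consistency rho eps s J i M u : 0 < eps -> jets rho J ->
  (forall v, ocube rho v -> `|J (rev s ++ [:: i; i]) v| <= M) ->
  ocube (rho - eps * (size s).+1%:R) u ->
  `|dqs eps s (fun v => dq eps i (J [::]) v - J [:: i] v) u| <= M * eps.
Proof.
move=> eps0 HJ HM; rewrite -natr1 mulrDr mulr1 opprD addrA => Qu.
rewrite dqsB dqsC.
have Qu' : ocube (rho - eps * (size s)%:R) u by apply: ocubeW Qu; lra.
have Qs := ocube_shift i (ltW eps0) Qu.
pose F := dqs eps s (J [::]); pose F1 := dqs eps s (J [:: i]).
pose F2 := dqs eps s (J [:: i; i]).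
have T := @taylor_bound R m F F1 F2 u i eps M.
have {}T : `|F (u + eps *: e_ i) - F u - eps * F1 u| <= M * eps ^+ 2.
  lapply T.
    move=> {}T; lapply T.
      move=> {}T; lapply T; first by move=> {}T.
      move=> t t01; apply: (@dqs_bound rho eps s (fun s => J (s ++ [:: i; i]))) => //.
        exact: jets_cat.
      exact: ocube_seg.
    move=> t t01; apply: (@dqs_is_derive rho) => //; first by move=> v Qv; exact: HJ.
    exact: ocube_seg.
  move=> t t01; apply: (@dqs_is_derive rho) => //; first by move=> v Qv; exact: HJ.
  exact: ocube_seg.
rewrite /dq -/F -/F1.
have -> : eps^-1 * (F (u + eps *: e_ i) - F u) - F1 u =
    eps^-1 * (F (u + eps *: e_ i) - F u - eps * F1 u).
  by field; rewrite gt_eqF.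
rewrite normrM normfV (gtr0_norm eps0) mulrC ler_pdivrMr //.
by apply: le_trans T _; rewrite expr2 mulrA.
Qed.

Lemma dqs_shift_bound rho eps s J i h M u : 0 < eps -> 0 <= h -> jets rho J ->
  (forall v, ocube rho v -> `|J (rev s ++ [:: i]) v| <= M) ->
  ocube (rho - eps * (size s)%:R - h) u ->
  `|dqs eps s (J [::]) (u + h *: e_ i) - dqs eps s (J [::]) u| <= h * M.
Proof.
move=> eps0 h0 HJ HM Qu.
have Qu' : ocube (rho - eps * (size s)%:R) u by apply: ocubeW Qu; lra.
have Qs := ocube_shift i h0 Qu.
rewrite -[X in _ <= X * _](ger0_norm h0).
apply: mvt_bound_ex => t t01; exists (dqs eps s (J [:: i]) (u + (t * h) *: e_ i)).
  apply: (@dqs_is_derive rho) => //; first by move=> v Qv; exact: HJ.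
  exact: ocube_seg.
apply: (@dqs_bound rho eps s (fun s => J (s ++ [:: i]))) => //.
  exact: jets_cat.
exact: ocube_seg.
Qed.

Definition lat eps (n : pts) : 'rV[R]_m := \row_k (eps * (n k)%:R).

Lemma lat_inc eps i (n : pts) : lat eps (inc i n) = lat eps n + eps *: e_ i.
Proof.
by apply/rowP => k; rewrite lineE !mxE /inc natrD mulrDr.
Qed.

Lemma dfiter_lat eps K s f (n : pts) :
  @dfiter R m (lattice_calculus eps K) s (fun n => f (lat eps n)) n = dqs eps s f (lat eps n).
Proof.
by elim: s n => [//|i s IH] n /=; rewrite /delta !IH lat_inc.
Qed.

Lemma lat_cube eps K r a (n : pts) : 0 < eps -> eps * K%:R <= r -> r < a ->
  (forall k, (n k <= K)%N) -> ocube a (lat eps n).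
Proof.
move=> eps0 eK ra nK k; rewrite mxE ger0_norm ?mulr_ge0 ?(ltW eps0) //.
apply: le_lt_trans ra; apply: le_trans eK; rewrite ler_wpM2l ?(ltW eps0) //.
by rewrite ler_nat.
Qed.

Lemma box_le K l (n : pts) : box K l n -> forall k, (n k <= K)%N.
Proof. by move=> Hn k; apply: leq_trans (Hn k); rewrite leq_addr. Qed.

Lemma box_lev eps K l s (n : pts) :
  box K (@lev R m (lattice_calculus eps K) l s) n -> box K l n.
Proof.
elim: s l => [//|i s IH] l /= H; apply: IH => k.
by apply: leq_trans (H k); rewrite leq_add2l /= leq_addr.
Qed.

End DifferenceQuotients.

(** * Conjugate nets as a quadratic first order system *)

Section ConjugateNetSystem.
Context {m N : nat}.
Implicit Types (i j k l : 'I_m) (c : 'I_N).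

(* The unknowns of the first order system: the constant 1 (which makes the system
   homogeneous quadratic), the components of f, those of the tangent vectors
   w_i = d_i f, and the coefficients c_ij. *)
Definition idx : finType := (unit + 'I_N + 'I_m * 'I_N + 'I_m * 'I_m)%type.

Definition xOne : idx := inl (inl (inl tt)).
Definition xF c : idx := inl (inl (inr c)).
Definition xW i c : idx := inl (inr (i, c)).
Definition xC i j : idx := inr (i, j).

Definition qev (a : idx) : pred 'I_m := fun k =>
  match a with
  | inl (inl _) => true
  | inl (inr (i, _)) => k != i
  | inr (i, j) => [&& i != j, k != i & k != j]
  end.

(* In a term [(b, o, (x, y))] the sign is [(-1) ^ b], and in the discrete system
   the factor [x] is shifted in the direction [o]. *)
Definition qrhs (a : idx) i : seq (bool * option 'I_m * (idx * idx)) :=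
  match a with
  | inl (inl (inl _)) => [::]
  | inl (inl (inr c)) => [:: (false, None, (xW i c, xOne))]
  | inl (inr (j, c)) => [:: (false, None, (xC j i, xW i c)); (false, None, (xC i j, xW j c))]
  | inr (j, k) => [:: (false, Some k, (xC i j, xC j k)); (false, Some k, (xC j i, xC i k));
                      (true, Some i, (xC j k, xC i k))]
  end.

(** In a discrete net [f] lives on vertices, [w_i] on edges and [c_ij] on elementary squares. *)
Definition qell (a : idx) : 'I_m -> nat :=
  match a with
  | inl (inl _) => fun=> 0%N
  | inl (inr (i, _)) => inc i (fun=> 0%N)
  | inr (i, j) => inc j (inc i (fun=> 0%N))
  end.

Lemma qrhs_size a i : (size (qrhs a i) <= 3)%N.
Proof. by case: a => [[[[]|c]|[j c]]|[j k]]. Qed.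

Lemma qrhs_closed : rhs_closed qev qrhs.
Proof.
move=> [[[[]|c]|[j c]]|[j k]] i l t /=; rewrite ?inE //.
- by move=> _ _ li /eqP -> /=; rewrite li.
- move=> ij lj li /orP[] /eqP -> /=; rewrite ?lj ?li ?ij //.
  by rewrite eq_sym ij.
- move=> /and3P[jk ij ik] /and3P[_ lj lk] li /or3P[] /eqP -> /=;
  by rewrite ?lj ?li ?ij ?lk ?ik ?jk // eq_sym ij.
Qed.

(** For [f] the equation of [w_j] is symmetric in the two directions; for [w_j] the equations of the
    coefficients are what makes the two sides agree; for the coefficients the condition is again a
    polynomial identity. *)
Lemma qrhs_compatible (R : realType) : @rhs_compatible R m idx qev qrhs.
Proof.
move=> [[[[]|c]|[j c]]|[j k]] i l p; rewrite /bil /=;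
  rewrite ?big_cons ?big_nil /= ?big_cons ?big_nil /=; do ?[move=> *; ring].
Qed.

Lemma qrhs_levels : rhs_levels qev qrhs qell.
Proof.
move=> [[[[]|c]|[j c]]|[j k]] i t /=; rewrite ?inE //.
- by move=> _ /eqP -> /=; split=> p; rewrite /inc.
- by move=> ij /orP[] /eqP -> /=; split=> p; rewrite /inc; lia.
- by move=> _ /or3P[] /eqP -> /=; split=> p; rewrite /inc; lia.
Qed.

End ConjugateNetSystem.

(** * Existence of discrete nets by Lame and rotation coefficients *)

Section LatticeRecursion.
Context {R : Type} {m : nat} {S : Type}.
Local Notation pts := ('I_m -> nat).
Variables (E : S -> pred 'I_m) (Phi : S -> 'I_m -> (S -> R) -> R) (d : S -> pts -> R).
Implicit Types (a b : S) (i j : 'I_m) (n : pts).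

Definition weight n : nat := \sum_i n i.

Definition dec i n : pts := fun k => (n k - (k == i))%N.

(** The fuel [p] is the number of steps from the origin. [pick] fixes one admissible last step, and
    [sol_step] shows that every admissible step is consistent with this choice. *)
Fixpoint recur (p : nat) a n : R :=
  if p is p'.+1 then
    if [pick i | E a i && (0 < n i)%N] is Some i
    then Phi a i (fun b => recur p' b (dec i n)) else d a n
  else d a n.

Definition sol a n : R := recur (weight n) a n.

Lemma weight_inc i n : weight (inc i n) = (weight n).+1.
Proof.
rewrite /weight /inc big_split /= -addn1; congr (_ + _)%N.
by rewrite (bigD1 i) //= eqxx big1 // => k /negbTE ->.
Qed.

Lemma dec_inc i n : dec i (inc i n) = n.
Proof. by apply/funext => k; rewrite /dec /inc addnK. Qed.

Lemma inc_dec i n : (0 < n i)%N -> inc i (dec i n) = n.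
Proof.
move=> ni; apply/funext => k; rewrite /dec /inc subnK //.
by case: eqP => [->|].
Qed.

Lemma sol_cases a n :
  (forall i, E a i -> n i = 0%N) /\ sol a n = d a n \/
  exists i n', [/\ n = inc i n', E a i & sol a n = Phi a i (sol^~ n')].
Proof.
have [H|] := pselect (forall i, E a i -> n i = 0%N).
  left; split=> //; rewrite /sol; case: (weight n) => //= p.
  by case: pickP => // i /andP[/H ->].
move=> /existsNP[i0 /not_implyP[Ei0 ni0]]; right.
have := erefl (sol a n); rewrite {2}/sol.
case W : (weight n) => [|p] /=.
  by move: W; rewrite /weight (bigD1 i0) //= => /eqP; rewrite addn_eq0 => /andP[/eqP].
case: pickP => [i /andP[Ei ni]|/(_ i0)]; last first.
  by rewrite Ei0 lt0n; move/eqP: ni0 => ->.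
move=> ->; exists i, (dec i n); split=> //; first by rewrite inc_dec.
congr Phi; apply/funext => b; rewrite /sol; congr recur.
by move: W; rewrite -(inc_dec ni) weight_inc dec_inc => -[].
Qed.

Lemma sol_data a n : (forall i, E a i -> n i = 0%N) -> sol a n = d a n.
Proof.
move=> H; have [[]//|[i [n' [nE Ei _]]]] := sol_cases a n.
by have := H i Ei; rewrite nE /inc eqxx addn1.
Qed.

Variables (Om : set pts) (Inv : (S -> R) -> Prop).
Hypothesis Om_down : forall i n, Om (inc i n) -> Om n.
Hypothesis Inv_sol : forall n, Om n -> Inv (sol^~ n).
Hypothesis consistent : forall a i j z y y', i != j -> E a i -> E a j -> Inv z ->
  (forall b, E b j -> y b = Phi b j z) -> (forall b, E b i -> y' b = Phi b i z) ->
  Phi a i y = Phi a j y'.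

(** If [inc j n] was computed by a step along another direction [i], then both routes start from the
    opposite corner [z] of a square. By induction on the weight the steps out of [z] satisfy the
    recursion, and [consistent] compares the two routes. *)
Lemma sol_step a j n : E a j -> Om (inc j n) -> sol a (inc j n) = Phi a j (sol^~ n).
Proof.
move: {2}(weight n).+1 (ltnSn (weight n)) => p; elim: p a j n => [//|p IH] a j n.
rewrite ltnS => np Ej Oj.
have [[H _]|[i [n' [nE Ei ->]]]] := sol_cases a (inc j n).
  by have := H j Ej; rewrite /inc eqxx addn1.
have [ij|ij] := eqVneq i j.
  by rewrite ij in nE *; congr Phi; rewrite -(dec_inc j n) nE dec_inc.
have n'j : (0 < n' j)%N.
  have := congr1 (fun h : pts => h j) nE; rewrite /inc eqxx eq_sym (negbTE ij) addn0 addn1.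
  by move=> <-.
pose z := dec j n'.
have n'E : n' = inc j z by rewrite /z inc_dec.
have nz : n = inc i z by rewrite -(dec_inc j n) nE n'E incC dec_inc.
have Oz : Om (inc j z) by apply: (Om_down (i := i)); rewrite -n'E -nE.
have Oi : Om (inc i z) by apply: (Om_down (i := j)); rewrite -nz.
have wz : (weight z < p)%N by rewrite nz weight_inc in np.
rewrite n'E nz; apply: (@consistent a i j (sol^~ z)) => //.
- exact: Inv_sol (Om_down Oi).
- by move=> b Eb; exact: IH.
- by move=> b Eb; exact: IH.
Qed.

End LatticeRecursion.

(** * The discrete Darboux system *)

Section Darboux.
Context {R : realType} {m N : nat}.
Local Notation pts := ('I_m -> nat).
Implicit Types (i j k l : 'I_m) (c : 'I_N) (n : pts).

Definition dstate : Type := ('I_m * option 'I_m + 'I_m * 'I_N + 'I_N)%type.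

(* Rotation coefficients b_ij, [sB i (Some j)], and Lame coefficients h_i,
   [sB i None]: both obey the same discrete Darboux equations. *)
Definition sB i (o : option 'I_m) : dstate := inl (inl (i, o)).
Definition sV i c : dstate := inl (inr (i, c)).
Definition sF c : dstate := inr c.

Definition dev (a : dstate) : pred 'I_m := fun k =>
  match a with
  | inl (inl (i, Some j)) => [&& i != j, k != i & k != j]
  | inl (inl (i, None)) => k != i
  | inl (inr (i, _)) => k != i
  | inr _ => true
  end.

Variable eps : R.

(* The value at [inc k n] in terms of the values [z] at [n]: the Darboux equations,
   which are implicit in the shifted unknowns, solved for them. *)
Definition dphi (a : dstate) k (z : dstate -> R) : R :=
  match a with
  | inl (inl (i, o)) => (z (sB i o) + z (sB i (Some k)) * z (sB k o)) /
      (1 - z (sB i (Some k)) * z (sB k (Some i)))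
  | inl (inr (j, c)) => z (sV j c) + z (sB k (Some j)) * z (sV k c)
  | inr c => z (sF c) + eps * z (sB k None) * z (sV k c)
  end.

Definition small_rotation (z : dstate -> R) := forall i j, `|z (sB i (Some j))| <= 4^-1.

Lemma small_mul (x y : R) : `|x| <= 4^-1 -> `|y| <= 4^-1 -> `|x * y| <= 16^-1.
Proof.
move=> hx hy; rewrite normrM; have : `|x| * `|y| <= 4^-1 * 4^-1 by exact: ler_pM.
by move/le_trans; apply; lra.
Qed.

Lemma one_minus_neq0 (x y : R) : `|x| <= 4^-1 -> `|y| <= 4^-1 -> 1 - x * y != 0.
Proof.
move=> hx hy; have := small_mul hx hy; have := ler_norm (x * y) => h1 h2.
by apply: lt0r_neq0; lra.
Qed.

(** The multidimensional consistency of the recursion: both orders of steps give the same rational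
    function of [z]. For the rotation and Lame coefficients three directions [p], [i], [j]
    interact. *)
Lemma dphi_consistent (a : dstate) i j (z y y' : dstate -> R) : i != j -> dev a i -> dev a j ->
  small_rotation z -> (forall b, dev b j -> y b = dphi b j z) ->
  (forall b, dev b i -> y' b = dphi b i z) -> dphi a i y = dphi a j y'.
Proof.
move=> ij ai aj Iz Hy Hy'; have ji : j != i by rewrite eq_sym.
have z1 p q := Iz p q.
case: a ai aj => [[[p o]|[p c]]|c] /= ai aj.
- have [pi pj oi oj] : [/\ p != i, p != j, dev (sB i o) j & dev (sB j o) i].
    case: o ai aj => [q|] /= => [/and3P[pq ip iq] /and3P[_ jp jq]|ip jp].
      by split; rewrite /= ?iq ?jq ?ji ?ij // eq_sym.
    by split; rewrite // eq_sym.
  have ip : i != p by rewrite eq_sym.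
  have jp : j != p by rewrite eq_sym.
  have d1 : dev (sB p (Some i)) j by rewrite /= pi jp ji.
  have d2 : dev (sB i (Some p)) j by rewrite /= ip ji jp.
  have d3 : dev (sB p (Some j)) i by rewrite /= pj ip ij.
  have d4 : dev (sB j (Some p)) i by rewrite /= jp ij ip.
  rewrite (Hy _ (aj : dev (sB p o) j)) (Hy _ oi) (Hy _ d1) (Hy _ d2).
  rewrite (Hy' _ (ai : dev (sB p o) i)) (Hy' _ oj) (Hy' _ d3) (Hy' _ d4) /=.
  have := z1 p i; have := z1 i p; have := z1 p j; have := z1 j p; have := z1 i j; have := z1 j i.
  set xpi := z (sB p (Some i)); set xip := z (sB i (Some p)).
  set xpj := z (sB p (Some j)); set xjp := z (sB j (Some p)).
  set xij := z (sB i (Some j)); set xji := z (sB j (Some i)).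
  move: (z (sB p o)) (z (sB i o)) (z (sB j o)) => xpo xio xjo.
  move=> hji hij hjp hpj hip hpi.
  have n1 := one_minus_neq0 hpj hjp; have n2 := one_minus_neq0 hij hji.
  have n3 := one_minus_neq0 hpi hip; have n4 := one_minus_neq0 hji hij.
  (* The determinant of the 3 by 3 matrix with unit diagonal and the negated rotation coefficients
     of [p], [i], [j] elsewhere: the denominator produced by two successive steps in either order.
     Coefficients of size at most 1/4 keep it positive. *)
  have D0 : 1 - xpj * xjp - xij * xji - xpi * xip - xpi * (xij * xjp) - xpj * (xji * xip) != 0.
    have m1 := small_mul hpj hjp; have m2 := small_mul hij hji; have m3 := small_mul hpi hip.
    have q16 : 16^-1 <= 4^-1 :> R by lra.
    have m4 := small_mul hpi (le_trans (small_mul hij hjp) q16).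
    have m5 := small_mul hpj (le_trans (small_mul hji hip) q16).
    have := ler_norm (xpj * xjp); have := ler_norm (xij * xji); have := ler_norm (xpi * xip).
    have := ler_norm (xpi * (xij * xjp)); have := ler_norm (xpj * (xji * xip)).
    by move=> *; apply: lt0r_neq0; lra.
  field; apply/and4P; split=> //.
  by move: D0; congr (_ != _); ring.
- have ip : i != p by []. have jp : j != p by [].
  have pi : p != i by rewrite eq_sym. have pj : p != j by rewrite eq_sym.
  have d1 : dev (sB i (Some p)) j by rewrite /= ip ji jp.
  have d2 : dev (sB j (Some p)) i by rewrite /= jp ij ip.
  rewrite (Hy _ (aj : dev (sV p c) j)) (Hy _ d1) (Hy _ (ji : dev (sV i c) j)).
  rewrite (Hy' _ (ai : dev (sV p c) i)) (Hy' _ d2) (Hy' _ (ij : dev (sV j c) i)) /=.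
  have n1 := one_minus_neq0 (z1 i j) (z1 j i); have n2 := one_minus_neq0 (z1 j i) (z1 i j).
  by field; rewrite ?n1 ?n2.
- rewrite (Hy _ (isT : dev (sF c) j)) (Hy _ (ji : dev (sB i None) j)) (Hy _ (ji : dev (sV i c) j)).
  rewrite (Hy' _ (isT : dev (sF c) i)) (Hy' _ (ij : dev (sB j None) i)) (Hy' _ (ij : dev (sV j c) i)) /=.
  have n1 := one_minus_neq0 (z1 i j) (z1 j i); have n2 := one_minus_neq0 (z1 j i) (z1 i j).
  by field; rewrite ?n1 ?n2.
Qed.

Variables (K : nat) (r beta V F0 : R) (d : dstate -> pts -> R).
Hypotheses (eps_gt0 : 0 < eps) (epsK : eps * K%:R <= r) (beta_gt0 : 0 < beta)
  (V_ge0 : 0 <= V) (F0_ge0 : 0 <= F0).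
Hypotheses (small_eps : 8 * beta * eps <= 1) (small_r : 32 * beta * (m%:R * r) <= 1).
Hypothesis d_rot : forall i j n, box K (fun=> 0%N) n -> (forall k, dev (sB i (Some j)) k -> n k = 0%N) ->
  `|d (sB i (Some j)) n| <= eps * beta.
Hypothesis d_lame : forall i n, d (sB i None) n = 1.
Hypothesis d_tan : forall i c n, box K (fun=> 0%N) n -> (forall k, dev (sV i c) k -> n k = 0%N) ->
  `|d (sV i c) n| <= V.
Hypothesis d_pos : forall c n, `|d (sF c) n| <= F0.

Local Notation x := (sol dev dphi d).
Local Notation Om := (box K (fun=> 0%N)).

Lemma box_inc i n : Om (inc i n) -> Om n.
Proof. by move=> H k; apply: leq_trans (H k); rewrite /inc !addn0 leq_addr. Qed.

Lemma weight_le n : Om n -> eps * (weight n)%:R <= m%:R * r.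
Proof.
move=> On; apply: (@le_trans _ _ (eps * (m * K)%:R)).
  rewrite ler_wpM2l ?(ltW eps_gt0) // ler_nat /weight.
  apply: leq_trans (_ : \sum_(i < m) K <= _)%N; last by rewrite sum_nat_const card_ord.
  by apply: leq_sum => i _; have := On i; rewrite addn0.
by rewrite natrM mulrCA ler_wpM2l.
Qed.

(** A step changes a rotation coefficient of size [eps * beta] by a multiple of [(eps * beta) ^+ 2],
    so the growth is linear in the path length [eps * w]. As this length is at most [m%:R * r], the
    bound stays below [2 * (eps * beta)]. *)
Definition rot_bound (w : nat) : R := eps * beta * (1 + 8 * beta * (eps * w%:R)).

Lemma rot_step_bound (X P Q y e : R) : `|X| <= y -> `|P| <= 4 * e ^+ 2 -> `|Q| <= 4 * e ^+ 2 ->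
  0 <= e -> 8 * e <= 1 -> y <= 2 * e -> `|(X + P) / (1 - Q)| <= y + 8 * e ^+ 2.
Proof.
move=> hX hP hQ e0 e8 ye.
have a16 : 4 * e ^+ 2 <= 16^-1.
  by rewrite expr2; have : e * e <= 8^-1 * 8^-1; [apply: ler_pM => //; lra | lra].
have a0 : 0 <= 4 * e ^+ 2 by rewrite mulr_ge0 // exprn_ge0.
set a := 4 * e ^+ 2 in hP hQ a16 a0 *.
have -> : 8 * e ^+ 2 = 2 * a by rewrite /a; ring.
have y0 : 0 <= y by apply: le_trans hX.
have hQ' := le_trans (ler_norm Q) hQ.
have d0 : 0 < 1 - Q by lra.
rewrite normrM normfV (gtr0_norm d0) ler_pdivrMr //.
apply: le_trans (ler_normD _ _) _.
have : (y + 2 * a) * (1 - a) <= (y + 2 * a) * (1 - Q).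
  by rewrite ler_wpM2l //; lra.
have : a * (y + 2 * a) <= a * 1 by rewrite ler_wpM2l //; lra.
lra.
Qed.

Lemma lame_step_bound (h g b Q e : R) : 2^-1 <= h <= 2 -> 2^-1 <= g <= 2 ->
  `|b| <= 2 * e -> `|Q| <= 4 * e ^+ 2 -> 0 <= e -> 8 * e <= 1 ->
  `|(h + b * g) / (1 - Q) - h| <= 16 * e.
Proof.
move=> /andP[h1 h2] /andP[g1 g2] hb hQ e0 e8.
have a16 : 4 * e ^+ 2 <= 2^-1 * e.
  by rewrite expr2; have : e * (8 * e) <= e * 1; [rewrite ler_wpM2l | lra].
have hQ' := le_trans (ler_norm Q) (le_trans hQ a16).
have d0 : 2^-1 <= 1 - Q by lra.
have d1 : 0 < 1 - Q by lra.
have -> : (h + b * g) / (1 - Q) - h = (b * g + h * Q) / (1 - Q).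
  by field; rewrite gt_eqF.
rewrite normrM normfV (gtr0_norm d1) ler_pdivrMr //.
apply: le_trans (ler_normD _ _) _; rewrite !normrM.
have p1 : `|b| * `|g| <= 2 * e * 2 by apply: ler_pM => //; rewrite ger0_norm //; lra.
have p2 : `|h| * `|Q| <= 2 * (2^-1 * e).
  by apply: ler_pM => //; [rewrite ger0_norm //; lra | exact: le_trans a16].
have : 16 * e * 2^-1 <= 16 * e * (1 - Q) by rewrite ler_wpM2l // mulr_ge0.
lra.
Qed.

(** Induction on the weight. Smallness of [r] keeps each quantity within a fixed factor of its
    initial size; this makes the increment of a step a multiple of [eps] (of [eps ^+ 2] for the
    rotation coefficients) and closes the induction. *)
Lemma sol_bounds n : Om n ->
  [/\ forall i j, `|x (sB i (Some j)) n| <= rot_bound (weight n),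
      forall i, `|x (sB i None) n - 1| <= 16 * beta * (eps * (weight n)%:R),
      forall i c, `|x (sV i c) n| <= V * (1 + 16 * beta * (eps * (weight n)%:R)) &
      forall c, `|x (sF c) n| <= F0 + 4 * V * (eps * (weight n)%:R)].
Proof.
move: {2}(weight n).+1 (ltnSn (weight n)) => p; elim: p n => [//|p IH] n np On.
have e0 : 0 <= eps * (weight n)%:R by rewrite mulr_ge0 // ltW.
have b0 := ltW beta_gt0.
have pre n' k : n = inc k n' ->
  [/\ forall i j, `|x (sB i (Some j)) n'| <= rot_bound (weight n'),
      forall i, `|x (sB i None) n' - 1| <= 16 * beta * (eps * (weight n')%:R),
      forall i c, `|x (sV i c) n'| <= V * (1 + 16 * beta * (eps * (weight n')%:R)) &
      forall c, `|x (sF c) n'| <= F0 + 4 * V * (eps * (weight n')%:R)] /\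
  [/\ eps * (weight n)%:R = eps * (weight n')%:R + eps, 0 <= eps * (weight n')%:R,
   rot_bound (weight n') <= 2 * (eps * beta),
   forall i, 2^-1 <= x (sB i None) n' <= 2 & forall i c, `|x (sV i c) n'| <= 2 * V].
  move=> nE; have On' : Om n' by apply: (@box_inc k); rewrite -nE.
  have [||H1 H2 H3 H4] := IH n'; [by move: np; rewrite nE weight_inc|by []|].
  have w0 : 0 <= eps * (weight n')%:R by rewrite mulr_ge0 // ltW.
  have wr := weight_le On'.
  have bw : 32 * beta * (eps * (weight n')%:R) <= 1.
    by apply: le_trans small_r; rewrite ler_wpM2l // mulr_ge0.
  have eb0 : 0 <= eps * beta by rewrite mulr_ge0 // ltW.
  split=> //; split=> //.
  - by rewrite nE weight_inc -natr1 mulrDr mulr1.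
  - rewrite /rot_bound mulrC ler_wpM2r //; lra.
  - by move=> i; have := H2 i; rewrite ler_norml => /andP[]; lra.
  - move=> i c; apply: le_trans (H3 i c) _; rewrite mulrC ler_wpM2r //; lra.
have eb : 8 * (eps * beta) <= 1 by rewrite [eps * beta]mulrC mulrA.
have eb0 : 0 <= eps * beta by rewrite mulr_ge0 // ltW.
have rot n' i j k l (H : forall i j, `|x (sB i (Some j)) n'| <= rot_bound (weight n')) :
  rot_bound (weight n') <= 2 * (eps * beta) ->
  `|x (sB i (Some j)) n' * x (sB k (Some l)) n'| <= 4 * (eps * beta) ^+ 2.
  move=> rb; rewrite normrM.
  apply: le_trans (ler_pM (normr_ge0 _) (normr_ge0 _) (le_trans (H _ _) rb) (le_trans (H _ _) rb)) _.
  by rewrite le_eqVlt; apply/orP; left; apply/eqP; ring.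
split.
- move=> i j; have [[Z ->]|[k [n' [nE Ek ->]]]] := sol_cases dev dphi d (sB i (Some j)) n.
    apply: le_trans (d_rot On Z) _; rewrite /rot_bound ler_peMr // lerDl.
    by rewrite mulr_ge0 // mulr_ge0.
  have [[H1 H2 H3 H4] [wE w0 rb hb vb]] := pre n' k nE; rewrite /=.
  have a1 := H1 i j; have a2 := rot n' i k k j H1 rb; have a3 := rot n' i k k i H1 rb.
  apply: le_trans (rot_step_bound a1 a2 a3 eb0 eb rb) _.
  by rewrite /rot_bound wE le_eqVlt; apply/orP; left; apply/eqP; ring.
- move=> i; have [[Z ->]|[k [n' [nE Ek ->]]]] := sol_cases dev dphi d (sB i None) n.
    by rewrite d_lame subrr normr0 mulr_ge0 // mulr_ge0.
  have [[H1 H2 H3 H4] [wE w0 rb hb vb]] := pre n' k nE; rewrite /=.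
  have a1 : `|x (sB i (Some k)) n'| <= 2 * (eps * beta) by exact: le_trans (H1 _ _) rb.
  have a2 := rot n' i k k i H1 rb.
  have E := lame_step_bound (hb i) (hb k) a1 a2 eb0 eb.
  have := H2 i; rewrite wE; set h' := _ / _ in E *; set h := x (sB i None) n' in E *.
  have := ler_normD (h' - h) (h - 1); rewrite addrA subrK.
  have : 16 * beta * (eps * (weight n')%:R + eps) =
    16 * beta * (eps * (weight n')%:R) + 16 * (eps * beta) by ring.
  by move=> ->; lra.
- move=> i c; have [[Z ->]|[k [n' [nE Ek ->]]]] := sol_cases dev dphi d (sV i c) n.
    apply: le_trans (d_tan On Z) _; rewrite ler_peMr // lerDl.
    by rewrite mulr_ge0 // mulr_ge0.
  have [[H1 H2 H3 H4] [wE w0 rb hb vb]] := pre n' k nE; rewrite /=.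
  apply: le_trans (ler_normD _ _) _; rewrite normrM wE.
  have : `|x (sB k (Some i)) n'| * `|x (sV k c) n'| <= 2 * (eps * beta) * (2 * V).
    by apply: ler_pM => //; apply: le_trans rb.
  have := H3 i c; have := mulr_ge0 eb0 V_ge0; lra.
- move=> c; have [[Z ->]|[k [n' [nE Ek ->]]]] := sol_cases dev dphi d (sF c) n.
    by apply: le_trans (d_pos c n) _; rewrite lerDl; apply: mulr_ge0 => //; rewrite mulr_ge0.
  have [[H1 H2 H3 H4] [wE w0 rb hb vb]] := pre n' k nE; rewrite /=.
  apply: le_trans (ler_normD _ _) _; rewrite 2!normrM wE (gtr0_norm eps_gt0) -mulrA.
  have : eps * (`|x (sB k None) n'| * `|x (sV k c) n'|) <= eps * (2 * (2 * V)).
    rewrite ler_wpM2l ?(ltW eps_gt0) //; apply: ler_pM => //.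
    by have /andP[h1 h2] := hb k; rewrite ger0_norm //; lra.
  have := H4 c; lra.
Qed.

End Darboux.

Section LatticeNetExistence.
Context {R : realType} {m N : nat}.
Local Notation pts := ('I_m -> nat).
Implicit Types (i j k l : 'I_m) (c : 'I_N) (n : pts).
Local Notation idx := (@idx m N).

Variables (eps r C0 V F0 : R) (K : nat).
Variables (cd : 'I_m -> 'I_m -> pts -> R) (vd : 'I_m -> 'I_N -> pts -> R) (fd : 'I_N -> R).
Local Notation Om := (@box m K (fun=> 0%N)).
(** In the rotation data [lame i j] is at most 2 and the denominator at least 1/4, which gives
    [8 * C0 * eps]; the 1 keeps [beta] positive. *)
Let beta := 8 * C0 + 1.
Hypotheses (eps_gt0 : 0 < eps) (epsK : eps * K%:R <= r) (C0_ge0 : 0 <= C0)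
  (V_ge0 : 0 <= V) (F0_ge0 : 0 <= F0).
Hypotheses (small_eps : 8 * beta * eps <= 1) (small_r : 32 * beta * (m%:R * r) <= 1)
  (small_r' : 4 * C0 * r <= 1).
Hypothesis cd_bound : forall i j n, i != j -> Om n -> `|cd i j n| <= C0.
Hypothesis vd_bound : forall i c n, Om n -> `|vd i c n| <= V.
Hypothesis fd_bound : forall c, `|fd c| <= F0.

Definition upd n j (p : nat) : pts := fun k => if k == j then p else n k.

(* On the coordinate plane of i and j, the Lame coefficient h_i is the product
   along the j-direction, starting from h_i = 1 on the i-axis. *)
Definition lame i j n : R := \prod_(0 <= p < n j) (1 + eps * cd j i (upd n j p)).

(** The rotation coefficient is dictated by tau_j h_i = h_i + b_ij tau_i h_j together with tau_j h_i
    = (1 + eps c_ji) h_i and tau_i h_j = (1 + eps c_ij) h_j. *)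
Definition darboux_data (a : @dstate m N) n : R :=
  match a with
  | inl (inl (i, Some j)) => if i == j then 0 else
      eps * cd j i n * lame i j n / ((1 + eps * cd i j n) * lame j i n)
  | inl (inl (i, None)) => 1
  | inl (inr (i, c)) => vd i c n
  | inr c => fd c
  end.

Lemma box_incE i (l n : pts) : box K (inc i l) n = box K l (inc i n).
Proof.
by apply/propext; split=> H k; have := H k; rewrite /inc addnA addnAC.
Qed.

Lemma upd_Om n j p : Om n -> (p <= n j)%N -> Om (upd n j p).
Proof.
move=> On pn k; rewrite /upd addn0; case: (k == j).
  by apply: leq_trans pn _; have := On j; rewrite addn0.
by have := On k; rewrite addn0.
Qed.

Lemma eps_cd i j n : i != j -> Om n -> `|eps * cd i j n| <= eps * C0.
Proof.
by move=> ij On; rewrite normrM (gtr0_norm eps_gt0) ler_wpM2l ?(ltW eps_gt0) ?cd_bound.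
Qed.

Lemma eps_C0 : eps * C0 <= 64^-1.
Proof.
have : 8 * (8 * C0) * eps <= 8 * beta * eps.
  by rewrite ler_wpM2r ?(ltW eps_gt0) // /beta; lra.
have -> : 8 * (8 * C0) * eps = 64 * (eps * C0) by ring.
move=> h; have := le_trans h small_eps; lra.
Qed.

Lemma lame_bound i j n : i != j -> Om n -> 2^-1 <= lame i j n <= 2.
Proof.
move=> ij On; have ji : j != i by rewrite eq_sym.
have H p : (p <= n j)%N ->
    `|\prod_(0 <= q < p) (1 + eps * cd j i (upd n j q)) - 1| <= 2 * (eps * C0) * p%:R.
  elim: p => [_|p IH pn]; first by rewrite big_nil subrr normr0 mulr0.
  have {}IH := IH (ltnW pn); rewrite big_nat_recr //=.
  have := eps_cd ji (upd_Om On (ltnW pn)).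
  set P := \prod_(_ <= _ < _) _ in IH *; set t := eps * cd _ _ _ => ht.
  have p1 : 2 * (eps * C0) * p%:R <= 2^-1.
    have : 4 * C0 * (eps * p%:R) <= 4 * C0 * r.
      rewrite ler_wpM2l ?mulr_ge0 //; apply: le_trans epsK.
      rewrite ler_wpM2l ?(ltW eps_gt0) // ler_nat ltnW //.
      by apply: leq_trans pn _; have := On j; rewrite addn0.
    have -> : 4 * C0 * (eps * p%:R) = 2 * (2 * (eps * C0) * p%:R) by ring.
    by move=> h; have := le_trans h small_r'; lra.
  have P2 : `|P| <= 2.
    by have := ler_normD (P - 1) 1; rewrite subrK normr1; lra.
  have -> : P * (1 + t) - 1 = (P - 1) + P * t by ring.
  apply: le_trans (ler_normD _ _) _; rewrite normrM -[p.+1%:R]natr1.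
  have : `|P| * `|t| <= 2 * (eps * C0) by exact: ler_pM.
  lra.
have := H (n j) (leqnn _).
have : 2 * (eps * C0) * (n j)%:R <= 2^-1.
  have : 4 * C0 * (eps * (n j)%:R) <= 4 * C0 * r.
    rewrite ler_wpM2l ?mulr_ge0 //; apply: le_trans epsK.
    by rewrite ler_wpM2l ?(ltW eps_gt0) // ler_nat; have := On j; rewrite addn0.
  have -> : 4 * C0 * (eps * (n j)%:R) = 2 * (2 * (eps * C0) * (n j)%:R) by ring.
  by move=> h; have := le_trans h small_r'; lra.
rewrite -/(lame i j n) ler_norml => h1 /andP[h2 h3]; apply/andP; split; lra.
Qed.

Lemma one_cd i j n : i != j -> Om n -> 2^-1 <= 1 + eps * cd i j n.
Proof.
move=> ij On; have := eps_cd ij On; have := eps_C0.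
rewrite ler_norml => h1 /andP[h2 h3]; lra.
Qed.

Lemma rot_data_bound i j n : Om n -> `|darboux_data (sB i (Some j)) n| <= eps * beta.
Proof.
have b0 : 0 <= beta by rewrite /beta addr_ge0 // mulr_ge0.
move=> On; rewrite /=; case: eqP => [_|/eqP ij].
  by rewrite normr0 mulr_ge0 // ltW.
have ji : j != i by rewrite eq_sym.
have /andP[a1 a2] := lame_bound ij On; have /andP[a3 a4] := lame_bound ji On.
have a5 := one_cd ij On; have a6 := eps_cd ji On.
have d0 : 4^-1 <= (1 + eps * cd i j n) * lame j i n.
  have : 2^-1 * 2^-1 <= (1 + eps * cd i j n) * lame j i n by apply: ler_pM.
  lra.
have d1 : 0 < (1 + eps * cd i j n) * lame j i n by lra.
rewrite normrM normfV (gtr0_norm d1) ler_pdivrMr // normrM.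
have h0 : 0 <= lame i j n by lra.
rewrite (ger0_norm h0).
have e1 : `|eps * cd j i n| * lame i j n <= eps * C0 * 2 by apply: ler_pM.
have e2 : eps * beta * 4^-1 <= eps * beta * ((1 + eps * cd i j n) * lame j i n).
  by rewrite ler_wpM2l // mulr_ge0 // ltW.
apply: le_trans e1 (le_trans _ e2).
have -> : eps * beta * 4^-1 = eps * C0 * 2 + eps / 4 by rewrite /beta; field.
by rewrite lerDl divr_ge0 // ltW.
Qed.

Local Notation x := (sol (@dev m N) (dphi eps) darboux_data).

Let beta_gt0 : 0 < beta.
Proof. by rewrite /beta ltr_wpDl // mulr_ge0. Qed.

Let bounds n (On : Om n) := @sol_bounds R m N eps K r beta V F0 darboux_data eps_gt0 epsK
  beta_gt0 V_ge0 small_eps small_r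
  (fun i j n On _ => @rot_data_bound i j n On) (fun i n => erefl)
  (fun i c n On _ => @vd_bound i c n On) (fun c n => fd_bound c) n On.

Lemma state_bounds n : Om n ->
  [/\ forall i j, `|x (sB i (Some j)) n| <= 2 * (eps * beta),
      forall i, 2^-1 <= x (sB i None) n <= 2,
      forall i c, `|x (sV i c) n| <= 2 * V &
      forall c, `|x (sF c) n| <= F0 + V].
Proof.
move=> On; have [H1 H2 H3 H4] := bounds On.
have w0 : 0 <= eps * (weight n)%:R by rewrite mulr_ge0 // ltW.
have wr := weight_le eps_gt0 epsK On.
have bw : 32 * beta * (eps * (weight n)%:R) <= 1.
  by apply: le_trans small_r; rewrite ler_wpM2l // mulr_ge0 // ltW.
have b1 : 1 <= beta by rewrite /beta lerDr mulr_ge0.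
have w32 : 32 * (eps * (weight n)%:R) <= 1.
  by apply: le_trans bw; rewrite ler_wpM2r // -{1}[32]mulr1 ler_wpM2l.
have eb0 : 0 <= eps * beta by rewrite mulr_ge0 // ltW.
split.
- move=> i j; apply: le_trans (H1 i j) _; rewrite /rot_bound mulrC ler_wpM2r //; lra.
- by move=> i; have := H2 i; rewrite ler_norml => /andP[]; lra.
- move=> i c; apply: le_trans (H3 i c) _; rewrite mulrC ler_wpM2r //; lra.
- move=> c; apply: le_trans (H4 c) _; rewrite lerD2l.
  have : V * (4 * (eps * (weight n)%:R)) <= V * 1 by rewrite ler_wpM2l //; lra.
  lra.
Qed.

Lemma state_step a j n : dev a j -> Om (inc j n) -> x a (inc j n) = dphi eps a j (x^~ n).
Proof.
have H := @sol_step R m (@dstate m N) (@dev m N) (dphi eps) darboux_data Om (@small_rotation R m N).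
apply: H.
- by move=> i n'; exact: box_inc.
- move=> n' On'; have [H1 _ _ _] := state_bounds On'; move=> i k.
  apply: le_trans (H1 i k) _.
  have -> : 2 * (eps * beta) = 4^-1 * (8 * beta * eps) by field.
  by have := small_eps; lra.
- exact: dphi_consistent.
Qed.

Local Notation b_ i j n := (x (sB i (Some j)) n).
Local Notation h_ i n := (x (sB i None) n).

Lemma h_neq0 i n : Om n -> h_ i n != 0.
Proof. by move=> On; have [_ H _ _] := state_bounds On; have /andP[] := H i; lra. Qed.

Lemma den_neq0 i j n : Om n -> 1 - b_ i j n * b_ j i n != 0.
Proof.
move=> On; have [H1 _ _ _] := state_bounds On.
have e4 : 2 * (eps * beta) <= 4^-1.
  have -> : 2 * (eps * beta) = 4^-1 * (8 * beta * eps) by field.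
  by have := small_eps; lra.
by apply: one_minus_neq0; apply: le_trans e4; exact: H1.
Qed.

(** The implicit form of the discrete Darboux equation, of which [dphi] is the explicit solution. It
    is this form that translates directly into the equations of a Q-net. *)
Lemma lame_rel i j n : i != j -> Om (inc i n) -> Om (inc j n) ->
  h_ i (inc j n) = h_ i n + b_ i j n * h_ j (inc i n).
Proof.
move=> ij Oi Oj; have ji : j != i by rewrite eq_sym.
rewrite (state_step (a := sB i None) ji Oj) (state_step (a := sB j None) ij Oi) /=.
have d1 := den_neq0 i j (box_inc Oi); have d2 := den_neq0 j i (box_inc Oi).
by field; rewrite ?d1 ?d2.
Qed.

Lemma lame_upd i j n : lame i j (inc j n) = lame i j n * (1 + eps * cd j i n).
Proof.
rewrite /lame {1}/inc eqxx addn1 big_nat_recr //=; congr (_ * _).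
  apply: eq_big_nat => p _; congr (1 + eps * cd j i _); apply/funext => k.
  by rewrite /upd /inc; case: eqP => //; rewrite addn0.
congr (1 + eps * cd j i _); apply/funext => k.
by rewrite /upd /inc; case: eqP => [->|] //; rewrite addn0.
Qed.

(** The recursion for [h_ i] along [j] also involves [h_ j], so both are identified simultaneously,
    by induction on the weight with the roles of [i] and [j] exchangeable. *)
Lemma h_plane i j n : i != j -> Om n -> (forall k, k != i -> k != j -> n k = 0%N) ->
  h_ i n = lame i j n.
Proof.
move: {2}(weight n).+1 (ltnSn (weight n)) => p.
elim: p i j n => [//|p IH] i j n; rewrite ltnS => np ij On Z.
have ji : j != i by rewrite eq_sym.
case nj : (n j) => [|q].
  rewrite /lame nj big_nil; rewrite sol_data // => k ki.
  by have [->|kj] := eqVneq k j => //; exact: Z.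
have n0 : (0 < n j)%N by rewrite nj.
have nE : n = inc j (dec j n) by rewrite inc_dec.
set n' := dec j n in nE.
have On' : Om n' by apply: (@box_inc _ _ j); rewrite -nE.
have Z' k : k != i -> k != j -> n' k = 0%N.
  by move=> ki kj; rewrite /n' /dec Z.
have wn : (weight n' < p)%N by rewrite nE weight_inc in np.
have hi := IH i j n' wn ij On' Z'.
have hj := IH j i n' wn ji On' (fun k kj ki => Z' k ki kj).
have bij : b_ i j n' = eps * cd j i n' * lame i j n' / ((1 + eps * cd i j n') * lame j i n').
  rewrite sol_data /=; first by rewrite (negbTE ij).
  by move=> k /and3P[_ ki kj]; exact: Z'.
have bji : b_ j i n' = eps * cd i j n' * lame j i n' / ((1 + eps * cd j i n') * lame i j n').
  rewrite sol_data /=; first by rewrite (negbTE ji).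
  by move=> k /and3P[_ ki kj]; exact: Z'.
have d1 := den_neq0 i j On'; rewrite bij bji in d1.
have Oj : Om (inc j n') by rewrite -nE.
rewrite nE (state_step (a := sB i None) ji Oj) /= lame_upd hi hj bij bji.
have /andP[a1 a2] := lame_bound ij On'; have /andP[a3 a4] := lame_bound ji On'.
have a5 := one_cd ij On'; have a6 := one_cd ji On'.
set X := lame i j n' in a1 a2 d1 *; set Y := lame j i n' in a3 a4 d1 *.
set u := cd i j n' in a5 d1 *; set v := cd j i n' in a6 d1 *.
(* With these data 1 - b_ij b_ji equals (1 + eps (u + v)) / ((1 + eps u) (1 + eps v)), so
   [1 + eps * (u + v)] must be nonzero as well. *)
have e5 : eps * (u + v) >= - 32^-1.
  have := eps_cd ij On'; have := eps_cd ji On'; have := eps_C0.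
  rewrite -/u -/v !ler_norml mulrDr => f1 /andP[f2 f3] /andP[f4 f5]; lra.
by field; repeat (apply/andP; split); apply: lt0r_neq0; lra.
Qed.

Definition net_data (a : idx) n : R :=
  match a with
  | inl (inl (inl _)) => 1
  | inl (inl (inr c)) => fd c
  | inl (inr (i, c)) => vd i c n
  | inr (i, j) => if i == j then 0 else cd i j n
  end.

(** The change of variables undone: w_i = h_i v_i, and c_ij is read off from tau_i h_j = (1 + eps
    c_ij) h_j. *)
Definition net_sol (a : idx) n : R :=
  match a with
  | inl (inl (inl _)) => 1
  | inl (inl (inr c)) => x (sF c) n
  | inl (inr (i, c)) => h_ i n * x (sV i c) n
  | inr (i, j) => if i == j then 0 else (h_ j (inc i n) / h_ j n - 1) / eps
  end.

Lemma net_sol_data (a : idx) n : box K (qell a) n -> (forall k, qev a k -> n k = 0%N) ->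
  net_sol a n = net_data a n.
Proof.
case: a => [[[[]|c]|[i c]]|[i j]] //= Bn Z.
- by rewrite sol_data.
- by rewrite !sol_data // mul1r.
- case: eqP => [//|/eqP ij]; have ji : j != i by rewrite eq_sym.
  have Oi : Om (inc i n).
    by rewrite /= !box_incE in Bn; rewrite incC in Bn; exact: box_inc Bn.
  have On := box_inc Oi.
  have Zn k : k != j -> k != i -> n k = 0%N by move=> kj ki; apply: Z; rewrite ij ki kj.
  rewrite (h_plane ji On) // (h_plane ji Oi); last first.
    by move=> k kj ki; rewrite /inc (negbTE ki) addn0 Zn.
  rewrite lame_upd; have /andP[a1 a2] := lame_bound ji On.
  field; apply/andP; split; apply: lt0r_neq0 => //; lra.
Qed.

(** The division by [eps] in [c_ij] is harmless: by [lame_rel] it equals b_ji tau_j h_i / (eps h_j),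
    and b_ji is of order [eps]. The bound is therefore uniform in the mesh size. *)
Lemma net_sol_bound (a : idx) n : box K (qell a) n -> `|net_sol a n| <= 1 + F0 + 4 * V + 10 * beta.
Proof.
have b0 := ltW beta_gt0.
case: a => [[[[]|c]|[i c]]|[i j]] /= Bn.
- by rewrite normr1 -!addrA lerDl !addr_ge0 ?mulr_ge0.
- have [_ _ _ H] := state_bounds Bn; have := H c; have := V_ge0; lra.
- have On : Om n by rewrite box_incE in Bn; exact: box_inc Bn.
  have [_ H2 H3 _] := state_bounds On; rewrite normrM.
  have /andP[h1 h2] := H2 i; have h0 : 0 <= h_ i n by lra.
  have : `|h_ i n| * `|x (sV i c) n| <= 2 * (2 * V).
    by apply: ler_pM => //; rewrite ger0_norm.
  by have := F0_ge0; have := V_ge0; lra.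
- case: eqP => [_|/eqP ij]; first by rewrite normr0 !addr_ge0 ?mulr_ge0.
  have ji : j != i by rewrite eq_sym.
  rewrite !box_incE in Bn.
  have Oi : Om (inc i n) by rewrite incC in Bn; exact: box_inc Bn.
  have Oj : Om (inc j n) by exact: box_inc Bn.
  have On := box_inc Oi.
  rewrite (lame_rel ji Oj Oi).
  have [H1 H2 _ _] := state_bounds On; have [_ H2' _ _] := state_bounds Oj.
  have /andP[h1 h2] := H2 j; have /andP[h3 h4] := H2' i.
  have -> : ((h_ j n + b_ j i n * h_ i (inc j n)) / h_ j n - 1) / eps =
     (b_ j i n * h_ i (inc j n)) / (h_ j n * eps).
    by field; apply/andP; split; apply: lt0r_neq0 => //; lra.
  have d0 : 0 < h_ j n * eps by rewrite mulr_gt0 //; lra.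
  rewrite normrM normfV (gtr0_norm d0) ler_pdivrMr // normrM.
  have p1 : `|b_ j i n| * `|h_ i (inc j n)| <= 2 * (eps * beta) * 2.
    by apply: ler_pM => //; rewrite ger0_norm //; lra.
  apply: le_trans p1 _.
  have p2 : (1 + F0 + 4 * V + 10 * beta) * (2^-1 * eps) <=
     (1 + F0 + 4 * V + 10 * beta) * (h_ j n * eps).
    by rewrite ler_wpM2l ?ler_wpM2r ?(ltW eps_gt0) // !addr_ge0 ?mulr_ge0.
  apply: le_trans p2.
  have := ltW eps_gt0 => e0.
  have := mulr_ge0 F0_ge0 e0; have := mulr_ge0 V_ge0 e0; have := mulr_ge0 b0 e0; lra.
Qed.

Lemma net_sol_eq (a : idx) i n : qev a i -> box K (inc i (qell a)) n ->
  delta eps i (net_sol a) n = dbilf qrhs a i net_sol net_sol n.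
Proof.
have e0 : eps != 0 by rewrite gt_eqF.
rewrite /dbilf; case: a => [[[[]|c]|[j c]]|[j k]] /= ai Bn.
- by rewrite big_nil /delta subrr mulr0.
- have Oi : Om (inc i n) by rewrite box_incE in Bn.
  rewrite big_cons big_nil /= /delta /= (state_step (a := sF c) isT Oi) /=.
  by field.
- have ij : i != j by []. have ji : j != i by rewrite eq_sym.
  rewrite !box_incE in Bn; have Oi := box_inc Bn.
  have Oj : Om (inc j n) by rewrite incC in Bn; exact: box_inc Bn.
  have On := box_inc Oi.
  rewrite !big_cons big_nil /= /delta /= (negbTE ij) (negbTE ji).
  rewrite (state_step (a := sV j c) ij Oi) /=.
  have r1 := lame_rel ij Oi Oj.
  have hi := h_neq0 i On; have hj := h_neq0 j On.
  rewrite r1.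
  by field; rewrite ?e0 ?hi ?hj.
- case/and3P: ai => jk ij ik.
  have ji : j != i by rewrite eq_sym. have ki : k != i by rewrite eq_sym.
  have kj : k != j by rewrite eq_sym.
  rewrite !box_incE in Bn.
  have Oik : Om (inc i (inc k n)) by rewrite incC; exact: box_inc Bn.
  have Oij : Om (inc i (inc j n)).
    by rewrite incC; apply: (@box_inc _ _ k); rewrite incC.
  have Ojk : Om (inc j (inc k n)).
    by apply: (@box_inc _ _ i); rewrite incC [inc i (inc k n)]incC.
  have Ok := box_inc Oik; have Oj := box_inc Oij.
  have Oi : Om (inc i n) by apply: (@box_inc _ _ k); rewrite incC.
  have On := box_inc Oi.
  rewrite !big_cons big_nil /= /delta /=.
  rewrite (negbTE ij) (negbTE ji) (negbTE ik) (negbTE jk).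
  have Oki : Om (inc k (inc i n)) by rewrite incC.
  have Oji : Om (inc j (inc i n)) by rewrite incC.
  have Okj : Om (inc k (inc j n)) by rewrite incC.
  have q1 := lame_rel kj Oki Oji.
  have q2 := lame_rel ij Oik Ojk.
  have dk1 : dev (sB k (Some j) : @dstate m N) i by rewrite /= kj ik ij.
  have dk2 : dev (sB i (Some j) : @dstate m N) k by rewrite /= ij ki kj.
  have s1 := state_step (a := sB k None) ik Oi; have s2 := state_step dk1 Oi.
  have s3 := state_step (a := sB i None) ki Ok; have s4 := state_step dk2 Ok.
  rewrite /= in s1 s2 s3 s4.
  have r1 := lame_rel kj Ok Oj; have r2 := lame_rel ki Ok Oi.
  rewrite [inc k (inc i n)]incC s1 s2 in q1.
  rewrite s3 s4 in q2.
  have n1 := h_neq0 k On; have n2 := h_neq0 k Oi; have n3 := h_neq0 k Oj.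
  have n4 := h_neq0 j Ok; have n5 := h_neq0 i Ok.
  have dn1 := den_neq0 k i On; have dn2 := den_neq0 i k On.
  rewrite r2 in n2.
  move: q1 q2; rewrite r1 r2.
  move: (h_ k (inc j (inc i n))) (h_ j (inc i (inc k n))) (h_ i (inc j (inc k n))).
  move=> Pk Pj Pi q1 q2.
  (* The implicit Darboux equation for a double step along [i] and [j]. With it all Lame
     coefficients on the cube are expressed by few of them, and the equation of [c_jk] becomes a
     rational identity. *)
  have E : Pk = h_ k n + b_ k j n * Pj + b_ k i n * Pi.
    by rewrite q1 q2; field; rewrite ?dn1 ?dn2.
  rewrite E.
  set a := x (sB k None) n in n1 n2 *; set bki := x (sB k (Some i)) n in n2 *.
  set bkj := x (sB k (Some j)) n.
  set hi := x (sB i None) (inc k n) in n2 n5 *; set hj := x (sB j None) (inc k n) in n4 *.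
  field.
  by rewrite ?e0 ?n1 ?n2 ?n4 ?n5.
Qed.

End LatticeNetExistence.

(** * Uniqueness for lattice and continuous systems *)

Section LatticeUniqueness.
Context {R : realType} {m : nat} {A : finType}.
Local Notation pts := ('I_m -> nat).
Variables (ev : A -> pred 'I_m)
  (rhs : A -> 'I_m -> seq (bool * option 'I_m * (A * A))) (ell : A -> pts).
Implicit Types (a b : A) (i : 'I_m) (n : pts).

Hypothesis rhs_size : forall a i, (size (rhs a i) <= 3)%N.
Hypothesis levels : rhs_levels ev rhs ell.
Variables (eps B1 : R) (K : nat) (Z Z' : A -> pts -> R).
Hypotheses (eps_gt0 : 0 < eps) (B1_ge0 : 0 <= B1) (small : 6 * eps * B1 <= 1).

Definition lattice_solution (x : A -> pts -> R) := forall a i n,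
  ev a i -> box K (inc i (ell a)) n -> delta eps i (x a) n = dbilf rhs a i x x n.

Hypothesis Z_eq : lattice_solution Z.
Hypothesis Z'_eq : lattice_solution Z'.
Hypothesis same_data : forall a n, box K (ell a) n -> (forall k, ev a k -> n k = 0%N) ->
  Z' a n = Z a n.
Hypothesis Z_bound : forall a n, box K (ell a) n -> `|Z a n| <= B1.

Let y a n := Z' a n - Z a n.

(** A right-hand side at weight [p - 1] contains shifted unknowns of weight [p], so a step does not
    determine the new values outright; for small [eps] the dependence is a contraction. The
    unshifted factors agree by induction on the weight, hence a bound is required of only one of the
    two solutions. *)
Lemma level_half p (M : R) : 0 <= M ->
  (forall a n, (weight n < p)%N -> box K (ell a) n -> y a n = 0) ->
  (forall a n, weight n = p -> box K (ell a) n -> `|y a n| <= M) ->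
  forall a n, weight n = p -> box K (ell a) n -> `|y a n| <= M / 2.
Proof.
move=> M0 IH HM a n np Bn.
have [Zr|] := pselect (forall k, ev a k -> n k = 0%N).
  by rewrite /y same_data // subrr normr0 divr_ge0.
move=> /existsNP[i /not_implyP[ai /eqP ni]].
rewrite -lt0n in ni.
have nE := inc_dec ni; set n' := dec i n in nE.
have wn : weight n = (weight n').+1 by rewrite -nE weight_inc.
have w' : (weight n' < p)%N by rewrite -np wn.
have Bn' : box K (inc i (ell a)) n'.
  by move=> k; have := Bn k; rewrite -nE /inc addnA addnAC.
have step (x : A -> pts -> R) : lattice_solution x -> x a n = x a n' + eps * dbilf rhs a i x x n'.
  move=> H; rewrite -(H a i n' ai Bn') /delta mulrA mulfV ?gt_eqF // mul1r nE.
  by rewrite addrC subrK.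
have Bl t : t \in rhs a i -> box K (ell t.2.1) (osh t.1.2 n') /\ box K (ell t.2.2) n'.
  move=> tr; have [l1 l2] := levels ai tr; split.
    move=> k; apply: leq_trans (Bn' k); have := l1 k.
    case: (t.1.2) => [q|] /=; last by rewrite leq_add2l.
    by rewrite /inc addnAC -addnA leq_add2l.
  by move=> k; apply: leq_trans (Bn' k); rewrite leq_add2l.
have D : y a n = eps * \sum_(t <- rhs a i) (-1) ^+ t.1.1 * (y t.2.1 (osh t.1.2 n') * Z t.2.2 n').
  rewrite /y (step _ Z_eq) (step _ Z'_eq) opprD addrACA -/(y a n') IH //; last first.
    by move=> k; apply: leq_trans (Bn' k); rewrite leq_add2l leq_addr.
  rewrite add0r -mulrBr; congr (_ * _); rewrite /dbilf -sumrB !big_seq.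
  apply: eq_bigr => t tr; have [_ b2] := Bl t tr.
  have := IH t.2.2 n' w' b2; rewrite /y => /eqP; rewrite subr_eq0 => /eqP ->.
  by move: ((-1) ^+ _) => c; ring.
rewrite D normrM (gtr0_norm eps_gt0).
have S : `|\sum_(t <- rhs a i) (-1) ^+ t.1.1 * (y t.2.1 (osh t.1.2 n') * Z t.2.2 n')| <=
    3 * (M * B1).
  apply: le_trans (ler_norm_sum _ _ _) _.
  apply: le_trans (_ : _ <= \sum_(t <- rhs a i) M * B1) _.
    rewrite !big_seq; apply: ler_sum => t tr; have [b1 b2] := Bl t tr.
    rewrite normrM normrX normrN1 expr1n mul1r normrM ler_pM ?Z_bound //.
    case: (t.1.2) b1 => [q|] /= b1; last by rewrite IH // normr0.
    by apply: HM => //; rewrite weight_inc -wn.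
  rewrite big_const_seq count_predT iter_addr_0 -[leLHS]mulr_natl ler_wpM2r ?mulr_ge0 //.
  by rewrite ler_nat.
apply: le_trans (ler_wpM2l (ltW eps_gt0) S) _.
have -> : eps * (3 * (M * B1)) = (6 * eps * B1) * (M / 2) by field.
by rewrite ler_piMl // divr_ge0.
Qed.

Lemma lattice_unique a n : box K (ell a) n -> Z' a n = Z a n.
Proof.
suff H p : forall a n, (weight n < p)%N -> box K (ell a) n -> y a n = 0.
  move=> Bn; apply/eqP; rewrite -subr_eq0; apply/eqP.
  exact: (H (weight n).+1).
elim: p => [//|p IH] {}a {}n; rewrite ltnS leq_eqVlt => /orP[/eqP np|]; last exact: IH.
move=> Bn; pose M := \sum_b supn (box K (ell b)) (y b).
have M0 : 0 <= M by rewrite sumr_ge0 // => b _; exact: supn_ge0.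
have HM q : forall a n, weight n = p -> box K (ell a) n -> `|y a n| <= M / 2 ^+ q.
  elim: q => [|q IHq] b n' n'p Bn'.
    rewrite expr0 divr1 /M (bigD1 b) //=.
    apply: le_trans (supn_ub (@box_bounded _ _ _ _ _) Bn') _.
    by rewrite lerDl sumr_ge0 // => *; exact: supn_ge0.
  rewrite exprSr invfM mulrA; apply: (level_half _ IH IHq) => //.
  by rewrite divr_ge0 // exprn_ge0.
have c : (fun=> y a n) @ \oo --> (0 : R).
  by apply: (@geometric_cvg _ _ _ M) => q; rewrite subr0; exact: HM.
by apply: (cvg_unique _ (cvg_cst _) c).
Qed.

End LatticeUniqueness.

(** * Uniqueness of bounded solutions on a cube of given size *)

Section ExpComparison.
Context {R : realType}.
Implicit Types (F : R -> R) (h lam kap c t : R).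

Lemma is_derive_exp_affine lam kap c t :
  is_derive t 1 (fun s : R => kap * expR (lam * (c + s))) (kap * (lam * expR (lam * (c + t)))).
Proof.
apply: (@is_deriveZ _ _ _ (fun s : R => expR (lam * (c + s)))).
have d1 : is_derive t 1 (fun s : R => c + s) (0 + 1).
  exact: is_deriveD.
have d2 : is_derive t 1 (fun s : R => lam * (c + s)) (lam * (0 + 1)).
  exact: (@is_deriveZ _ _ _ (fun s : R => c + s)).
rewrite add0r mulr1 in d2; rewrite mulrC.
exact: (@is_derive1_comp _ expR (fun s : R => lam * (c + s))).
Qed.

Lemma exp_comparison F (F' : R -> R) lam kap c h : 0 <= h ->
  (forall t, 0 <= t <= h -> is_derive t 1 F (F' t)) ->
  (forall t, 0 <= t <= h -> `|F' t| <= kap * (lam * expR (lam * (c + t)))) ->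
  `|F h - F 0| <= kap * expR (lam * (c + h)) - kap * expR (lam * (c + 0)).
Proof.
move=> h0 D H.
have G (s : R) : `|s| = 1 -> s * (F h - F 0) <= kap * expR (lam * (c + h)) - kap * expR (lam * (c + 0)).
  move=> s1.
  pose g (t : R) := s * F t - kap * expR (lam * (c + t)).
  pose g' (t : R) := s * F' t - kap * (lam * expR (lam * (c + t))).
  have [t th|t] := @mvt1 R g g' 0 h.
    rewrite (min_idPl h0) (max_idPr h0) in th.
    apply: is_deriveB; last exact: is_derive_exp_affine.
    by apply: (@is_deriveZ _ _ _ F); exact: D.
  rewrite (min_idPl h0) (max_idPr h0) => th E.
  have : g' t * (h - 0) <= 0.
    rewrite subr0 mulr_le0_ge0 // /g' subr_le0; apply: le_trans (H t th).
    by rewrite -[leRHS]mul1r -s1 -normrM ler_norm.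
  rewrite -E /g; lra.
rewrite ler_norml; have := G 1 (normr1 _); have := G (-1) (normrN1 _); lra.
Qed.

End ExpComparison.

Section ContinuousUniqueness.
Context {R : realType} {m : nat} {A : finType}.
Variables (ev : A -> pred 'I_m)
  (rhs : A -> 'I_m -> seq (bool * option 'I_m * (A * A))).
Implicit Types (a b : A) (i j l : 'I_m) (u v : 'rV[R]_m) (n : nat).

Local Notation e_ := (@basis_vec R m).

Hypothesis rhs_size : forall a i, (size (rhs a i) <= 3)%N.
Variables (r B : R) (x x' : A -> 'rV[R]_m -> R).
Hypothesis B_ge0 : 0 <= B.

Definition cube_solution (z : A -> 'rV[R]_m -> R) := forall a i u, ev a i -> cube r u ->
  is_derive u (e_ i) (z a) (bilf rhs a i z z u).

Hypotheses (x_eq : cube_solution x) (x'_eq : cube_solution x').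
Hypothesis same_data : forall a u, cube r u -> (forall i, ev a i -> u 0 i = 0) ->
  x' a u = x a u.
Hypothesis xB : forall a u, cube r u -> `|x a u| <= B.
Hypothesis x'B : forall a u, cube r u -> `|x' a u| <= B.

Let y a u := x' a u - x a u.
(** The bound [B] depends on the solutions compared, so the cube cannot be assumed small relative to
    it. A sup norm with exponential weight [wt] makes integration a contraction instead:
    [6 * B / lam <= 2^-1]. *)
Let lam := 12 * B + 1.
Let wt u := expR (lam * \sum_k u 0 k).

Lemma weighted_half (M : R) : 0 <= M ->
  (forall a u, cube r u -> `|y a u| <= M * wt u) ->
  forall a u, cube r u -> `|y a u| <= M / 2 * wt u.
Proof.
move=> M0 HM a u Qu.
have lam0 : 0 < lam by rewrite /lam ltr_wpDl // mulr_ge0.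
pose kap := 6 * B * M / lam.
have kap0 : 0 <= kap by rewrite divr_ge0 ?mulr_ge0 // ltW.
(* From the data point ([n = 0]) to [u] ([n = m]), one coordinate at a time. The increments of
   [kap * wt] along the chain telescope, so the number of directions does not enter the constant. *)
pose z n := zer (fun l => ev a l && (n <= l)%N) u.
have Qz n : cube r (z n).
  move=> l; rewrite zerE; case: ifP => _; last exact: Qu.
  by rewrite lexx; have /andP[h1 h2] := Qu l; exact: le_trans h2.
have Dy i v : ev a i -> cube r v -> exists2 g, is_derive v (e_ i) (y a) g & `|g| <= 6 * B * M * wt v.
  move=> ai Qv; exists (bilf rhs a i x' x' v - bilf rhs a i x x v).
    by apply: is_deriveB; [exact: x'_eq | exact: x_eq].
  have -> : bilf rhs a i x' x' v - bilf rhs a i x x v =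
      bil rhs a i (y^~ v) (x'^~ v) + bil rhs a i (x^~ v) (y^~ v).
    rewrite /bilf /bil -sumrB -big_split; apply: eq_bigr => t _ /=.
    by rewrite /y; move: ((-1) ^+ _) => c; ring.
  have w0 : 0 <= M * wt v by rewrite mulr_ge0 // expR_ge0.
  have b1 : `|bil rhs a i (y^~ v) (x'^~ v)| <= 3 * (M * wt v * B).
    by apply: bil_bound => // t _; [exact: HM | exact: x'B].
  have b2 : `|bil rhs a i (x^~ v) (y^~ v)| <= 3 * (B * (M * wt v)).
    by apply: bil_bound => // t _; [exact: xB | exact: HM].
  apply: le_trans (ler_normD _ _) _; lra.
have W n : (n <= m)%N -> `|y a (z n)| <= kap * wt (z n).
  elim: n => [_|n IH nm].
    rewrite /y same_data ?subrr ?normr0; first by rewrite mulr_ge0 // expR_ge0.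
      exact: Qz.
    by move=> l al; rewrite zerE al.
  have {}IH := IH (ltnW nm); pose j := Ordinal nm.
  have ZE : z n.+1 = z n + (if ev a j then u 0 j else 0) *: e_ j.
    apply/rowP => l; rewrite lineE !zerE.
    have [->|lj] := eqVneq l j.
      by rewrite mulr1 /= leqnn ltnn andbT andbF; case: ifP; rewrite ?add0r ?addr0.
    rewrite mulr0 addr0; congr (if _ then _ else _); congr (_ && _).
    by rewrite ltn_neqAle [X in X && _](_ : _ = true) // eq_sym.
  have [aj|naj] := boolP (ev a j); last first.
    by rewrite ZE (negbTE naj) scale0r addr0.
  rewrite aj in ZE.
  have zj : z n 0 j = 0 by rewrite zerE aj leqnn.
  have sE t : \sum_k (z n + t *: e_ j) 0 k = \sum_k z n 0 k + t.
    under eq_bigr => k _ do rewrite lineE.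
    rewrite big_split /=; congr (_ + _).
    by rewrite (bigD1 j) //= eqxx mulr1 big1 ?addr0 // => k /negbTE ->; rewrite mulr0.
  have /andP[u0 ur] := Qu j.
  have Qt t : 0 <= t <= u 0 j -> cube r (z n + t *: e_ j).
    move=> /andP[t0 t1] l; rewrite lineE.
    have [->|lj] := eqVneq l j; last by rewrite mulr0 addr0; exact: Qz.
    by rewrite mulr1 zj add0r t0 (le_trans t1).
  have E := @exp_comparison R (fun t => y a (z n + t *: e_ j))
    (fun t => partial j (y a) (z n + t *: e_ j)) lam kap (\sum_k z n 0 k) (u 0 j) u0.
  lapply E.
    move=> {}E; lapply E.
      move=> {}E; rewrite ZE /wt sE.
      move: E; rewrite scale0r !addr0 => E.
      move: IH; rewrite /wt => IH.
      set f1 := y a (z n) in IH E *; set f2 := y a _ in E *.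
      have := ler_normD (f2 - f1) f1; rewrite subrK; lra.
    move=> t th; have [g dg gB] := Dy j _ aj (Qt t th).
    rewrite (partial_is_derive dg); apply: le_trans gB _.
    rewrite /wt sE mulrA; rewrite ler_wpM2r ?expR_ge0 // /kap mulfVK ?gt_eqF //.
  move=> t th; have [g dg gB] := Dy j _ aj (Qt t th).
  by apply: is_derive_line; rewrite (partial_is_derive dg).
have zm : z m = u.
  by apply/rowP => l; rewrite zerE leqNgt ltn_ord andbF.
have := W m (leqnn m); rewrite zm => h; apply: le_trans h _.
rewrite ler_wpM2r ?expR_ge0 // /kap ler_pdivrMr // /lam.
have := mulr_ge0 M0 B_ge0; lra.
Qed.

Lemma cube_unique a u : cube r u -> x' a u = x a u.
Proof.
move=> Qu; apply/eqP; rewrite -subr_eq0 -/(y a u).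
have sum0 v : cube r v -> 0 <= \sum_k v 0 k.
  by move=> Qv; rewrite sumr_ge0 // => k _; have /andP[] := Qv k.
have lam0 : 0 <= lam by rewrite /lam addr_ge0 // mulr_ge0.
have H n : forall a u, cube r u -> `|y a u| <= 2 * B / 2 ^+ n * wt u.
  elim: n => [|n IH] b v Qv.
    rewrite expr0 divr1; have : 1 <= wt v by rewrite /wt -expR0 ler_expR mulr_ge0 // sum0.
    move=> w1; apply: le_trans (_ : 2 * B * 1 <= _); last first.
      by rewrite ler_wpM2l // mulr_ge0.
    apply: le_trans (ler_normB _ _) _; have := xB b Qv; have := x'B b Qv; lra.
  rewrite exprSr invfM mulrA; apply: weighted_half => //.
  by rewrite divr_ge0 ?mulr_ge0 ?exprn_ge0.
have c : (fun=> y a u) @ \oo --> (0 : R).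
  apply: (@geometric_cvg _ _ _ (2 * B * wt u)) => n; rewrite subr0.
  by rewrite mulrAC; exact: H.
by apply/eqP; apply: (cvg_unique _ (cvg_cst _) c).
Qed.

End ContinuousUniqueness.

(** * The net with given initial data *)

Section InitialData.
Context {R : realType} {m : nat}.
Implicit Types (i j : 'I_m) (u v : 'rV[R]_m) (L : pred 'I_m).

Local Notation e_ := (@basis_vec R m).

Lemma is_derive_pull_at L (f : 'rV[R]_m -> R) g u i : ~~ L i ->
  is_derive (zer L u) (e_ i) f g -> is_derive u (e_ i) (fun v => f (zer L v)) g.
Proof.
move=> Li d.
have := @is_derive_translate R m f u (zer L u - u) i g.
rewrite addrC subrK => /(_ d); apply: is_derive_ext_line => h.
by rewrite zer_line (negbTE Li) addrC addrA subrK.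
Qed.

Lemma coord_is_derive N (F : 'rV[R]_m -> 'rV[R]_N) u v l (c : 'I_N) :
  is_derive u v F l -> is_derive u v (fun w => F w 0 c) (l 0 c).
Proof.
move=> [d <-]; apply: DeriveDef; first exact: ((derivable_mxP _ _ _).1 d 0 c).
by rewrite derive_mx // mxE.
Qed.

Lemma coord_norm_le N (w : 'rV[R]_N) c : `|w 0 c| <= `|w|.
Proof. by rewrite [leRHS]mx_normrE; exact: (le_bigmax _ _ (0, c)). Qed.

Definition subspace_of (I : {set 'I_m}) : set 'rV[R]_m := [set u | forall k, k \notin I -> u 0 k = 0].

Lemma axisE i : axis i = subspace_of [set i]%SET.
Proof.
apply/seteqP; split=> u H k; first by rewrite inE; exact: H.
by move=> ki; apply: H; rewrite inE.
Qed.

Lemma coord_planeE i j : coord_plane i j = subspace_of [set i; j]%SET.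
Proof.
apply/seteqP; split=> u H k; first by rewrite !inE negb_or => /andP[]; exact: H.
by move=> ki kj; apply: H; rewrite !inE negb_or ki.
Qed.

Lemma subspace_zer (I : {set 'I_m}) u : subspace_of I (zer (fun k => k \notin I) u).
Proof. by move=> k kI; rewrite zerE kI. Qed.

Lemma within_locally_bounded (V : normedModType R) (I : {set 'I_m}) (F : 'rV[R]_m -> V) :
  {within subspace_of I, continuous F} ->
  forall rho, exists M, forall u, ocube rho u -> `|F (zer (fun k => k \notin I) u)| <= M.
Proof.
move=> cF rho.
pose A k : set R := if k \in I then [set` `[- rho, rho]] else [set 0].
pose KK : set 'rV[R]_m := [set u | forall k, A k (u 0 k)].
have cK : compact KK.
  apply: (@rV_compact R m A) => k; rewrite /A; case: ifP => _.
    exact: segment_compact.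
  exact: compact_set1.
have KS : KK `<=` subspace_of I.
  by move=> u Ku k kI; have := Ku k; rewrite /A (negbTE kI).
have [M [_ HM]] := compact_bounded (continuous_compact (continuous_subspaceW KS cF) cK).
exists (M + 1) => u Qu; apply: (HM (M + 1)); first by rewrite ltrDl.
exists (zer (fun k => k \notin I) u) => //= k; rewrite /A zerE.
case: ifP => //= kI; rewrite in_itv /=.
by have := Qu k; rewrite ltr_norml => /andP[h1 h2]; rewrite !ltW.
Qed.

(** Data given on a coordinate subspace become globally smooth when extended constantly in the other
    coordinates. [phi] is a component for the curves and the identity for the coefficients. *)
Lemma smoothG_of_along (V : normedModType R) (I : {set 'I_m}) (F : 'rV[R]_m -> V) (phi : V -> R) :
  (forall w : V, `|phi w| <= `|w|) ->
  (forall (G : 'rV[R]_m -> V) u i l, is_derive u (e_ i) G l ->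
    is_derive u (e_ i) (fun w => phi (G w)) (phi l)) ->
  smooth_along I (subspace_of I) F ->
  forall s, all (fun i => i \in I) s ->
    smoothG (fun u => phi (iter_partial s F (zer (fun k => k \notin I) u))) /\
    forall i u, is_derive u (e_ i) (fun u => phi (iter_partial s F (zer (fun k => k \notin I) u)))
      (if i \in I then phi (iter_partial (i :: s) F (zer (fun k => k \notin I) u)) else 0).
Proof.
move=> nphi dphi sF.
have D s i u : all (fun i => i \in I) s ->
    is_derive u (e_ i) (fun u => phi (iter_partial s F (zer (fun k => k \notin I) u)))
      (if i \in I then phi (iter_partial (i :: s) F (zer (fun k => k \notin I) u)) else 0).
  move=> sI; have [_ dF] := sF s sI; case: ifP => iI.
    apply: (@is_derive_pull_at _ (fun w => phi (iter_partial s F w))); first by rewrite iI.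
    apply: dphi; apply: derivableP; apply: dF => //; exact: subspace_zer.
  apply: (@is_derive_ext_line _ _ (fun=> phi (iter_partial s F (zer (fun k => k \notin I) u)))).
  by move=> h; rewrite zer_line iI.
move=> s sI; split; last by move=> i u; exact: D.
have lb s' : all (fun i => i \in I) s' ->
    locally_bounded (fun u => phi (iter_partial s' F (zer (fun k => k \notin I) u))).
  move=> s'I rho; have [cF _] := sF s' s'I.
  have [M HM] := within_locally_bounded cF rho.
  by exists M => u Qu; apply: le_trans (nphi _) (HM u Qu).
move=> k; elim: k s sI => [|k IH] s sI; first by split=> //; exact: lb.
apply: smooth_orderS; first exact: lb.
move=> i; have [iI|iI] := boolP (i \in I).
  exists (fun u => phi (iter_partial (i :: s) F (zer (fun k => k \notin I) u))).
    by apply: IH; rewrite /= iI.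
  by move=> u; have := D s i u sI; rewrite iI.
exists (fun=> 0); first exact: smooth_order_cst.
by move=> u; have := D s i u sI; rewrite (negbTE iI).
Qed.

End InitialData.

Section NetData.
Context {R : realType} {m N : nat}.
Implicit Types (i j : 'I_m) (u v : 'rV[R]_m) (c : 'I_N).
Local Notation e_ := (@basis_vec R m).
Local Notation idx := (@idx m N).

Variables (f0 : 'rV[R]_m -> 'rV[R]_N) (c0 : 'I_m -> 'I_m -> 'rV[R]_m -> R).
Hypothesis data : smooth_data f0 c0.

Definition axis_curve i c u : R := f0 (zer (fun k => k \notin [set i]%SET) u) 0 c.

Definition smooth_net_data (a : idx) u : R :=
  match a with
  | inl (inl (inl _)) => 1
  | inl (inl (inr c)) => f0 0 0 c
  | inl (inr (i, c)) => partial i f0 (zer (fun k => k \notin [set i]%SET) u) 0 c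
  | inr (i, j) => if i == j then 0 else c0 i j (zer (fun k => k \notin [set i; j]%SET) u)
  end.

Lemma axis_along i c :
  smoothG (axis_curve i c) /\ (smoothG (smooth_net_data (xW i c)) /\
  forall u, is_derive u (e_ i) (axis_curve i c) (smooth_net_data (xW i c) u)).
Proof.
have [sf _] := data; have := sf i; rewrite axisE => sfi.
have H := @smoothG_of_along R m _ [set i]%SET f0 (fun w => w 0 c)
  (fun w => coord_norm_le w c) (fun G u i l d => coord_is_derive c d) sfi.
have i1 : all (fun j => j \in [set i]%SET) [:: i] by rewrite /= inE eqxx.
have [H1 D1] := H [::] isT; have [H2 _] := H [:: i] i1.
split; first exact: H1.
split; first exact: H2.
by move=> u; have := D1 i u; rewrite inE eqxx.
Qed.

Lemma smooth_net_dataP (a : idx) : smoothG (smooth_net_data a).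
Proof.
case: a => [[[[]|c]|[i c]]|[i j]].
- exact: smoothG_cst.
- exact: smoothG_cst.
- by have [_ []] := axis_along i c.
- rewrite /smooth_net_data; case: eqP => [_|/eqP ij]; first exact: smoothG_cst.
  have [_ sc] := data; have := sc i j ij; rewrite coord_planeE => scij.
  have H := @smoothG_of_along R m _ [set i; j]%SET (c0 i j) (fun w => w)
    (fun w => lexx _) (fun G u i l d => d) scij.
  by have [] := H [::] isT.
Qed.

Lemma smooth_net_data_zer (a : idx) u :
  smooth_net_data a (zer (qev a) u) = smooth_net_data a u.
Proof.
have zz L (L' : pred 'I_m) : L =1 L' -> zer L (zer L' u) = zer L u.
  by move=> E; apply/rowP => k; rewrite !zerE E; case: (L' k).
case: a => [[[[]|c]|[i c]]|[i j]] //=.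
  by rewrite zz // => k; rewrite inE.
case: eqP => // /eqP ij; rewrite zz // => k.
by rewrite /qev ij !inE negb_or.
Qed.

End NetData.

Section JetFunctions.
Context {R : realType} {m : nat}.
Implicit Types (i j : 'I_m) (u v : 'rV[R]_m) (s : seq 'I_m).
Local Notation e_ := (@basis_vec R m).
Variable rho : R.

(** Only partial derivatives are at hand, so [u] is moved to [v] one coordinate at a time, inside
    the cube. *)
Lemma ocube_lipschitz (f : 'rV[R]_m -> R) (g : 'I_m -> 'rV[R]_m -> R) (C : R) :
  (forall i u, ocube rho u -> is_derive u (e_ i) f (g i u)) ->
  (forall i u, ocube rho u -> `|g i u| <= C) ->
  forall u v, ocube rho u -> ocube rho v -> `|f v - f u| <= C * \sum_k `|v 0 k - u 0 k|.
Proof.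
move=> D HC u v Qu Qv.
pose w n : 'rV[R]_m := \row_(k < m) (if (k < n)%N then v 0 k else u 0 k).
have Qw n : ocube rho (w n) by move=> k; rewrite mxE; case: ifP.
have W n : (n <= m)%N -> `|f (w n) - f u| <= C * \sum_(k < m | (k < n)%N) `|v 0 k - u 0 k|.
  elim: n => [_|n IH nm].
    have -> : w 0%N = u by apply/rowP => k; rewrite mxE.
    by rewrite subrr normr0 big_pred0 ?mulr0.
  have {}IH := IH (ltnW nm); pose j := Ordinal nm.
  have E : w n.+1 = w n + (v 0 j - u 0 j) *: e_ j.
    apply/rowP => k; rewrite lineE !mxE ltnS.
    have [->|kj] := eqVneq k j; first by rewrite leqnn ltnn mulr1 addrC subrK.
    rewrite mulr0 addr0 leq_eqVlt (_ : (k == n :> nat) = false) //.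
    by apply/negbTE; apply: contra kj => /eqP kn; apply/eqP/val_inj.
  have M : `|f (w n + (v 0 j - u 0 j) *: e_ j) - f (w n)| <= `|v 0 j - u 0 j| * C.
    apply: mvt_bound_ex => t t01; exists (g j (w n + (t * (v 0 j - u 0 j)) *: e_ j)).
      by apply: D; apply: ocube_seg => //; rewrite -E.
    by apply: HC; apply: ocube_seg => //; rewrite -E.
  rewrite (bigD1 j) //= [X in _ <= _ * (_ + X)](_ : _ = \sum_(k < m | (k < n)%N) `|v 0 k - u 0 k|); last first.
    apply: eq_bigl => k; rewrite ltnS leq_eqVlt.
    have [->|kj] := eqVneq k j; first by rewrite ltnn andbF.
    rewrite andbT (_ : (k == n :> nat) = false) //.
    by apply/negbTE; apply: contra kj => /eqP kn; apply/eqP/val_inj.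
  rewrite mulrDr E -(subrKA (f (w n))).
  apply: le_trans (ler_normD _ _) _; apply: lerD => //.
  by rewrite mulrC.
have := W m (leqnn m); have -> : w m = v by apply/rowP => k; rewrite mxE ltn_ord.
by under eq_bigl => k do rewrite ltn_ord.
Qed.

Lemma ocube_continuous (f : 'rV[R]_m -> R) (g : 'I_m -> 'rV[R]_m -> R) :
  (forall i u, ocube rho u -> is_derive u (e_ i) f (g i u)) ->
  (forall i, bounded_on (ocube rho) (g i)) ->
  forall u, ocube rho u -> f @ u --> f u.
Proof.
move=> D HB u Qu.
have [F HF] := ex_choice HB.
pose C := \sum_i `|F i|.
have HC i v : ocube rho v -> `|g i v| <= C.
  move=> Qv; apply: le_trans (HF i v Qv) _; apply: le_trans (ler_norm _) _.
  by rewrite /C (bigD1 i) //= lerDl sumr_ge0.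
have C0 : 0 <= C by rewrite sumr_ge0.
apply/(@cvgrPdist_le _ _ _ (nbhs u) (nbhs_filter u)) => e e0.
pose dl := e / ((C + 1) * (m%:R + 1)).
have den : 0 < (C + 1) * (m%:R + 1) by rewrite mulr_gt0 // ltr_wpDl.
have dl0 : 0 < dl by rewrite divr_gt0.
have H k : \forall v \near u, `|(v : 'rV[R]_m) 0 k - u 0 k| <= dl.
  have c : (fun v : 'rV[R]_m => v 0 k) @ u --> u 0 k by exact: coord_continuous.
  move/(@cvgrPdist_le _ _ _ (nbhs u) (nbhs_filter u)) : c => /(_ dl dl0); apply: (@filterS _ _ (nbhs_filter u)) => v.
  by rewrite distrC.
have HA := @filter_forall _ _ (fun k v => `|(v : 'rV[R]_m) 0 k - u 0 k| <= dl) (nbhs u) (nbhs_filter u) H.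
have HQ := @filterI _ _ (nbhs_filter u) _ _ (ocube_nbhs Qu) HA.
apply: (@filterS _ _ (nbhs_filter u) _ _ _ HQ) => v [Qv Hv].
rewrite distrC; apply: le_trans (ocube_lipschitz D HC Qu Qv) _.
have S : \sum_k `|v 0 k - u 0 k| <= m%:R * dl.
  by apply: le_trans (ler_sum _ (fun k _ => Hv k)) _; rewrite sumr_const card_ord -[leLHS]mulr_natl.
apply: le_trans (ler_wpM2l C0 S) _.
have E : e = (C + 1) * (m%:R + 1) * dl by rewrite /dl mulrCA mulfV ?mulr1 // gt_eqF.
rewrite [leRHS]E mulrA ler_wpM2r ?(ltW dl0) //.
by apply: ler_pM => //; rewrite lerDl.
Qed.

Variable J : seq 'I_m -> 'rV[R]_m -> R.
Hypotheses (HJ : jets rho J) (HB : forall s, bounded_on (ocube rho) (J s)).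

Lemma jet_continuous s u : ocube rho u -> J s @ u --> J s u.
Proof.
apply: (@ocube_continuous (J s) (fun i => J (i :: s))) => [i v Qv|i].
  exact: HJ.
exact: HB.
Qed.

Lemma iter_partial_jet f : (forall u, ocube rho u -> f u = J [::] u) ->
  forall s u, ocube rho u -> iter_partial s f u = J s u.
Proof.
move=> fJ; elim=> [|i s IH] u Qu; first exact: fJ.
apply: partial_is_derive; apply: (is_derive_ext_ocube (rho := rho) Qu _ (HJ s i Qu)).
by move=> v Qv; symmetry; exact: IH.
Qed.

Lemma within_ocube_continuous (V : normedModType R) (f : 'rV[R]_m -> V) :
  (forall u, ocube rho u -> f @ u --> f u) -> {within ocube rho, continuous f}.
Proof.
move=> H; apply/subspace_continuousP => u Qu; apply: cvg_within_filter.
exact: H.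
Qed.

Lemma smooth_along_jet f : (forall u, ocube rho u -> f u = J [::] u) ->
  smooth_along [set: 'I_m]%SET (ocube rho) f.
Proof.
move=> fJ s _; have E := iter_partial_jet fJ; split.
  apply: within_ocube_continuous => u Qu; rewrite E //.
  have c := @jet_continuous s u Qu.
  apply: cvg_trans c; apply: (near_eq_cvg (FF := nbhs_filter u)).
  by apply: (@filterS _ _ (nbhs_filter u) _ _ _ (ocube_nbhs Qu)) => v Qv; rewrite E.
move=> u Qu i _; apply: is_derive_derivable.
apply: (is_derive_ext_ocube (rho := rho) Qu _ (HJ s i Qu)).
by move=> v Qv; rewrite E.
Qed.

End JetFunctions.

Section RowJetFunctions.
Context {R : realType} {m N : nat}.
Implicit Types (i j : 'I_m) (u v : 'rV[R]_m) (s : seq 'I_m).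
Local Notation e_ := (@basis_vec R m).
Variable rho : R.
Variable J : 'I_N -> seq 'I_m -> 'rV[R]_m -> R.
Hypotheses (HJ : forall c, jets rho (J c))
  (HB : forall c s, bounded_on (ocube rho) (J c s)).

Lemma is_derive_row (F : 'rV[R]_m -> 'rV[R]_N) u v (l : 'rV[R]_N) :
  (forall c, is_derive u v (fun w => F w 0 c) (l 0 c)) -> is_derive u v F l.
Proof.
move=> H.
have d : derivable F u v.
  by apply/derivable_mxP => a c; rewrite (ord1 a); exact: is_derive_derivable (H c).
apply: DeriveDef => //; rewrite derive_mx //; apply/rowP => c; rewrite mxE.
exact: is_derive_val (H c).
Qed.

Lemma row_continuous (F : 'rV[R]_m -> 'rV[R]_N) u :
  (forall c, (fun w => F w 0 c) @ u --> F u 0 c) -> F @ u --> F u.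
Proof.
move=> H; apply/(@cvgrPdist_le _ _ _ (nbhs u) (nbhs_filter u)) => e e0.
have HA := @filter_forall _ _ (fun c v => `|F u 0 c - F v 0 c| <= e) (nbhs u) (nbhs_filter u)
  (fun c => (@cvgrPdist_le _ _ _ (nbhs u) (nbhs_filter u) _ _).1 (H c) e e0).
apply: (@filterS _ _ (nbhs_filter u) _ _ _ HA) => v Hv.
rewrite [leLHS]mx_normrE; apply: bigmax_le; first exact: ltW.
by case=> a c _; rewrite (ord1 a) /= !mxE; exact: Hv.
Qed.

Lemma iter_partial_row_jet F : (forall u, ocube rho u -> F u = \row_c J c [::] u) ->
  forall s u, ocube rho u -> iter_partial s F u = \row_c J c s u.
Proof.
move=> FJ; elim=> [|i s IH] u Qu; first exact: FJ.
apply: is_derive_val; apply: is_derive_row => c.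
rewrite mxE; apply: (is_derive_ext_ocube (rho := rho) Qu _ (@HJ c s i u Qu)).
by move=> v Qv; have := IH v Qv => /rowP /(_ c); rewrite mxE => <-.
Qed.

Lemma smooth_along_row_jet F : (forall u, ocube rho u -> F u = \row_c J c [::] u) ->
  smooth_along [set: 'I_m]%SET (ocube rho) F.
Proof.
move=> FJ s _; have E := iter_partial_row_jet FJ; split.
  apply: within_ocube_continuous => u Qu; apply: row_continuous => c.
  rewrite E // mxE; have ct := jet_continuous (HJ c) (HB c) (s := s) Qu.
  apply: cvg_trans ct; apply: (near_eq_cvg (FF := nbhs_filter u)).
  by apply: (@filterS _ _ (nbhs_filter u) _ _ _ (ocube_nbhs Qu)) => v Qv; rewrite E // mxE.
move=> u Qu i _.
apply: (@is_derive_derivable _ _ _ _ _ _ (\row_c J c (i :: s) u)); apply: is_derive_row => c.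
rewrite mxE; apply: (is_derive_ext_ocube (rho := rho) Qu _ (@HJ c s i u Qu)).
by move=> v Qv; rewrite E // mxE.
Qed.

End RowJetFunctions.

(** * The smooth net and its initial data *)

Section ContinuousNet.
Context {R : realType} {m N : nat}.
Implicit Types (i j : 'I_m) (u v : 'rV[R]_m) (c : 'I_N).
Local Notation e_ := (@basis_vec R m).
Local Notation idx := (@idx m N).

Variables (f0 : 'rV[R]_m -> 'rV[R]_N) (c0 : 'I_m -> 'I_m -> 'rV[R]_m -> R).
Hypothesis data : smooth_data f0 c0.

Variables (rho D r : R).
Hypotheses (rho_gt0 : 0 < rho) (D_ge0 : 0 <= D) (r_lt : r < rho).
Hypothesis data_bound : forall (a : idx) u, ocube rho u -> `|smooth_net_data f0 c0 a u| <= D.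
Hypothesis rho_ball : 2 * rho * m%:R * (3 * ((D + 2) * (D + 2))) <= 1.
Hypothesis rho_contr : 2 * rho * m%:R * (6 * (D + 2)) <= 2^-1.

Definition net_jet : idx -> seq 'I_m -> 'rV[R]_m -> R := jet qev qrhs (smooth_net_data f0 c0).
Local Notation J := net_jet.
Definition net_map u : 'rV[R]_N := \row_c J (xF c) [::] u.
Definition net_coef i j u : R := J (xC i j) [::] u.

Lemma net_jets a : jets rho (J a).
Proof.
move=> s i u Qu.
exact: (@jet_is_derive R m _ qev qrhs _ (smooth_net_dataP data) qrhs_size rho D).
Qed.

Lemma net_jet_bounded a s : bounded_on (ocube rho) (J a s).
Proof.
have [C _ H] := @jet_bounded R m _ qev qrhs _ (smooth_net_dataP data) qrhs_size rho D rho_gt0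
  D_ge0 data_bound rho_ball rho_contr s.
by exists C => u; exact: H.
Qed.

Lemma net_jet_ball a u : ocube rho u -> `|J a [::] u| <= D + 2.
Proof.
exact: (@jet_ball R m _ qev qrhs _ (smooth_net_dataP data) qrhs_size rho D).
Qed.

Lemma net_jet_system a i u : ocube rho u -> qev a i ->
  J a [:: i] u = bilf qrhs a i (J^~ [::]) (J^~ [::]) u.
Proof.
move=> Qu ai.
have P : forall (b : idx) (l : 'I_m) v, ocube rho v -> qev b l ->
   (forall p, later qev b l p -> v 0 p = 0) -> J b [:: l] v = bilf qrhs b l (J^~ [::]) (J^~ [::]) v.
  move=> b l v.
  exact: (@jet_path R m _ qev qrhs _ (smooth_net_dataP data) (smooth_net_data_zer f0 c0) qrhs_size rho D).
have B0 : 0 <= D + 2 by rewrite addr_ge0.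
have T := @system_holds R m _ qev qrhs qrhs_size J rho (D + 2) net_jets net_jet_bounded P
  net_jet_ball rho_gt0 B0 rho_contr qrhs_closed (@qrhs_compatible m N R).
exact: T.
Qed.

Lemma net_jet_data a u : ocube rho u -> (forall i, qev a i -> u 0 i = 0) ->
  J a [::] u = smooth_net_data f0 c0 a u.
Proof.
exact: (@jet_data R m _ qev qrhs _ (smooth_net_dataP data) qrhs_size rho D).
Qed.

Lemma ocube0 : ocube rho (0 : 'rV[R]_m).
Proof. by move=> k; rewrite mxE normr0. Qed.

Lemma cube_ocube u : cube r u -> ocube rho u.
Proof.
by move=> Qu k; have /andP[h1 h2] := Qu k; rewrite ger0_norm //; exact: le_lt_trans r_lt.
Qed.

(** The unknown [xOne] has an empty right-hand side, so its partial derivatives vanish and it keeps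
    its value at the origin. *)
Lemma net_jet_one u : ocube rho u -> J (@xOne m N) [::] u = 1.
Proof.
move=> Qu.
have E := @ocube_lipschitz R m rho (J (@xOne m N) [::]) (fun i => J (@xOne m N) [:: i]) 0
  (fun i v Qv => @net_jets _ [::] i v Qv).
have Z i v : ocube rho v -> `|J (@xOne m N) [:: i] v| <= 0.
  by move=> Qv; rewrite net_jet_system // /bilf /bil big_nil normr0.
have := E Z 0 u ocube0 Qu; rewrite mul0r normr_le0 subr_eq0 => /eqP ->.
by rewrite net_jet_data //; [exact: ocube0 | move=> i _; rewrite mxE].
Qed.

Lemma net_jet_F c i u : ocube rho u -> J (xF c) [:: i] u = J (xW i c) [::] u.
Proof.
move=> Qu; rewrite net_jet_system // /bilf /bil big_cons big_nil /=.
by rewrite expr0 mul1r addr0 net_jet_one // mulr1.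
Qed.

Lemma net_jet_W c i j u : ocube rho u -> i != j ->
  J (xF c) [:: i; j] u = J (xC j i) [::] u * J (xW i c) [::] u
    + J (xC i j) [::] u * J (xW j c) [::] u.
Proof.
move=> Qu ij.
have -> : J (xF c) [:: i; j] u = J (xW j c) [:: i] u.
  rewrite -(is_derive_val (@net_jets (xF c) [:: j] i u Qu)).
  apply: is_derive_val; apply: (is_derive_ext_ocube (rho := rho) Qu _ (@net_jets _ [::] i u Qu)).
  by move=> v Qv; rewrite net_jet_F.
rewrite net_jet_system // /bilf /bil big_cons big_cons big_nil /=.
by rewrite !expr0 !mul1r addr0.
Qed.

Lemma iter_partial_net_map s u : ocube rho u -> iter_partial s net_map u = \row_c J (xF c) s u.
Proof.
exact: (@iter_partial_row_jet R m N rho (fun c => J (xF c)) (fun c => @net_jets (xF c)) net_map).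
Qed.

Lemma net_conjugate_system : conjugate_system r net_map net_coef.
Proof.
split=> [i j ij u /cube_ocube Qu|i j k ij jk ik u /cube_ocube Qu].
  have E1 p : partial p net_map u = \row_c J (xW p c) [::] u.
    have := iter_partial_net_map [:: p] Qu => /= ->.
    by apply/rowP => c; rewrite !mxE net_jet_F.
  have := iter_partial_net_map [:: i; j] Qu => /= ->; rewrite !E1.
  by apply/rowP => c; rewrite !mxE net_jet_W.
have -> : partial i (net_coef j k) u = J (xC j k) [:: i] u.
  by apply: partial_is_derive; exact: net_jets.
rewrite net_jet_system //=; last by rewrite jk ij ik.
rewrite /bilf /bil !big_cons big_nil /= expr0 expr1 /net_coef; ring.
Qed.

Lemma zer_subspace (I : {set 'I_m}) u : subspace_of I u -> zer (fun k => k \notin I) u = u.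
Proof. by move=> H; apply/rowP => k; rewrite zerE; case: ifP => // /H ->. Qed.

(** The system prescribes [f] at the origin and [w_i] on the axis. Along the axis the net and the
    given curve start at the same point and have the same derivative. *)
Lemma net_axis_data i u : axis i u -> cube r u -> net_map u = f0 u.
Proof.
move=> ax /cube_ocube Qu; apply/rowP => c; rewrite mxE.
have [_ [_ dC]] := axis_along data i c.
have Eu : 0 + u 0 i *: e_ i = u.
  apply/rowP => k; rewrite lineE mxE add0r.
  by have [->|/ax ->] := eqVneq k i; rewrite ?mulr1 ?mulr0.
have M : `|J (xF c) [::] (0 + u 0 i *: e_ i) - axis_curve f0 i c (0 + u 0 i *: e_ i) -
   (J (xF c) [::] 0 - axis_curve f0 i c 0)| <= `|u 0 i| * 0.
  apply: (@mvt_bound_ex R m (fun v => J (xF c) [::] v - axis_curve f0 i c v)) => t t01.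
  have Qt : ocube rho (0 + (t * u 0 i) *: e_ i).
    by apply: ocube_seg => //; [exact: ocube0 | rewrite Eu].
  exists (J (xF c) [:: i] (0 + (t * u 0 i) *: e_ i) - smooth_net_data f0 c0 (xW i c) (0 + (t * u 0 i) *: e_ i)).
move: (@net_jets (xF c) [::] i _ Qt) => dJ; apply: (is_deriveB dJ (dC _)).
  rewrite net_jet_F // net_jet_data // ?subrr ?normr0 //.
  by move=> k /= ki; rewrite lineE mxE (negbTE ki) mulr0 addr0.
move: M; rewrite mulr0 normr_le0 subr_eq0 Eu (net_jet_data ocube0); last by move=> k _; rewrite mxE.
have ax' : subspace_of [set i]%SET u by rewrite -axisE.
have ax0 : subspace_of [set i]%SET (0 : 'rV[R]_m) by move=> k _; rewrite mxE.
by rewrite /axis_curve (zer_subspace ax') (zer_subspace ax0) /= subrr subr_eq0 => /eqP.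
Qed.

Lemma net_plane_data i j u : i != j -> coord_plane i j u -> cube r u -> net_coef i j u = c0 i j u.
Proof.
move=> ij; rewrite coord_planeE => pl /cube_ocube Qu.
rewrite /net_coef net_jet_data //= ?(negbTE ij) ?zer_subspace // => k /and3P[_ ki kj].
by apply: pl; rewrite !inE negb_or ki.
Qed.

Lemma net_conjugate_net : conjugate_net_with_data f0 c0 r net_map net_coef.
Proof.
split.
- split=> [|i j _]; exists (ocube rho); split.
  + exact: ocube_open.
  + exact: cube_ocube.
  + exact: (@smooth_along_row_jet R m N rho (fun c => J (xF c)) (fun c => @net_jets (xF c))
      (fun c => @net_jet_bounded (xF c))).
  + exact: ocube_open.
  + exact: cube_ocube.
  + exact: (@smooth_along_jet R m rho (J (xC i j)) (@net_jets _) (@net_jet_bounded _)).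
- exact: net_conjugate_system.
- exact: net_axis_data.
- by move=> i j ij u; exact: net_plane_data.
Qed.

End ContinuousNet.

Section OneSided.
Context {R : realType}.

(** At an end point of the interval a two-sided derivative is still determined by the values on one
    side. This is how values on the closed cube determine tangent vectors at its boundary. *)
Lemma is_derive_itv_eq0 (h : R -> R) t l r : 0 < r -> 0 <= t <= r ->
  (forall s, 0 <= s <= r -> h s = 0) -> is_derive t 1 h l -> l = 0.
Proof.
move=> r0 tr h0 [d <-]; apply/eqP/negPn/negP => l0.
have := d; rewrite /derivable => /cvg_ex [l' c].
have El : 'D_1 h t = l' by rewrite /derive; exact: (cvg_lim _ c).
rewrite El in l0.
have e0 : 0 < `|l'| by rewrite normr_gt0.
have := (@cvgrPdist_lt _ _ _ _ _ _ _).1 c _ e0.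
move=> [dl /= dl0 H].
pose s := Num.min (dl / 2) (r / 2).
have s0 : 0 < s by rewrite lt_min !divr_gt0.
have sd : s < dl by rewrite gt_min ltr_pdivrMr // ltr_pMr // ltr1n.
have sr : s <= r / 2 by rewrite ge_min lexx orbT.
have [q [q0 qd qt]] : exists q, [/\ q != 0, `|q| < dl & 0 <= t + q <= r].
  have [tr2|tr2] := leP t (r / 2).
    by exists s; rewrite gt_eqF // ger0_norm ?(ltW s0) //; split=> //; lra.
  by exists (- s); rewrite oppr_eq0 gt_eqF // normrN ger0_norm ?(ltW s0) //; split=> //; lra.
have Bq : ball 0 dl q by rewrite /ball /= sub0r normrN.
have := H q Bq q0.
have Eq : h (q *: 1 + t) = 0 by apply: h0; rewrite /GRing.scale /= mulr1 addrC.
by rewrite /= Eq (h0 _ tr) subrr scaler0 subr0 ltxx.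
Qed.

End OneSided.

Section RightHandSides.
Context {R : realType} {m N : nat}.
Variables (z : @idx m N -> 'rV[R]_m -> R) (u : 'rV[R]_m).

Lemma bilf_qrhsF c i : bilf qrhs (xF c) i z z u = z (xW i c) u * z (@xOne m N) u.
Proof. by rewrite /bilf /bil big_cons big_nil /= expr0 mul1r addr0. Qed.

Lemma bilf_qrhsW i j c : bilf qrhs (xW j c) i z z u =
  z (xC j i) u * z (xW i c) u + z (xC i j) u * z (xW j c) u.
Proof. by rewrite /bilf /bil !big_cons big_nil /= !expr0 !mul1r addr0. Qed.

Lemma bilf_qrhsC i j k : bilf qrhs (xC j k) i z z u =
  z (xC i j) u * z (xC j k) u + z (xC j i) u * z (xC i k) u - z (xC j k) u * z (xC i k) u.
Proof. by rewrite /bilf /bil !big_cons big_nil /= !expr0 expr1 !mul1r addr0 mulN1r addrA. Qed.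

End RightHandSides.

Section Uniqueness.
Context {R : realType} {m N : nat}.
Implicit Types (i j : 'I_m) (u v : 'rV[R]_m).
Local Notation e_ := (@basis_vec R m).
Local Notation idx := (@idx m N).

Lemma smooth_on_derivable (V : normedModType R) (r : R) (F : 'rV[R]_m -> V) s i u :
  smooth_on (cube r) F -> cube r u -> derivable (iter_partial s F) u (e_ i).
Proof.
move=> [U [_ sU H]] Qu; have as_ : all (fun i => i \in [set: 'I_m]%SET) s.
  by apply/allP => j _; rewrite inE.
by have [_] := H s as_; apply; [exact: sU | rewrite inE].
Qed.

Lemma smooth_on_bounded (V : normedModType R) (r : R) (F : 'rV[R]_m -> V) s :
  smooth_on (cube r) F -> exists2 M, 0 <= M & forall u, cube r u -> `|iter_partial s F u| <= M.
Proof.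
move=> [U [_ sU H]]; have as_ : all (fun i => i \in [set: 'I_m]%SET) s.
  by apply/allP => j _; rewrite inE.
have [cF _] := H s as_.
have cK : compact (cube r : set 'rV[R]_m).
  have -> : (cube r : set 'rV[R]_m) = [set u | forall k, [set` `[0, r]] (u 0 k)].
    by apply/seteqP; split=> u /= Hu k; have := Hu k; rewrite in_itv.
  by apply: (@rV_compact R m (fun=> [set` `[0, r]])) => k; exact: segment_compact.
have [M [_ HM]] := compact_bounded (continuous_compact (continuous_subspaceW sU cF) cK).
exists (`|M| + 1) => [|u Qu]; first by rewrite addr_ge0.
apply: (HM (`|M| + 1)); last by exists u.
by rewrite ltr_pwDr // ler_norm.
Qed.

Variables (f0 : 'rV[R]_m -> 'rV[R]_N) (c0 : 'I_m -> 'I_m -> 'rV[R]_m -> R) (r : R).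
Hypotheses (m_gt0 : (0 < m)%N) (r_gt0 : 0 < r).

Definition net_state (f : 'rV[R]_m -> 'rV[R]_N) (c : 'I_m -> 'I_m -> 'rV[R]_m -> R) (a : idx) u : R :=
  match a with
  | inl (inl (inl _)) => 1
  | inl (inl (inr n)) => f u 0 n
  | inl (inr (i, n)) => partial i f u 0 n
  | inr (i, j) => if i == j then 0 else c i j u
  end.

Lemma net_state_solution f c : conjugate_net_with_data f0 c0 r f c ->
  cube_solution qev qrhs r (net_state f c).
Proof.
move=> [[sf sc] [Ef Ec] _ _].
move=> [[[[]|n]|[j n]]|[j k]] i u ai Qu.
- by rewrite /bilf /bil big_nil; exact: is_derive_cst.
- rewrite bilf_qrhsF /= mulr1; apply: coord_is_derive; apply: derivableP.
  exact: (@smooth_on_derivable _ r _ [::]).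
- have ij : i != j by [].
  have ji : j != i by rewrite eq_sym.
  have sd : derivable (partial j f) u (e_ i) by exact: (@smooth_on_derivable _ r _ [:: j]).
  have d : is_derive u (e_ i) (fun w => partial j f w 0 n) (partial i (partial j f) u 0 n).
    by apply: coord_is_derive; exact: derivableP.
  have E : partial i (partial j f) u 0 n = c j i u * partial i f u 0 n + c i j u * partial j f u 0 n.
    have lin (p q : R) (x y : 'rV[R]_N) : (p *: x + q *: y) 0 n = p * x 0 n + q * y 0 n.
      by rewrite !mxE.
    by rewrite Ef // lin.
  by rewrite bilf_qrhsW /= (negbTE ij) (negbTE ji) -E.
- have /and3P[jk ij ik] := ai; have ji : j != i by rewrite eq_sym.
  rewrite bilf_qrhsC /= (negbTE jk) (negbTE ij) (negbTE ji) (negbTE ik) -(Ec i j k ij jk ik u Qu).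
  have d : derivable (c j k) u (e_ i) by exact: (@smooth_on_derivable _ r _ [::] _ _ (sc j k jk)).
  have -> : net_state f c (inr (j, k)) = c j k by apply/funext => v; rewrite /= (negbTE jk).
  exact: DeriveDef.
Qed.

Lemma net_state_bounded f c : conjugate_net_with_data f0 c0 r f c ->
  exists2 B, 0 <= B & forall a u, cube r u -> `|net_state f c a u| <= B.
Proof.
move=> [[sf sc] _ _ _].
have H (a : idx) : exists M, 0 <= M /\ forall u, cube r u -> `|net_state f c a u| <= M.
  case: a => [[[[]|n]|[j n]]|[j k]].
  - by exists 1; split=> // u _; rewrite /= normr1.
  - have [M M0 HM] := smooth_on_bounded [::] sf; exists M; split=> // u Qu.
    by apply: le_trans (coord_norm_le _ _) (HM u Qu).
  - have [M M0 HM] := smooth_on_bounded [:: j] sf; exists M; split=> // u Qu.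
    by apply: le_trans (coord_norm_le _ _) (HM u Qu).
  - have [->|jk] := eqVneq j k; first by exists 0; split=> // u _; rewrite /= eqxx normr0.
    have [M M0 HM] := smooth_on_bounded [::] (sc j k jk); exists M; split=> // u Qu.
    by rewrite /= (negbTE jk); exact: HM.
have [F HF] := ex_choice H; exists (\sum_a F a) => [|a u Qu].
  by rewrite sumr_ge0 // => a _; have [] := HF a.
have [F0 Fu] := HF a; apply: le_trans (Fu u Qu) _.
by rewrite (bigD1 a) //= lerDl sumr_ge0 // => b _; have [] := HF b.
Qed.

Lemma partial_axis_eq (f f' : 'rV[R]_m -> 'rV[R]_N) i u : axis i u -> cube r u ->
  derivable f u (e_ i) -> derivable f' u (e_ i) ->
  (forall v, axis i v -> cube r v -> f' v = f v) -> partial i f' u = partial i f u.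
Proof.
move=> ax Qu df df' E; apply/rowP => n; apply/eqP; rewrite -subr_eq0; apply/eqP.
have Eu : 0 + u 0 i *: e_ i = u.
  apply/rowP => k; rewrite lineE mxE add0r.
  by have [->|/ax ->] := eqVneq k i; rewrite ?mulr1 ?mulr0.
apply: (@is_derive_itv_eq0 R (fun t => f' (0 + t *: e_ i) 0 n - f (0 + t *: e_ i) 0 n) (u 0 i) _ r) => //.
- move=> s sr.
  have lE k : (0 + s *: e_ i) 0 k = if k == i then s else 0.
    by rewrite lineE mxE add0r; case: (k == i); rewrite ?mulr1 ?mulr0.
  rewrite E ?subrr // => k; rewrite lE; first by move=> /negbTE ->.
  by case: ifP => _ //; rewrite lexx ltW.
- apply: (@is_derive_line R m (fun v => f' v 0 n - f v 0 n)); rewrite Eu.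
  have D (g : 'rV[R]_m -> 'rV[R]_N) : derivable g u (e_ i) ->
     is_derive u (e_ i) (fun v => g v 0 n) (partial i g u 0 n).
    by move=> dg; apply: coord_is_derive; exact: derivableP.
  by have d1 := D f df; have d2 := D f' df'; exact: is_deriveB.
Qed.

Lemma conjugate_net_unique f c f' c' :
  conjugate_net_with_data f0 c0 r f c -> conjugate_net_with_data f0 c0 r f' c' ->
  (forall u, cube r u -> f' u = f u) /\
  (forall i j, i != j -> forall u, cube r u -> c' i j u = c i j u).
Proof.
move=> H H'.
have [B B0 HB] := net_state_bounded H; have [B' B'0 HB'] := net_state_bounded H'.
have [[sf _] _ af pc] := H; have [[sf' _] _ af' pc'] := H'.
have SD (a : idx) u : cube r u -> (forall i, qev a i -> u 0 i = 0) ->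
    net_state f' c' a u = net_state f c a u.
  case: a => [[[[]|n]|[j n]]|[j k]] Qu u0 //=.
  (* The value of [f] at the origin is prescribed through the axes, and [0 < m] provides one. *)
  - pose i0 := Ordinal m_gt0.
    have a0 : axis i0 u by move=> k _; exact: u0.
    by rewrite (af i0) // (af' i0).
  - have aj : axis j u by move=> k kj; exact: u0.
    rewrite (_ : partial j f' u = partial j f u) //; apply: partial_axis_eq => //.
    + exact: (@smooth_on_derivable _ r _ [::] _ _ sf).
    + exact: (@smooth_on_derivable _ r _ [::] _ _ sf').
    + by move=> v av Qv; rewrite (af j) // (af' j).
  - case: (boolP (j == k)) => // jk.
    have pl : coord_plane j k u.
      by move=> l lj lk; apply: u0 => /=; rewrite jk lj lk.
    by rewrite pc // pc'.
have U (a : idx) u (Qu : cube r u) : net_state f' c' a u = net_state f c a u.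
  apply: (@cube_unique R m _ qev qrhs qrhs_size r (B + B')) => //.
  - by rewrite addr_ge0.
  - exact: net_state_solution.
  - exact: net_state_solution.
  - by move=> b v Qv; rewrite (le_trans (HB b v Qv)) // lerDl.
  - by move=> b v Qv; rewrite (le_trans (HB' b v Qv)) // lerDr.
split=> [u Qu|i j ij u Qu]; first by apply/rowP => n; exact: (U (xF n)).
by have := U (xC i j) u Qu; rewrite /= (negbTE ij).
Qed.

End Uniqueness.

(** * Canonical discrete nets *)

Section DiscreteNet.
Context {R : realType} {m N : nat}.
Local Notation pts := ('I_m -> nat).
Implicit Types (i j k : 'I_m) (u v : 'rV[R]_m) (n : pts).
Local Notation e_ := (@basis_vec R m).
Local Notation idx := (@idx m N).

Variables (eps r : R) (K : nat).
Hypotheses (eps_gt0 : 0 < eps) (epsK : eps * K%:R <= r) (epsK1 : r < eps * K.+1%:R).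

Definition coords u : pts := fun k => Num.truncn (u 0 k / eps).

Lemma coordsK n : coords (lat eps n) = n.
Proof.
apply/funext => k; rewrite /coords mxE mulrAC mulfV ?gt_eqF // mul1r.
by rewrite natrK.
Qed.

Lemma lat_in_cube n : box K (fun=> 0%N) n <-> cube r (lat eps n).
Proof.
split=> H k; have := H k; rewrite mxE ?addn0.
  move=> nK; rewrite mulr_ge0 ?(ltW eps_gt0) //=; apply: le_trans epsK.
  by rewrite ler_wpM2l ?(ltW eps_gt0) // ler_nat.
move=> /andP[_ h]; rewrite -ltnS -(ltr_nat R) -(ltr_pM2l eps_gt0).
exact: le_lt_trans h epsK1.
Qed.

Lemma lat_lattice n : lattice eps (lat eps n).
Proof. by move=> k; exists (n k); rewrite mxE. Qed.

Lemma lat_in_lattice_cube n : lattice_cube eps r (lat eps n) <-> box K (fun=> 0%N) n.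
Proof.
split=> [[_ /lat_in_cube]//|Hn]; split; first exact: lat_lattice.
exact/lat_in_cube.
Qed.

Lemma lattice_cube_lat u : lattice_cube eps r u -> exists2 n, u = lat eps n & box K (fun=> 0%N) n.
Proof.
move=> [Lu Qu]; have [z Hz] := ex_choice Lu.
have E : u = lat eps (fun k => `|z k|%N).
  apply/rowP => k; rewrite mxE Hz; congr (_ * _).
  have /andP[u0 _] := Qu k; rewrite Hz pmulr_rge0 // ler0z in u0.
  by rewrite natr_absz ger0_norm.
exists (fun k => `|z k|%N) => //; apply/lat_in_cube; rewrite -E.
exact: Qu.
Qed.

Lemma square_in_lat i j n : square_in eps r i j (lat eps n) <-> box K (inc j (inc i (fun=> 0%N))) n.
Proof.
rewrite /square_in /= -!lat_inc !lat_in_lattice_cube.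
by split=> [[_ H]|H]; [|split] => l; have := H l; rewrite /inc; clear; lia.
Qed.

Lemma box_in_lat i j k n :
  box_in eps r i j k (lat eps n) <-> box K (inc i (inc k (inc j (fun=> 0%N)))) n.
Proof.
rewrite /box_in /= -!lat_inc !lat_in_lattice_cube.
by split=> [[_ H]|H]; [|split] => l; have := H l; rewrite /inc; clear; lia.
Qed.

Lemma diffq_lat (V : normedModType R) (F : 'rV[R]_m -> V) i n :
  diffq eps i F (lat eps n) = eps^-1 *: (F (lat eps (inc i n)) - F (lat eps n)).
Proof. by rewrite /diffq /shift_at lat_inc. Qed.

Variables (f0 : 'rV[R]_m -> 'rV[R]_N) (c0 : 'I_m -> 'I_m -> 'rV[R]_m -> R).
Hypothesis data : smooth_data f0 c0.
Variables (D : R) (centred : bool).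
Hypotheses (m_gt0 : (0 < m)%N) (D_ge0 : 0 <= D) (r_eps : r + eps < 1).
Hypothesis data_bound : forall (a : idx) u, ocube 1 u -> `|smooth_net_data f0 c0 a u| <= D.
Let beta := 8 * D + 1.
Hypotheses (small_eps : 8 * beta * eps <= 1) (small_r : 32 * beta * (m%:R * r) <= 1)
  (small_r' : 4 * D * r <= 1) (small_B : 6 * eps * (1 + D + 4 * D + 10 * beta) <= 1).

Definition coef_data i j n : R :=
  smooth_net_data f0 c0 (xC i j : idx) (sample_point centred eps i j (lat eps n)).
(** Difference quotients of the curves in place of tangent vectors, so that summing the edges
    reproduces [f0] exactly at the lattice points of the axes; see [sol_axis]. *)
Definition tangent_data i (c : 'I_N) n : R :=
  eps^-1 * (axis_curve f0 i c (lat eps (inc i n)) - axis_curve f0 i c (lat eps n)).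
Definition origin_data (c : 'I_N) : R := f0 0 0 c.
Local Notation dd := (@net_data R m N coef_data tangent_data origin_data).
Local Notation sol_ := (@net_sol R m N eps coef_data tangent_data origin_data).

Lemma sample_ocube i j n : i != j -> box K (fun=> 0%N) n ->
  ocube 1 (sample_point centred eps i j (lat eps n)).
Proof.
move=> ij /lat_in_cube Qn k; have /andP[h1 h2] := Qn k.
have e0 := eps_gt0; have re := r_eps.
rewrite /sample_point; case: centred; last by rewrite ger0_norm //; lra.
rewrite !lineE.
have [ki|ki] := eqVneq k i; first subst k.
  by rewrite (negbTE ij) mulr1 mulr0 addr0 ger0_norm; lra.
by case: (k == j); rewrite ?mulr1 ?mulr0 ger0_norm; lra.
Qed.

Lemma coef_data_bound i j n : i != j -> box K (fun=> 0%N) n -> `|coef_data i j n| <= D.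
Proof. by move=> ij Hn; apply: data_bound; exact: sample_ocube. Qed.

Lemma tangent_data_bound i c n : box K (fun=> 0%N) n -> `|tangent_data i c n| <= D.
Proof.
move=> /lat_in_cube Qn; rewrite /tangent_data lat_inc.
have [_ [_ dC]] := axis_along data i c.
have M : `|axis_curve f0 i c (lat eps n + eps *: e_ i) - axis_curve f0 i c (lat eps n)| <= `|eps| * D.
  apply: mvt_bound_ex => t t01; exists (smooth_net_data f0 c0 (xW i c) (lat eps n + (t * eps) *: e_ i)) => //.
  apply: data_bound => k; rewrite lineE.
  have /andP[h1 h2] := Qn k; have /andP[t0 t1] := t01.
  have q0 : 0 <= t * eps by rewrite mulr_ge0 // ltW.
  have q1 : t * eps <= eps by rewrite ler_piMl // ltW.
  by have re := r_eps; case: (k == i); rewrite ?mulr1 ?mulr0 ger0_norm; lra.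
rewrite normrM normfV (gtr0_norm eps_gt0) in M *.
by rewrite ler_pdivrMl.
Qed.

Lemma origin_data_bound c : `|origin_data c| <= D.
Proof.
apply: (@data_bound (xF c) 0) => k.
by rewrite mxE normr0.
Qed.

Definition dnet_state (fe : 'rV[R]_m -> 'rV[R]_N) (ce : 'I_m -> 'I_m -> 'rV[R]_m -> R)
  (a : idx) n : R :=
  match a with
  | inl (inl (inl _)) => 1
  | inl (inl (inr c)) => fe (lat eps n) 0 c
  | inl (inr (i, c)) => diffq eps i fe (lat eps n) 0 c
  | inr (i, j) => if i == j then 0 else ce i j (lat eps n)
  end.

Lemma dnet_state_solution fe ce : canonical_Qnet centred f0 c0 eps r fe ce ->
  lattice_solution qev qrhs qell eps K (dnet_state fe ce).
Proof.
move=> [[Ef Ec] _ _].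
move=> [[[[]|c]|[j c]]|[j k]] i n ai Bn; rewrite /dbilf ?big_cons ?big_nil /delta /=.
- by rewrite subrr mulr0.
- by rewrite expr0 mul1r mulr1 addr0 diffq_lat !mxE.
- have ij : i != j by [].
  rewrite !expr0 !mul1r addr0 eq_sym (negbTE ij).
  have Sn : square_in eps r i j (lat eps n).
    by apply/square_in_lat; move: Bn; rewrite /= incC.
  have := Ef i j ij _ Sn => /rowP /(_ c); rewrite [in X in X -> _]diffq_lat => E.
  by rewrite mxE mxE [X in _ * (_ + X)]mxE [X in _ = X]mxE [X in _ = X + _]mxE [X in _ = _ + X]mxE in E.
- have /and3P[jk ij ik] := ai; rewrite (negbTE jk) !expr0 expr1 !mul1r addr0.
  have ji : j != i by rewrite eq_sym.
  rewrite (negbTE ij) (negbTE ji) (negbTE ik) mulN1r addrA.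
  have Sn : box_in eps r i j k (lat eps n) by apply/box_in_lat.
  have := Ec i j k ij jk ik _ Sn; rewrite diffq_lat /shift_at -!lat_inc => E.
  exact: E.
Qed.

Lemma lat_axis i n : (forall k, k != i -> n k = 0%N) -> axis i (lat eps n).
Proof. by move=> n0 k ki; rewrite mxE n0 // mulr0. Qed.

Lemma axis_curve_axis i c u : axis i u -> axis_curve f0 i c u = f0 u 0 c.
Proof. by rewrite axisE => /zer_subspace E; rewrite /axis_curve E. Qed.

Lemma coef_data_plane i j n : i != j -> (forall k, k != i -> k != j -> n k = 0%N) ->
  coef_data i j n = c0 i j (sample_point centred eps i j (lat eps n)).
Proof.
move=> ij n0; rewrite /coef_data /= (negbTE ij) zer_subspace // => k.
rewrite !inE negb_or => /andP[ki kj].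
have n0k : lat eps n 0 k = 0 by rewrite mxE n0 // mulr0.
by rewrite /sample_point; case: centred; rewrite // !lineE (negbTE ki) (negbTE kj) n0k !mulr0 !addr0.
Qed.

Lemma dnet_state_data fe ce : canonical_Qnet centred f0 c0 eps r fe ce ->
  forall a n, box K (qell a) n -> (forall k, qev a k -> n k = 0%N) ->
  dnet_state fe ce a n = dd a n.
Proof.
move=> [_ Df Dc] [[[[]|c]|[i c]]|[i j]] n Bn n0 //=.
- have l0 : lat eps n = 0 by apply/rowP => k; rewrite !mxE n0 // mulr0.
  by rewrite (Df (Ordinal m_gt0)) ?l0 //; [move=> k _; rewrite mxE | rewrite -l0; apply/lat_in_lattice_cube].
- have n0' k : k != i -> inc i n k = 0%N by move=> ki; rewrite /inc (negbTE ki) addn0; exact: n0.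
  have Bi : box K (fun=> 0%N) (inc i n) by rewrite -box_incE.
  have Bn0 : box K (fun=> 0%N) n by move=> k; apply: leq_trans (Bi k); rewrite leq_add2r leq_addr.
  rewrite diffq_lat /tangent_data !axis_curve_axis; [|exact: lat_axis|exact: lat_axis].
  rewrite (Df i) ?(Df i); [by rewrite !mxE|exact: lat_axis|exact/lat_in_lattice_cube|exact: lat_axis|exact/lat_in_lattice_cube].
- case: (boolP (i == j)) => // ij.
  have n0' k : k != i -> k != j -> n k = 0%N by move=> ki kj; apply: n0; rewrite /= ij ki.
  rewrite coef_data_plane // Dc //; last exact/square_in_lat.
  by move=> k ki kj; rewrite mxE n0' // mulr0.
Qed.

(** An arbitrary canonical net carries no a priori bound, but [lattice_unique] asks for one only of
    the constructed solution. All canonical nets thereby inherit its uniform bound. *)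
Lemma dnet_state_eq fe ce : canonical_Qnet centred f0 c0 eps r fe ce ->
  forall a n, box K (qell a) n -> dnet_state fe ce a n = sol_ a n.
Proof.
move=> H a n Bn.
have B0 : 0 <= 1 + D + 4 * D + 10 * beta.
  by rewrite /beta; have := D_ge0; lra.
have T := @lattice_unique R m _ qev qrhs qell qrhs_size qrhs_levels eps _ K sol_ (dnet_state fe ce)
  eps_gt0 B0 small_B.
apply: T => //.
- move=> b i p bi; exact: (@net_sol_eq R m N eps r D D D K _ _ _ eps_gt0 epsK D_ge0 D_ge0 small_eps
    small_r small_r' coef_data_bound tangent_data_bound origin_data_bound).
- exact: dnet_state_solution.
- move=> b p Bp p0; rewrite dnet_state_data //; symmetry.
  exact: (@net_sol_data R m N eps r D D D K _ _ _ eps_gt0 epsK D_ge0 D_ge0 small_eps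
    small_r small_r' coef_data_bound tangent_data_bound origin_data_bound).
- move=> b p; exact: (@net_sol_bound R m N eps r D D D K _ _ _ eps_gt0 epsK D_ge0 D_ge0 D_ge0 small_eps
    small_r small_r' coef_data_bound tangent_data_bound origin_data_bound).
Qed.

Definition sol_map u : 'rV[R]_N := \row_c sol_ (xF c) (coords u).
Definition sol_coef i j u : R := sol_ (xC i j) (coords u).

Lemma sol_mapE n : sol_map (lat eps n) = \row_c sol_ (xF c) n.
Proof. by apply/rowP => c; rewrite !mxE coordsK. Qed.

Lemma sol_coefE i j n : sol_coef i j (lat eps n) = sol_ (xC i j) n.
Proof. by rewrite /sol_coef coordsK. Qed.

Lemma sol_eq (a : idx) i n : qev a i -> box K (inc i (qell a)) n ->
  delta eps i (sol_ a) n = dbilf qrhs a i sol_ sol_ n.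
Proof.
exact: (@net_sol_eq R m N eps r D D D K _ _ _ eps_gt0 epsK D_ge0 D_ge0 small_eps
    small_r small_r' coef_data_bound tangent_data_bound origin_data_bound).
Qed.

Lemma sol_initial (a : idx) n : box K (qell a) n -> (forall k, qev a k -> n k = 0%N) ->
  sol_ a n = dd a n.
Proof.
exact: (@net_sol_data R m N eps r D D D K _ _ _ eps_gt0 epsK D_ge0 D_ge0 small_eps
    small_r small_r' coef_data_bound tangent_data_bound origin_data_bound).
Qed.

Lemma diffq_sol_map i n : box K (inc i (fun=> 0%N)) n ->
  diffq eps i sol_map (lat eps n) = \row_c sol_ (xW i c) n.
Proof.
move=> Bn; rewrite diffq_lat !sol_mapE; apply/rowP => c; rewrite !mxE.
have := @sol_eq (xF c) i n isT Bn; rewrite /delta /dbilf big_cons big_nil /= => ->.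
by rewrite expr0 mul1r mulr1 addr0.
Qed.

Lemma sol_axis i p : (p <= K)%N -> forall c,
  sol_ (xF c) (fun k => if k == i then p else 0%N) = f0 (lat eps (fun k => if k == i then p else 0%N)) 0 c.
Proof.
move=> + c; pose w p : pts := fun k => if k == i then p else 0%N; rewrite -/(w p).
have wi p' : w p'.+1 = inc i (w p').
  by apply/funext => k; rewrite /w /inc; case: (k == i); rewrite ?addn1 ?addn0.
have wax p' : axis i (lat eps (w p')).
  by apply: lat_axis => k; rewrite /w => /negbTE ->.
elim: p => [_|p IH pK].
  rewrite sol_initial /=; [|by move=> k; rewrite /w; case: ifP|by move=> k _; rewrite /w; case: ifP].
  by rewrite /origin_data; congr (f0 _ 0 c); apply/rowP => k; rewrite !mxE /w; case: ifP; rewrite mulr0.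
have Bw : box K (inc i (fun=> 0%N)) (w p).
  by move=> k; rewrite /w /inc; case: (k == i); rewrite ?add0n ?addn1.
have := diffq_sol_map Bw; rewrite diffq_lat !sol_mapE => /rowP /(_ c); rewrite !mxE -wi.
rewrite (IH (ltnW pK)).
rewrite [X in _ = X -> _](@sol_initial (xW i c)) //; last by move=> k ki; rewrite /w (negbTE ki).
rewrite [X in _ = X -> _]/= /tangent_data !axis_curve_axis -?wi //.
move=> /(congr1 (fun x => eps * x)); rewrite !mulrA mulfV ?gt_eqF // !mul1r.
by move=> /addIr.
Qed.

Lemma canonical_sol : canonical_Qnet centred f0 c0 eps r sol_map sol_coef.
Proof.
split; first split.
- move=> i j ij u Su; have [n un _] := lattice_cube_lat Su.1; rewrite un in Su *.
  have Bn := (square_in_lat i j n).1 Su.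
  have Bj : box K (inc j (fun=> 0%N)) n.
    by move=> k; apply: leq_trans (Bn k); rewrite leq_add2l /inc; clear; lia.
  have Bi : box K (inc i (fun=> 0%N)) n.
    by move=> k; apply: leq_trans (Bn k); rewrite leq_add2l /inc; clear; lia.
  have Bij : box K (inc j (fun=> 0%N)) (inc i n).
    by move=> k; have := Bn k; rewrite /inc; clear; lia.
  rewrite diffq_lat !diffq_sol_map // !sol_coefE; apply/rowP => c; rewrite !mxE.
  have Bs : box K (inc i (qell (xW j c))) n by rewrite /= incC.
  have := @sol_eq (xW j c) i n ij Bs; rewrite /delta /dbilf !big_cons big_nil => ->.
  by rewrite !expr0 !mul1r addr0.
- move=> i j k ij jk ik u Su; have [n un _] := lattice_cube_lat Su.1; rewrite un in Su *.
  have Bn := (box_in_lat i j k n).1 Su.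
  have ev : qev (xC j k : idx) i by rewrite /= jk ij ik.
  have := @sol_eq (xC j k) i n ev Bn.
  rewrite diffq_lat /shift_at -!lat_inc !sol_coefE /delta /dbilf !big_cons big_nil.
  rewrite !expr0 expr1 !mul1r mulN1r addr0 addrA; exact.
- move=> i u ax Lu; have [n un Bn] := lattice_cube_lat Lu; rewrite un in ax Lu *.
  have nE : n = (fun k => if k == i then n i else 0%N).
    apply/funext => k; have [->//|ki] := eqVneq k i.
    have := ax k ki; rewrite mxE => /eqP; rewrite mulf_eq0 gt_eqF //= pnatr_eq0.
    by move/eqP.
  rewrite sol_mapE nE; apply/rowP => c; rewrite mxE sol_axis //.
  by have := Bn i; rewrite addn0.
- move=> i j ij u pl Su; have [n un _] := lattice_cube_lat Su.1; rewrite un in pl Su *.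
  have Bn := (square_in_lat i j n).1 Su.
  have n0 k : k != i -> k != j -> n k = 0%N.
    move=> ki kj; have := pl k ki kj; rewrite mxE => /eqP; rewrite mulf_eq0 gt_eqF //= pnatr_eq0.
    by move/eqP.
  rewrite sol_coefE sol_initial //=.
    by rewrite (negbTE ij) coef_data_plane.
  by move=> k /and3P[_ ki kj]; exact: n0.
Qed.

Lemma canonical_unique fe ce : canonical_Qnet centred f0 c0 eps r fe ce ->
  (forall u, lattice_cube eps r u -> fe u = sol_map u) /\
  (forall i j, i != j -> forall u, square_in eps r i j u -> ce i j u = sol_coef i j u).
Proof.
move=> H; split=> [u Lu|i j ij u Su].
  have [n -> Bn] := lattice_cube_lat Lu; rewrite sol_mapE; apply/rowP => c; rewrite mxE.
  exact: (dnet_state_eq H (a := xF c)).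
have [n un _] := lattice_cube_lat Su.1; rewrite un in Su *.
have Bn := (square_in_lat i j n).1 Su.
have := dnet_state_eq H (a := xC i j) Bn; rewrite [LHS]/= (negbTE ij) => ->.
by rewrite sol_coefE.
Qed.

End DiscreteNet.

(** * Consistency and convergence *)

Section Sampled.
Context {R : realType} {m : nat}.
Local Notation pts := ('I_m -> nat).
Implicit Types (i j : 'I_m) (u v : 'rV[R]_m) (s : seq 'I_m) (n l : pts).
Local Notation e_ := (@basis_vec R m).

Variables (rho eps r mu : R) (K k : nat).
Hypotheses (eps_gt0 : 0 < eps) (mu_ge0 : 0 <= mu) (epsK : eps * K%:R <= r).
(** A margin for [k] difference quotients, the further quotient in the consistency error, and a
    shift by at most [eps]. *)
Hypothesis room : r < rho - eps * k.+2%:R.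
Local Notation C := (lattice_calculus eps K).
Local Notation Nk l f := (@nrm R m C mu k l f).
Let P := (1 + mu * m%:R) ^+ k.

Lemma growth_ge0 : 0 <= P.
Proof. by rewrite exprn_ge0 // addr_ge0 // mulr_ge0. Qed.

Lemma nrm_sampled l (g : 'rV[R]_m -> R) (M : R) : 0 <= M ->
  (forall s u, (size s <= k)%N -> ocube (rho - eps * k.+2%:R) u -> `|dqs eps s g u| <= M) ->
  Nk l (fun n => g (lat eps n)) <= M * P.
Proof.
move=> M0 H.
apply: (@nrm_le R m C mu mu_ge0 k l (fun n => g (lat eps n)) M M0 I) => s n sk Bn.
rewrite dfiter_lat; apply: H => //.
exact: (lat_cube eps_gt0 epsK room (box_le (box_lev Bn))).
Qed.

Lemma room_le (p : nat) (h : R) s u : (size s <= k)%N -> (p <= 1)%N -> h <= eps ->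
  ocube (rho - eps * k.+2%:R) u -> ocube (rho - eps * (size s + p)%:R - h) u.
Proof.
move=> sk p1 he; apply: ocubeW.
have : (size s + p)%:R + 1 <= k.+2%:R :> R by rewrite natr1 ler_nat; lia.
move/(ler_wpM2l (ltW eps_gt0)); rewrite mulrDr mulr1; lra.
Qed.

Variable J : seq 'I_m -> 'rV[R]_m -> R.
Variable M : R.
Hypotheses (M_ge0 : 0 <= M) (HJ : jets rho J).
Hypothesis HM : forall s v, (size s <= k.+2)%N -> ocube rho v -> `|J s v| <= M.

Lemma nrm_sampled_consistency l i :
  Nk l (fun n => dq eps i (J [::]) (lat eps n) - J [:: i] (lat eps n)) <= M * eps * P.
Proof.
apply: (@nrm_sampled l (fun v => dq eps i (J [::]) v - J [:: i] v)).
  by rewrite mulr_ge0 // ltW.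
move=> s u sk Qu; apply: (dqs_consistency eps_gt0 HJ).
  by move=> v Qv; apply: HM; rewrite // size_cat size_rev /= addn2 !ltnS.
have := @room_le 1 0 s u sk isT (ltW eps_gt0) Qu.
by rewrite subr0 addn1.
Qed.

Lemma nrm_sampled_shift l i (h : R) : 0 <= h <= eps ->
  Nk l (fun n => J [::] (lat eps n + h *: e_ i) - J [::] (lat eps n)) <= M * eps * P.
Proof.
move=> /andP[h0 he].
apply: (@nrm_sampled l (fun v => J [::] (v + h *: e_ i) - J [::] v)).
  by rewrite mulr_ge0 // ltW.
move=> s u sk Qu; rewrite dqsB (dqs_translate eps s (J [::])).
apply: le_trans (_ : h * M <= _); last by rewrite mulrC ler_wpM2l.
apply: (dqs_shift_bound eps_gt0 h0 HJ).
  by move=> v Qv; apply: HM; rewrite // size_cat size_rev /= addn1 ltnS (leq_trans sk).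
by have := @room_le 0 h s u sk isT he Qu; rewrite addn0.
Qed.

Lemma nrm_sampled_small l (B : R) : 0 <= B ->
  (forall v, ocube rho v -> `|J [::] v| <= B) ->
  Nk l (fun n => J [::] (lat eps n)) <= B + M * (P - 1).
Proof.
move=> B0 HB.
have rr : rho - eps * k.+2%:R <= rho by rewrite gerBl mulr_ge0 // ltW.
apply: (@nrm_small R m C mu mu_ge0 k l (fun n => J [::] (lat eps n)) B M B0 M_ge0 I).
  move=> n Bn; apply: HB; apply: (ocubeW rr).
  exact: (lat_cube eps_gt0 epsK room (box_le Bn)).
move=> s n _ sk Bn; rewrite dfiter_lat.
have Qn := lat_cube eps_gt0 epsK room (box_le (box_lev Bn)).
apply: (dqs_bound eps_gt0 HJ).
  by move=> v Qv; apply: HM; rewrite // size_rev (leq_trans sk) // ltnW.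
have := @room_le 0 0 s _ sk isT (ltW eps_gt0) Qn.
by rewrite subr0 addn0.
Qed.

End Sampled.

Section SystemConsistency.
Context {R : realType} {m : nat} {A : finType}.
Local Notation pts := ('I_m -> nat).
Variables (ev : A -> pred 'I_m)
  (rhs : A -> 'I_m -> seq (bool * option 'I_m * (A * A))).
Implicit Types (a b : A) (i j : 'I_m) (u v : 'rV[R]_m) (s : seq 'I_m) (n l : pts).
Hypothesis rhs_size : forall a i, (size (rhs a i) <= 3)%N.

Variables (rho eps r mu : R) (K k : nat).
Hypotheses (eps_gt0 : 0 < eps) (mu_ge0 : 0 <= mu) (epsK : eps * K%:R <= r).
Hypothesis room : r < rho - eps * k.+2%:R.
Local Notation C := (lattice_calculus eps K).
Local Notation Nk l f := (@nrm R m C mu k l f).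
Let P := (1 + mu * m%:R) ^+ k.

Variables (J : A -> seq 'I_m -> 'rV[R]_m -> R) (M B : R).
Hypotheses (M_ge0 : 0 <= M) (HJ : forall a, jets rho (J a)).
Hypothesis HM : forall a s v, (size s <= k.+2)%N -> ocube rho v -> `|J a s v| <= M.
Hypothesis J_system : forall a i u, ocube rho u -> ev a i ->
  J a [:: i] u = bilf rhs a i (J^~ [::]) (J^~ [::]) u.
Let X a n := J a [::] (lat eps n).
Hypotheses (B_ge0 : 0 <= B) (NX : forall l a, Nk l (X a) <= B).

(** Two errors of order [eps] add up: that of the difference quotient against the derivative, and,
    in each of at most three products, that of the shifted factor against the unshifted one. *)
Lemma nrm_system_consistency a i l : ev a i ->
  Nk l (fun n => delta eps i (X a) n - dbilf rhs a i X X n) <=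
  M * eps * P + 3 * (M * eps * P * B).
Proof.
move=> ai.
have P0 : 0 <= P := growth_ge0 k mu_ge0.
have c0 : 0 <= M * eps * P by rewrite !mulr_ge0 // ltW.
pose g n := dq eps i (J a [::]) (lat eps n) - J a [:: i] (lat eps n).
pose F (t : bool * option 'I_m * (A * A)) n : R :=
  (-1) ^+ t.1.1 * ((X t.2.1 n - X t.2.1 (osh t.1.2 n)) * X t.2.2 n).
have rr : rho - eps * k.+2%:R <= rho by rewrite gerBl mulr_ge0 // ltW.
have E : Nk l (fun n => delta eps i (X a) n - dbilf rhs a i X X n) =
    Nk l (fun n => g n + \sum_(t <- rhs a i) F t n).
  apply: (@nrm_ext R m C mu k l _ _ I I) => n Bn.
  have Qn : ocube rho (lat eps n).
    by apply: (ocubeW rr); exact: (lat_cube eps_gt0 epsK room (box_le Bn)).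
  rewrite /g (J_system Qn ai) /bilf /bil /dbilf /F /dq /delta /X lat_inc.
  rewrite -addrA; congr (_ + _); rewrite -!sumrN -big_split; apply: eq_bigr => t _ /=.
  by move: ((-1) ^+ _) => c; ring.
rewrite E; apply: le_trans (@nrmD R m C mu mu_ge0 k l g (fun n => \sum_(t <- rhs a i) F t n) I I) _.
apply: lerD.
  exact: (nrm_sampled_consistency eps_gt0 mu_ge0 epsK room M_ge0 (HJ a) (HM a)).
apply: le_trans (@nrm_sum R m C mu mu_ge0 k l _ (rhs a i) F (fun _ => I)) _.
apply: le_trans (_ : _ <= \sum_(t <- rhs a i) M * eps * P * B) _; last first.
  rewrite big_const_seq count_predT iter_addr_0 -[leLHS]mulr_natl.
  by apply: ler_wpM2r; [exact: mulr_ge0 | rewrite ler_nat].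
apply: ler_sum => t _.
apply: le_trans (@nrmZ R m C mu mu_ge0 k l _
  (fun n => (X t.2.1 n - X t.2.1 (osh t.1.2 n)) * X t.2.2 n) I) _.
rewrite normrX normrN1 expr1n mul1r.
apply: le_trans (@nrmM R m C mu mu_ge0 k l
  (fun n => X t.2.1 n - X t.2.1 (osh t.1.2 n)) (X t.2.2) I I) _.
apply: ler_pM; rewrite ?NX ?(nrm_ge0 mu_ge0) //.
case: (t.1.2) => [q|] /=.
  pose h n := J t.2.1 [::] (lat eps n + eps *: basis_vec q) - J t.2.1 [::] (lat eps n).
  have -> : Nk l (fun n => X t.2.1 n - X t.2.1 (inc q n)) = Nk l (fun n => - h n).
    by apply: (@nrm_ext R m C mu k l _ _ I I) => n _; rewrite /h /X lat_inc opprB.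
  apply: le_trans (@nrmN R m C mu mu_ge0 k l h I) _.
  apply: (nrm_sampled_shift eps_gt0 mu_ge0 epsK room M_ge0 (HJ t.2.1) (HM t.2.1)).
  by rewrite lexx andbT ltW.
have -> : Nk l (fun n => X t.2.1 n - X t.2.1 n) = Nk l (fun=> 0).
  by apply: (@nrm_ext R m C mu k l _ _ I I) => n _; rewrite subrr.
by apply: le_trans (@nrmC R m C mu k l 0) _; rewrite normr0.
Qed.

End SystemConsistency.

Section DataError.
Context {R : realType} {m N : nat}.
Local Notation pts := ('I_m -> nat).
Implicit Types (i j : 'I_m) (u v : 'rV[R]_m) (s : seq 'I_m) (n l : pts).
Local Notation e_ := (@basis_vec R m).
Local Notation idx := (@idx m N).

Lemma ex_common_bound (T : finType) (Q : T -> R -> Prop) :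
  (forall t M M', M <= M' -> Q t M -> Q t M') -> (forall t, exists2 M, 0 <= M & Q t M) ->
  exists2 M, 0 <= M & forall t, Q t M.
Proof.
move=> mono H; have H' t : exists M, 0 <= M /\ Q t M by have [M ? ?] := H t; exists M.
have [F HF] := ex_choice H'; exists (\sum_t F t).
  by rewrite sumr_ge0 // => t _; have [] := HF t.
move=> t; have [Ft Qt] := HF t; apply: mono Qt.
by rewrite (bigD1 t) //= lerDl sumr_ge0 // => t' _; have [] := HF t'.
Qed.

Lemma smoothG_jets rho (F : 'rV[R]_m -> R) : smoothG F -> jets rho (fun s => iter_partial s F).
Proof. by move=> sF s i u _; apply: smoothG_is_derive; exact: smooth_iter_partial. Qed.

Variables (f0 : 'rV[R]_m -> 'rV[R]_N) (c0 : 'I_m -> 'I_m -> 'rV[R]_m -> R).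
Hypothesis data : smooth_data f0 c0.
Variables (rho eps r mu M : R) (K k : nat) (centred : bool).
Hypotheses (eps_gt0 : 0 < eps) (eps_le1 : eps <= 1) (mu_ge0 : 0 <= mu) (epsK : eps * K%:R <= r).
Hypothesis room : r < rho - eps * k.+2%:R.
Local Notation C := (lattice_calculus eps K).
Local Notation Nk l f := (@nrm R m C mu k l f).
Let P := (1 + mu * m%:R) ^+ k.
Hypothesis M_ge0 : 0 <= M.
Hypothesis dataM : forall (a : idx) s u, (size s <= k.+2)%N -> ocube (rho + 1) u ->
  `|iter_partial s (smooth_net_data f0 c0 a) u| <= M.
Hypothesis curveM : forall i c s u, (size s <= k.+2)%N -> ocube (rho + 1) u ->
  `|iter_partial s (axis_curve f0 i c) u| <= M.

(** The tangent data err by a difference quotient against a derivative. Centred coefficients err by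
    a half step along [i] followed by one along [j], hence the factor 2. *)
Lemma nrm_data_error (a : idx) l :
  Nk l (fun n => net_data (coef_data eps f0 c0 centred) (tangent_data eps f0) (origin_data f0) a n
     - smooth_net_data f0 c0 a (lat eps n)) <= 2 * (M * eps * P).
Proof.
have P0 : 0 <= P := growth_ge0 k mu_ge0.
have c0' : 0 <= M * eps * P by rewrite !mulr_ge0 // ltW.
have cz (F : pts -> R) : (forall n, F n = 0) -> Nk l F <= 2 * (M * eps * P).
  move=> F0; have -> : Nk l F = Nk l (fun=> 0) by apply: (@nrm_ext R m C mu k l _ _ I I).
  by apply: le_trans (@nrmC R m C mu k l 0) _; rewrite normr0 mulr_ge0.
have r1 : rho <= rho + 1 by rewrite lerDl.
case: a => [[[[]|c]|[i c]]|[i j]].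
- by apply: cz => n; rewrite /= subrr.
- by apply: cz => n; rewrite /= /origin_data subrr.
- have [sA [_ dA]] := axis_along data i c.
  have T := @nrm_sampled_consistency R m rho eps r mu K k eps_gt0 mu_ge0 epsK room
    (fun s => iter_partial s (axis_curve f0 i c)) M M_ge0 (smoothG_jets sA)
    (fun s v sk Qv => curveM i c sk (ocubeW r1 Qv)) l i.
  apply: le_trans (_ : _ <= M * eps * P) _; last by rewrite -/P in c0' *; lra.
  apply: le_trans T; rewrite le_eqVlt; apply/orP; left; apply/eqP.
  apply: (@nrm_ext R m C mu k l _ _ I I) => n _ /=.
  by rewrite /tangent_data lat_inc /dq (partial_is_derive (dA _)).
- have [->|ij] := eqVneq i j; first by apply: cz => n; rewrite /= eqxx subrr.
  rewrite /net_data /coef_data (negbTE ij) /sample_point.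
  case: centred; last by apply: cz => n; rewrite subrr.
  set F := smooth_net_data f0 c0 (xC i j).
  have sF : smoothG F := smooth_net_dataP data _.
  have h01 : 0 <= eps / 2 <= eps by have := eps_gt0; move=> ?; apply/andP; split; lra.
  have T1 := @nrm_sampled_shift R m rho eps r mu K k eps_gt0 mu_ge0 epsK room
    (fun s => iter_partial s F) M M_ge0 (smoothG_jets sF)
    (fun s v sk Qv => dataM (xC i j) sk (ocubeW r1 Qv)) l i (eps / 2) h01.
  (* The half step along [j] starts from the point already moved along [i]. The bounds on the cube
     of radius [rho + 1] cover this translate, as [eps <= 1]. *)
  pose J s v := iter_partial s F (v + (eps / 2) *: e_ i).
  have J1 : jets rho J.
    move=> s q u _; apply: is_derive_translate.
    by apply: smoothG_is_derive; exact: smooth_iter_partial.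
  have J2 s v : (size s <= k.+2)%N -> ocube rho v -> `|J s v| <= M.
    move=> sk Qv; apply: (dataM (xC i j)) => //; apply: ocube_shift.
      by have /andP[] := h01.
    apply: ocubeW Qv; have := eps_le1; move: h01; lra.
  have T2 := @nrm_sampled_shift R m rho eps r mu K k eps_gt0 mu_ge0 epsK room
    J M M_ge0 J1 J2 l j (eps / 2) h01.
  have := @nrmD R m C mu mu_ge0 k l
    (fun n => J [::] (lat eps n + (eps / 2) *: e_ j) - J [::] (lat eps n))
    (fun n => F (lat eps n + (eps / 2) *: e_ i) - F (lat eps n)) I I.
  set N0 := nrm _ _ _ _ => H.
  apply: le_trans (_ : _ <= N0) _; last first.
    apply: le_trans H _; rewrite -/P in T1 T2; move: T1 T2 => /=; lra.
  rewrite le_eqVlt; apply/orP; left; apply/eqP.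
  apply: (@nrm_ext R m C mu k l _ _ I I) => n _ /=.
  rewrite /J /= -/F [lat eps n + (eps / 2) *: e_ j + _]addrAC; ring.
Qed.

End DataError.

Section NetConvergence.
Context {R : realType} {m N : nat}.
Local Notation pts := ('I_m -> nat).
Implicit Types (i j : 'I_m) (u v : 'rV[R]_m) (s : seq 'I_m) (n l : pts).
Local Notation e_ := (@basis_vec R m).
Local Notation idx := (@idx m N).

Variables (f0 : 'rV[R]_m -> 'rV[R]_N) (c0 : 'I_m -> 'I_m -> 'rV[R]_m -> R).
Hypothesis data : smooth_data f0 c0.
Variables (rho D r B1 : R) (centred : bool).
Hypotheses (rho_gt0 : 0 < rho) (D_ge0 : 0 <= D) (r_gt0 : 0 < r) (r_lt : r < rho).
Hypothesis data_bound : forall (a : idx) u, ocube rho u -> `|smooth_net_data f0 c0 a u| <= D.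
Hypothesis rho_ball : 2 * rho * m%:R * (3 * ((D + 2) * (D + 2))) <= 1.
Hypothesis rho_contr : 2 * rho * m%:R * (6 * (D + 2)) <= 2^-1.
Hypotheses (B1_ge0 : 0 <= B1) (r_m : 2 * r * m%:R <= 1).
Hypothesis r_small : 2 * r * m%:R * (3 * (2 * (D + 3) + (D + 3 + B1 + 1))) <= 2^-1.

Local Notation J := (net_jet f0 c0).
Local Notation dd eps :=
  (net_data (coef_data eps f0 c0 centred) (tangent_data eps f0) (origin_data f0)).

Lemma net_convergence k : exists Cc : R, \forall eps \near 0^'+, forall K (Z : idx -> pts -> R),
  eps * K%:R <= r -> lattice_solution qev qrhs qell eps K Z ->
  (forall a n, box K (qell a) n -> (forall p, qev a p -> n p = 0%N) -> Z a n = dd eps a n) ->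
  (forall a n, box K (qell a) n -> `|Z a n| <= B1) ->
  forall a s n, size s = k -> box K (@lev R m (lattice_calculus eps K) (qell a) s) n ->
  `|@dfiter R m (lattice_calculus eps K) s (fun n => Z a n - J a [::] (lat eps n)) n| <= Cc * eps.
Proof.
have JJ a : jets rho (J a).
  exact: (net_jets data rho_gt0 D_ge0 data_bound rho_ball rho_contr).
have JB a s : bounded_on (ocube rho) (J a s).
  exact: (net_jet_bounded data rho_gt0 D_ge0 data_bound rho_ball rho_contr).
have [M1 M10 H1] : exists2 M, 0 <= M & forall a : idx, forall s u, (size s <= k.+2)%N -> ocube rho u -> `|J a s u| <= M.
  apply: (ex_common_bound (Q := fun (a : idx) M => forall s u, (size s <= k.+2)%N -> ocube rho u -> `|J a s u| <= M)).
    by move=> a M M' MM H s u sk Qu; apply: le_trans MM; exact: H.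
  by move=> a; exact: (jets_all_bounded k.+2 (JJ a) (JB a)).
have [M2 M20 H2] : exists2 M, 0 <= M & forall a : idx, forall s u, (size s <= k.+2)%N -> ocube (rho + 1) u ->
    `|iter_partial s (smooth_net_data f0 c0 a) u| <= M.
  apply: (ex_common_bound (Q := fun (a : idx) M => forall s u, (size s <= k.+2)%N -> ocube (rho + 1) u ->
     `|iter_partial s (smooth_net_data f0 c0 a) u| <= M)).
    by move=> a M M' MM H s u sk Qu; apply: le_trans MM; exact: H.
  by move=> a; exact: (dfs_bound (rho + 1) k.+2 (smooth_net_dataP data a)).
have [M3 M30 H3] : exists2 M, 0 <= M & forall ic : 'I_m * 'I_N, forall s u, (size s <= k.+2)%N -> ocube (rho + 1) u ->
    `|iter_partial s (axis_curve f0 ic.1 ic.2) u| <= M.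
  apply: (ex_common_bound (Q := fun (ic : 'I_m * 'I_N) M => forall s u, (size s <= k.+2)%N -> ocube (rho + 1) u ->
    `|iter_partial s (axis_curve f0 ic.1 ic.2) u| <= M)).
    by move=> a M M' MM H s u sk Qu; apply: le_trans MM; exact: H.
  by move=> [i c]; have [sA _] := axis_along data i c; exact: (dfs_bound (rho + 1) k.+2 sA).
pose M := M1 + M2 + M3.
have M0 : 0 <= M by rewrite !addr_ge0.
have {}H1 a s u : (size s <= k.+2)%N -> ocube rho u -> `|J a s u| <= M.
  by move=> sk Qu; apply: le_trans (H1 a s u sk Qu) _; rewrite /M; lra.
have {}H2 (a : idx) s u : (size s <= k.+2)%N -> ocube (rho + 1) u -> `|iter_partial s (smooth_net_data f0 c0 a) u| <= M.
  by move=> sk Qu; apply: le_trans (H2 a s u sk Qu) _; rewrite /M; lra.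
have {}H3 i c s u : (size s <= k.+2)%N -> ocube (rho + 1) u -> `|iter_partial s (axis_curve f0 i c) u| <= M.
  by move=> sk Qu; apply: le_trans (H3 (i, c) s u sk Qu) _; rewrite /M; lra.
have e0 : 0 < (M + 1)^-1 by rewrite invr_gt0 ltr_wpDl.
have b0 : 0 < r / k.+1%:R by rewrite divr_gt0.
(* [mu] is fixed after the derivative bound [M], so that derivatives add at most [M / (M + 1) <= 1]
   to the norm of the sampled net and [mu * k%:R <= r]. *)
have [mu mu0 [mub mue]] := @small_weight R m%:R k _ _ (ler0n _ _) e0 b0.
have muk : r + mu * k%:R <= 2 * r.
  have : mu * k%:R <= r.
    move: mub; rewrite ler_pdivlMr // => mub; apply: le_trans mub.
    by rewrite ler_wpM2l ?(ltW mu0) // ler_nat.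
  lra.
have rk0 : 0 <= r + mu * k%:R by rewrite addr_ge0 ?mulr_ge0 // ltW.
pose P := (1 + mu * m%:R) ^+ k.
have P0 : 0 <= P := growth_ge0 k (ltW mu0).
(* [C0 * eps] dominates both the consistency error [M * eps * P + 3 * (M * eps * P * (D + 3))] and
   the data error [2 * (M * eps * P)], so it can serve as [kappa]. *)
pose C0 := M * P * (3 + 3 * (D + 3)).
have C00 : 0 <= C0 by rewrite /C0 !mulr_ge0 // addr_ge0 // mulr_ge0 // addr_ge0.
exists (4 * C0 / mu ^+ k).
near=> eps => K Z epsK Z_eq Z_data Z_bound a s n sk Bn.
have eps_gt0 : 0 < eps by near: eps; exact: nbhs_right_gt.
have eps_le1 : eps <= 1 by near: eps; exact: nbhs_right_le.
have room : r < rho - eps * k.+2%:R.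
  suff : eps < (rho - r) / k.+2%:R by rewrite ltr_pdivlMr //; lra.
  by near: eps; apply: nbhs_right_lt; rewrite divr_gt0 // subr_gt0.
have kappa_small : 8 * (C0 * eps) <= 1.
  suff : eps <= (8 * C0 + 1)^-1.
    move=> h; have : eps * (8 * C0 + 1) <= 1.
      by rewrite -ler_pdivlMr ?div1r // ltr_wpDl // mulr_ge0.
    have -> : eps * (8 * C0 + 1) = 8 * (C0 * eps) + eps by ring.
    lra.
  by near: eps; apply: nbhs_right_le; rewrite invr_gt0 ltr_wpDl // mulr_ge0.
pose X (a : idx) n := J a [::] (lat eps n).
have B0 : 0 <= D + 3 by rewrite addr_ge0.
have D2 : 0 <= D + 2 by rewrite addr_ge0.
have NX l b : @nrm R m (lattice_calculus eps K) mu k l (X b) <= D + 3.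
  have T := @nrm_sampled_small R m rho eps r mu K k eps_gt0 (ltW mu0) epsK room (J b) M M0
    (JJ b) (H1 b) l (D + 2) D2
    (net_jet_ball data rho_gt0 D_ge0 data_bound rho_ball rho_contr b).
  apply: le_trans T _; suff : M * (P - 1) <= 1 by rewrite -/P; lra.
  apply: le_trans (ler_wpM2l M0 mue) _.
  by rewrite ler_pdivrMr ?mul1r ?lerDl // ltr_wpDl.
have kap0 : 0 <= C0 * eps by rewrite mulr_ge0 // ltW.
have c00 : 0 <= M * eps * P by rewrite !mulr_ge0 // ltW.
have c01 : 0 <= M * eps * P * (D + 3) by rewrite mulr_ge0.
have kE : C0 * eps = 3 * (M * eps * P) + 3 * (M * eps * P * (D + 3)) by rewrite /C0; ring.
have Ne b i : qev b i -> @nrm R m (lattice_calculus eps K) mu k (inc i (qell b))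
    (fun n => delta eps i (X b) n - dbilf qrhs b i X X n) <= C0 * eps.
  move=> bi.
  have T := @nrm_system_consistency R m _ qev qrhs qrhs_size rho eps r mu K k eps_gt0 (ltW mu0) epsK
    room J M (D + 3) M0 JJ H1
    (net_jet_system data rho_gt0 D_ge0 data_bound rho_ball rho_contr) B0 NX b i (inc i (qell b)) bi.
  apply: le_trans T _; rewrite -/P kE; lra.
have Nd b : @nrm R m (lattice_calculus eps K) mu k (qell b)
    (fun n => Z b (zl (qev b) n) - X b (zl (qev b) n)) <= C0 * eps.
  pose g n := dd eps b n - smooth_net_data f0 c0 b (lat eps n).
  have -> : @nrm R m (lattice_calculus eps K) mu k (qell b)
      (fun n => Z b (zl (qev b) n) - X b (zl (qev b) n)) =
      @nrm R m (lattice_calculus eps K) mu k (qell b) (fun n => g (zl (qev b) n)).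
    apply: (@nrm_ext R m (lattice_calculus eps K) mu k (qell b) _ _ I I) => p Bp.
    have Bz := @box_zl m K (qev b) (qell b) p Bp.
    have z0 q : qev b q -> zl (qev b) p q = 0%N by rewrite /zl => ->.
    rewrite /g /X Z_data //; congr (_ - _).
    apply: (net_jet_data data rho_gt0 D_ge0 data_bound rho_ball rho_contr).
      exact: (lat_cube eps_gt0 epsK r_lt (box_le Bz)).
    by move=> q bq; rewrite mxE z0 // mulr0.
  apply: le_trans (@nrm_zl R m eps mu K (ltW mu0) k (qell b) (qev b) g) _.
  have T := @nrm_data_error R m N f0 c0 data rho eps r mu M K k centred eps_gt0 eps_le1 (ltW mu0)
    epsK room M0 H2 H3 b (qell b).
  apply: le_trans T _; rewrite -/P kE; lra.
have sm1 : (r + mu * k%:R) * m%:R <= 1.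
  by apply: le_trans r_m; rewrite ler_wpM2r.
have sm2 : (r + mu * k%:R) * m%:R * (3 * (2 * (D + 3) + (D + 3 + B1 + 1))) <= 2^-1.
  apply: le_trans r_small; rewrite ler_wpM2r //.
    have := D_ge0; have := B1_ge0; lra.
  by rewrite ler_wpM2r.
have T := @lattice_convergence R m _ qev qrhs qell qrhs_size qrhs_levels eps mu r K eps_gt0 (ltW mu0)
  epsK X Z (D + 3) B1 (C0 * eps) B0 B1_ge0 kap0 Z_eq k (fun b => NX (qell b) b) Ne Nd Z_bound sm1
  kappa_small sm2 k (leqnn k) a.
have sk' : (size s <= k)%N by rewrite sk.
have T2 := @nrm_pt R m (lattice_calculus eps K) mu (ltW mu0) k (qell a) (fun n => Z a n - X a n) s n I sk' Bn.
rewrite sk in T2; have := le_trans T2 T => T3.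
rewrite mulrAC ler_pdivlMr ?exprn_gt0 // mulrC.
by apply: le_trans T3 _; rewrite mulrA.
Unshelve. all: by end_near. Qed.

End NetConvergence.

(** * Multi-indices, mesh sizes and the conclusion *)

Section MeshConvergence.
Context {R : realType} {m N : nat}.
Local Notation pts := ('I_m -> nat).
Implicit Types (i j : 'I_m) (s : seq 'I_m) (n l : pts) (eps : R).

(** A multi-index as a word, since all estimates are indexed by words of directions. *)
Definition index_seq (alpha : 'I_m -> nat) : seq 'I_m :=
  flatten [seq nseq (alpha i) i | i <- enum 'I_m].

Lemma iter_diffqE (V : normedModType R) eps alpha (F : 'rV[R]_m -> V) :
  iter_diffq eps alpha F = foldr (diffq eps) F (index_seq alpha).
Proof.
rewrite /iter_diffq /index_seq; elim: (enum _) => [//|i s IH] /=.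
by rewrite foldr_cat -IH; elim: (alpha i) => [//|p /= ->].
Qed.

Lemma count_index_seq alpha k : count_mem k (index_seq alpha) = alpha k.
Proof.
rewrite /index_seq count_flatten -map_comp sumnE big_map big_enum /= (bigD1 k) //=.
rewrite count_nseq /= eqxx mul1n big1 ?addn0 // => i ik.
by rewrite count_nseq /= (negbTE ik).
Qed.

Lemma levE eps K l s k : (@lev R m (lattice_calculus eps K) l s) k = (l k + count_mem k s)%N.
Proof.
elim: s l => [|i s IH] l /=; first by rewrite addn0.
by rewrite /inc IH [i == k]eq_sym addnCA addnC.
Qed.

Lemma foldr_diffq_lat eps K s (F : 'rV[R]_m -> 'rV[R]_N) c n :
  foldr (diffq eps) F s (lat eps n) 0 c =
  @dfiter R m (lattice_calculus eps K) s (fun n => F (lat eps n) 0 c) n.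
Proof.
elim: s n => [//|i s IH] n /=.
by rewrite diffq_lat /delta -!IH !mxE.
Qed.

Lemma mesh_size (eps r : R) : 0 < eps -> 0 < r ->
  exists K : nat, eps * K%:R <= r /\ r < eps * K.+1%:R.
Proof.
move=> e0 r0; exists (Num.truncn (r / eps)).
have re : 0 <= r / eps by rewrite divr_ge0 // ltW.
have /andP[h1 h2] := Num.Theory.truncn_itv re.
split; first by rewrite mulrC -ler_pdivlMr.
by rewrite mulrC -ltr_pdivrMr.
Qed.

End MeshConvergence.

Lemma smooth_net_data_bounded (R : realType) (m N : nat)
  (f0 : 'rV[R]_m -> 'rV[R]_N) (c0 : 'I_m -> 'I_m -> 'rV[R]_m -> R) : smooth_data f0 c0 ->
  exists2 D, 0 <= D & forall (a : @idx m N) u, ocube 1 u -> `|smooth_net_data f0 c0 a u| <= D.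
Proof.
move=> data.
apply: (ex_common_bound (Q := fun (a : idx) M => forall u, ocube 1 u -> `|smooth_net_data f0 c0 a u| <= M)).
  by move=> a M M' MM H u Qu; apply: le_trans MM; exact: H.
move=> a; have [M M0 HM] := dfs_bound 1 0 (smooth_net_dataP data a).
by exists M => // u Qu; exact: (HM [::]).
Qed.

Theorem theorem3p7 (R : realType) (m N : nat) (m_gt0 : (0 < m)%N)
    (N_ge3 : (3 <= N)%N)
    (f0 : 'rV[R]_m -> 'rV[R]_N) (c0 : 'I_m -> 'I_m -> 'rV[R]_m -> R)
    (data : smooth_data f0 c0) (centred : bool) :
  exists2 r : R, 0 < r &
  exists (f : 'rV[R]_m -> 'rV[R]_N) (c : 'I_m -> 'I_m -> 'rV[R]_m -> R),
  [/\ conjugate_net_with_data f0 c0 r f c,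
      (forall f' c', conjugate_net_with_data f0 c0 r f' c' ->
        (forall u, cube r u -> f' u = f u) /\
        (forall i j, i != j -> forall u, cube r u -> c' i j u = c i j u)),
      (\forall eps \near 0^'+,
        exists (fe : 'rV[R]_m -> 'rV[R]_N)
               (ce : 'I_m -> 'I_m -> 'rV[R]_m -> R),
          canonical_Qnet centred f0 c0 eps r fe ce /\
          forall fe' ce', canonical_Qnet centred f0 c0 eps r fe' ce' ->
            (forall u, lattice_cube eps r u -> fe' u = fe u) /\
            (forall i j, i != j -> forall u, square_in eps r i j u ->
               ce' i j u = ce i j u)) &
      forall (feps : R -> 'rV[R]_m -> 'rV[R]_N)
             (ceps : R -> 'I_m -> 'I_m -> 'rV[R]_m -> R),
        (\forall eps \near 0^'+,
           canonical_Qnet centred f0 c0 eps r (feps eps) (ceps eps)) ->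
        cvg_smooth_O_eps r feps f].
Proof.
have [D D0 HD] := smooth_net_data_bounded data.
have m1 : 1 <= m%:R :> R by rewrite ler1n.
(* The constant comes from the most demanding condition, [h_conv]: with [a * (D + 1) ^+ 2 = 300^-1],
   one has [264 * (a * D) + 63 * a <= 132 * (2 * (a * D) + a) <= 132 / 300 < 2^-1]. *)
have [q qE] : exists q : R, q = 300 by exists 300.
pose rho : R := (q * m%:R * (D + 1) ^+ 2)^-1.
have den : 0 < q * m%:R * (D + 1) ^+ 2.
  have mp : 0 < m%:R :> R by rewrite ltr0n.
  have Dp : 0 < D + 1 by rewrite ltr_wpDl.
  have cp : 0 < q by rewrite qE ltr0n.
  exact: mulr_gt0 (mulr_gt0 cp mp) (exprn_gt0 2 Dp).
have rho0 : 0 < rho by rewrite invr_gt0.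
pose a := rho * m%:R.
have a0 : 0 < a by rewrite mulr_gt0 // (lt_le_trans ltr01).
have aD0 : 0 <= a * D by rewrite mulr_ge0 // ltW.
have aDD0 : 0 <= a * (D * D) by rewrite !mulr_ge0 // ltW.
have aE : a * (D * D) + 2 * (a * D) + a = 300^-1.
  have : rho * (q * m%:R * (D + 1) ^+ 2) = 1 by rewrite mulVf // gt_eqF.
  have -> : rho * (q * m%:R * (D + 1) ^+ 2) = q * (a * (D * D) + 2 * (a * D) + a).
    by rewrite /a; ring.
  rewrite qE => h; lra.
have rho_a : rho <= a by rewrite /a ler_peMr // ltW.
have rhoD : rho * D <= a * D by rewrite ler_wpM2r.
pose r := rho / 2.
have r0 : 0 < r by rewrite divr_gt0.
have r_lt : r < rho by rewrite /r; lra.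
have rho1 : rho <= 1 by lra.
have HDr : forall (b : @idx m N) u, ocube rho u -> `|smooth_net_data f0 c0 b u| <= D.
  by move=> b u Qu; apply: HD; exact: ocubeW Qu.
have h_ball : 2 * rho * m%:R * (3 * ((D + 2) * (D + 2))) <= 1.
  have -> : 2 * rho * m%:R * (3 * ((D + 2) * (D + 2))) = 6 * (a * (D * D) + 4 * (a * D) + 4 * a).
    by rewrite /a; ring.
  lra.
have h_contr : 2 * rho * m%:R * (6 * (D + 2)) <= 2^-1.
  have -> : 2 * rho * m%:R * (6 * (D + 2)) = 12 * (a * D) + 24 * a by rewrite /a; ring.
  lra.
have h_small_r : 32 * (8 * D + 1) * (m%:R * r) <= 1.
  have -> : 32 * (8 * D + 1) * (m%:R * r) = 128 * (a * D) + 16 * a by rewrite /r /a; field.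
  lra.
have h_small_r' : 4 * D * r <= 1.
  have -> : 4 * D * r = 2 * (rho * D) by rewrite /r; field.
  lra.
(* The bound of [net_sol_bound] when [D] bounds all the data, so that [beta = 8 * D + 1]. *)
pose B1 := 1 + D + 4 * D + 10 * (8 * D + 1).
have B10 : 0 <= B1 by rewrite /B1; lra.
have rE : 2 * r = rho by rewrite /r; field.
have h_rm : 2 * r * m%:R <= 1 by rewrite rE -/a; lra.
have h_conv : 2 * r * m%:R * (3 * (2 * (D + 3) + (D + 3 + B1 + 1))) <= 2^-1.
  rewrite rE -/a; have -> : a * (3 * (2 * (D + 3) + (D + 3 + B1 + 1))) = 264 * (a * D) + 63 * a.
    by rewrite /B1; ring.
  lra.
have p8 : 0 < 8 * (8 * D + 1) by lra.
have p6 : 0 < 6 * (B1 + 1) by lra.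
have small : \forall eps \near (0 : R)^'+, [/\ 0 < eps, r + eps < 1, 8 * (8 * D + 1) * eps <= 1 &
    6 * eps * B1 <= 1].
  near=> eps; have e0 : 0 < eps by near: eps; exact: nbhs_right_gt.
  split=> //.
  - suff : eps < 1 - rho by rewrite /r; lra.
    by near: eps; apply: nbhs_right_lt; lra.
  - rewrite mulrC -ler_pdivlMr // div1r; near: eps; apply: nbhs_right_le.
    by rewrite invr_gt0.
  - have : eps <= (6 * (B1 + 1))^-1 by near: eps; apply: nbhs_right_le; rewrite invr_gt0.
    rewrite -div1r ler_pdivlMr //.
    have -> : eps * (6 * (B1 + 1)) = 6 * eps * B1 + 6 * eps by ring.
    lra.
have conj_net : conjugate_net_with_data f0 c0 r (net_map f0 c0) (net_coef f0 c0).
  exact: (net_conjugate_net data rho0 D0 r_lt HDr h_ball h_contr).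
exists r => //; exists (net_map f0 c0), (net_coef f0 c0); split.
- exact: conj_net.
- by move=> f' c' H; exact: (conjugate_net_unique m_gt0 r0 conj_net H).
- apply: filterS small => eps [e0 re se sB].
  have [K [K1 K2]] := mesh_size e0 r0.
  exists (sol_map eps f0 c0 centred), (sol_coef eps f0 c0 centred); split.
    exact: (canonical_sol e0 K1 K2 data centred D0 re HD se h_small_r h_small_r').
  by move=> fe' ce' H;
    exact: (canonical_unique e0 K1 K2 data m_gt0 D0 re HD se h_small_r h_small_r' sB H).
- move=> feps ceps can alpha.
  pose s := index_seq alpha.
  have [C HC] := net_convergence data centred rho0 D0 r0 r_lt HDr h_ball h_contr B10 h_rm h_conv (size s).
  exists `|C|; apply: filterS3 small can HC => eps [e0 re se sB] cane HCe u Lu Lu'.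
  have [K [K1 K2]] := mesh_size e0 r0.
  have [n un Bn] := lattice_cube_lat e0 K1 K2 Lu; rewrite un in Lu' *.
  have Bs : box K (@lev R m (lattice_calculus eps K) (fun=> 0%N) s) n.
    have nE : lat eps n + eps *: \row_k (alpha k)%:R = lat eps (fun k => n k + alpha k)%N.
      by apply/rowP => k; rewrite !mxE natrD mulrDr.
    rewrite nE in Lu'; have := (lat_in_lattice_cube e0 K1 K2 _).1 Lu'.
    by move=> Bna k; rewrite levE count_index_seq add0n; have := Bna k; rewrite addn0.
  rewrite iter_diffqE [leLHS]mx_normrE; apply: bigmax_le => [|[x c] _].
    by rewrite mulr_ge0 // ltW.
  rewrite (ord1 x) {x} /= (foldr_diffq_lat eps K).
  apply: le_trans (_ : C * eps <= _); last by rewrite ler_wpM2r ?ler_norm // ltW.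
  pose Z := dnet_state eps (feps eps) (ceps eps).
  have Z_eq := dnet_state_solution e0 K1 K2 cane.
  have Z_data := dnet_state_data e0 K1 K2 m_gt0 cane.
  have Z_bound (b : @idx m N) p : box K (qell b) p -> `|Z b p| <= B1.
    (* The given net is replaced by the constructed one, which is the one with a known bound. *)
    move=> Bp; rewrite /Z (dnet_state_eq e0 K1 K2 data m_gt0 D0 re HD se h_small_r h_small_r' sB cane Bp).
    exact: (net_sol_bound e0 K1 D0 D0 D0 se h_small_r h_small_r'
      (coef_data_bound e0 K1 K2 centred re HD) (tangent_data_bound e0 K1 K2 data re HD) (origin_data_bound HD)).
  have T := HCe K Z K1 Z_eq Z_data Z_bound (xF c) s n erefl Bs.
  rewrite (_ : (fun p : 'I_m -> nat => (feps eps (lat eps p) - net_map f0 c0 (lat eps p)) 0 c) =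
    fun p => Z (xF c) p - net_jet f0 c0 (xF c) [::] (lat eps p)) //.
  by apply/funext => p; rewrite !mxE.
Unshelve. all: by end_near.
Qed.
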